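(* Let $p$ be a prime, $a\geq1$, $q=p^a$, let $n\geq 1$, $d\geq 2$ with $d\mid n$, and let $\lambda\in\mathbb{F}_q^N$. Let $f_\lambda=\sum_{j=1}^N\lambda_jx^{{\bf a}_j}\in\mathbb{F}_q[x_0,\dots,x_n]$ be homogeneous of degree $d$, $X_\lambda\subseteq\mathbb{P}^n$ its zero locus, and write $$Z(X_\lambda/\mathbb{F}_q,t)=\frac{P_\lambda(t)^{(-1)^n}}{(1-t)(1-qt)\cdots(1-q^{n-1}t)}.$$ Then, as power series in $t$ modulo $p$ (coefficientwise), $$P_\lambda(q^{-\mu}t)\equiv\frac{\det\big(I-t\bar A({\lambda}^{p^{a-1}})\bar A({\lambda}^{p^{a-2}})\cdots\bar A({\lambda})\big)}{\prod_{i=0}^n\big(1-t\,\bar g_i(\lambda^{p^{a-1}})\bar g_i(\lambda^{p^{a-2}})\cdots\bar g_i(\lambda)\big)}\pmod p.$$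
   Context: Here ${\bf a}_j=(a_{0j},\dots,a_{nj})\in\mathbb{N}^{n+1}$ with $\sum_i a_{ij}=d$, ${\bf a}_j^+=(a_{0j},\dots,a_{nj},1)\in\mathbb{N}^{n+2}$, and $\mu\ge0$ is defined by $\lceil (n+1)/d\rceil=\mu+1$. It is known that $P_\lambda(q^{-\mu}t)\in 1+t\mathbb{Z}[[t]]$. Let $U_{\min}$ be the set of $u\in\mathbb{N}^{n+2}$ with $\sum_{i=0}^nu_i=du_{n+1}$, all $u_i>0$, and $u_{n+1}=\mu+1$; $A(\Lambda)=[A_{uv}(\Lambda)]_{u,v\in U_{\min}}$ with $$A_{uv}(\Lambda)=(-1)^{\mu+1}\sum_{\nu\in\mathbb{N}^N,\ \sum_j\nu_j{\bf a}_j^+=pu-v}\frac{\Lambda^{\nu}}{\nu_1!\cdots\nu_N!},$$ which has $p$-integral coefficients, and $\bar A$ is its reduction mod $p$. For $i=0,\dots,n$ let $u^{(i)}=(1,\dots,1,0,1,\dots,1,\mu)\in\mathbb{N}^{n+2}$ (coordinates indexed $0,\dots,n+1$, with $0$ in coordinate $i$), and $$g_i(\Lambda)=(-1)^{\mu}\sum_{\nu\in\mathbb{N}^N,\ \sum_j\nu_j{\bf a}_j^+=(p-1)u^{(i)}}\frac{\Lambda^\nu}{\nu_1!\cdots\nu_N!}\in(\mathbb{Q}\cap\mathbb{Z}_p)[\Lambda],$$ with $\bar g_i$ its reduction mod $p$. $\lambda^{p^k}$ means $(\lambda_1^{p^k},\dots,\lambda_N^{p^k})$. *)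

(* Defs.v *)
From HB Require Import structures.
From mathcomp Require Import all_boot all_order all_algebra.
Set Implicit Arguments. Unset Strict Implicit. Unset Printing Implicit Defensive.
Import Order.TTheory GRing.Theory Num.Theory.
Local Open Scope ring_scope.

Definition fps (R : Type) := nat -> R.

Definition fps_mul (R : pzSemiRingType) (f g : fps R) : fps R :=
  fun m => \sum_(k < m.+1) f k * g (m - k)%N.

Definition fps_one (R : pzSemiRingType) : fps R := fun m => (m == 0%N)%:R.

Definition fps_pow (R : pzSemiRingType) (f : fps R) (k : nat) : fps R :=
  iter k (fps_mul f) (@fps_one R).

(* exp of a power series with zero constant term, over Q *)
Definition fps_exp (f : fps rat) : fps rat :=
  fun m => \sum_(k < m.+1) fps_pow f k m / (k`!)%:R.

Fixpoint fps_inv_aux (R : unitRingType) (f : fps R) (fuel m : nat) : R :=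
  match fuel with
  | 0 => 0
  | fuel'.+1 =>
      if m == 0%N then (f 0%N)^-1
      else - (f 0%N)^-1 * \sum_(k < m) f (m - k)%N * fps_inv_aux f fuel' k
  end.
Definition fps_inv (R : unitRingType) (f : fps R) : fps R :=
  fun m => fps_inv_aux f m.+1 m.

Definition fps_of_poly (R : nzSemiRingType) (P : {poly R}) : fps R := fun m => P`_m.

Definition feval (F L : finFieldType) (n N : nat) (iota : {rmorphism F -> L})
  (A : 'I_N -> 'I_n.+1 -> nat) (lam : 'I_N -> F) (x : 'I_n.+1 -> L) : L :=
  \sum_(j < N) iota (lam j) * \prod_(i < n.+1) x i ^+ A j i.

(* number of points of X_lam in P^n(L): nonzero zeros in L^{n+1} modulo L^* *)
Definition proj_count (F L : finFieldType) (n N : nat) (iota : {rmorphism F -> L})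
  (A : 'I_N -> 'I_n.+1 -> nat) (lam : 'I_N -> F) : nat :=
  (#|[set x : {ffun 'I_n.+1 -> L} |
       [exists i, x i != 0%R] && (feval iota A lam x == 0%R)]| %/ (#|L| - 1))%N.

(* L s is a field with q^(s+1) elements, so N_s = #X_lam(F_{q^s}) is computed in L (s-1) *)
Definition Npts (F : finFieldType) (L : nat -> finFieldType)
  (iota : forall s, {rmorphism F -> L s}) (n N : nat)
  (A : 'I_N -> 'I_n.+1 -> nat) (lam : 'I_N -> F) (s : nat) : nat :=
  proj_count (iota s.-1) A lam.

Definition zeta (F : finFieldType) (L : nat -> finFieldType)
  (iota : forall s, {rmorphism F -> L s}) (n N : nat)
  (A : 'I_N -> 'I_n.+1 -> nat) (lam : 'I_N -> F) : fps rat :=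
  fps_exp (fun s => if s == 0%N then 0 else (Npts iota A lam s)%:R / s%:R).

(* P_lam defined by  Z = P^{(-1)^n} / ((1-t)(1-qt)...(1-q^{n-1}t)),
   i.e.  P^{(-1)^n} = Z * prod_{i<n} (1 - q^i t) *)
Definition Pzeta (F : finFieldType) (L : nat -> finFieldType)
  (iota : forall s, {rmorphism F -> L s}) (q n N : nat)
  (A : 'I_N -> 'I_n.+1 -> nat) (lam : 'I_N -> F) : fps rat :=
  let ZQ := fps_mul (zeta iota A lam)
              (fps_of_poly (\prod_(i < n) (1 - ((q ^ i)%N)%:R *: 'X))) in
  if odd n then fps_inv ZQ else ZQ.

(* mu defined by ceil((n+1)/d) = mu + 1 *)
Definition mu (n d : nat) : nat := ((n.+1 + d.-1) %/ d).-1.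

(* reduction mod p of a p-integral rational number into F (char F = p) *)
Definition red (F : finFieldType) (r : rat) : F := (numq r)%:~R / (denq r)%:~R.

Definition aplus (n N : nat) (A : 'I_N -> 'I_n.+1 -> nat) (j : 'I_N) (i : 'I_n.+2) : nat :=
  if (i == n.+1 :> nat) then 1%N else A j (inord i).

Definition nubound (p n d : nat) : nat := (p * (mu n d).+1).+1.

(* sum over nu in N^N with  sum_j nu_j a_j^+ + w = target  of
   red(1/(nu_1!...nu_N!)) * lam'^nu.  The last coordinate forces
   sum_j nu_j <= target_(n+1) < nubound, so the bounded enumeration is complete
   for the targets used below. *)
Definition nusum (F : finFieldType) (p n d N : nat) (A : 'I_N -> 'I_n.+1 -> nat)
  (w target : 'I_n.+2 -> nat) (lam' : 'I_N -> F) : F :=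
  \sum_(nu : {ffun 'I_N -> 'I_(nubound p n d)}
          | [forall i : 'I_n.+2,
               (\sum_(j < N) (nu j : nat) * aplus A j i + w i == target i)%N])
     red F (1 / (\prod_(j < N) (nu j)`!)%:R) * \prod_(j < N) lam' j ^+ nu j.

Definition ubound (n d : nat) : nat := (d * (mu n d).+1).+1.

Definition Umin (n d : nat) : seq {ffun 'I_n.+2 -> 'I_(ubound n d)} :=
  filter (fun u : {ffun 'I_n.+2 -> 'I_(ubound n d)} =>
     [&& (\sum_(i < n.+2 | (i : nat) != n.+1) (u i : nat) == d * u ord_max)%N,
         [forall i, 0 < (u i : nat)]%N & (u ord_max == (mu n d).+1 :> nat)])
    (enum {ffun 'I_n.+2 -> 'I_(ubound n d)}).

Definition u_default (n d : nat) : {ffun 'I_n.+2 -> 'I_(ubound n d)} := [ffun => ord0].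

Definition Abar_entry (F : finFieldType) (p n d N : nat) (A : 'I_N -> 'I_n.+1 -> nat)
  (u v : {ffun 'I_n.+2 -> 'I_(ubound n d)}) (lam' : 'I_N -> F) : F :=
  (-1) ^+ (mu n d).+1 *
  nusum p d A (fun i => v i : nat) (fun i => (p * u i)%N) lam'.

Definition Abar (F : finFieldType) (p n d N : nat) (A : 'I_N -> 'I_n.+1 -> nat)
  (lam' : 'I_N -> F) : 'M[F]_(size (Umin n d)) :=
  \matrix_(i, j) Abar_entry p A (nth (u_default n d) (Umin n d) i)
                                (nth (u_default n d) (Umin n d) j) lam'.

Definition uvec (n d : nat) (i : 'I_n.+1) (c : 'I_n.+2) : nat :=
  if (c == n.+1 :> nat) then mu n d else if (c == i :> nat) then 0%N else 1%N.

Definition gbar (F : finFieldType) (p n d N : nat) (A : 'I_N -> 'I_n.+1 -> nat)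
  (i : 'I_n.+1) (lam' : 'I_N -> F) : F :=
  (-1) ^+ mu n d * nusum p d A (fun _ => 0%N) (fun c => ((p - 1) * uvec d i c)%N) lam'.

Definition frobk (F : finFieldType) (N p k : nat) (lam : 'I_N -> F) : 'I_N -> F :=
  fun j => lam j ^+ (p ^ k).

Definition rhs_series (F : finFieldType) (p a n d N : nat) (A : 'I_N -> 'I_n.+1 -> nat)
  (lam : 'I_N -> F) : fps F :=
  let M := \prod_(k < a) Abar p d A (frobk p (a.-1 - k)%N lam) in
  let num := \det (1%:M - 'X *: map_mx polyC M) in
  let den := \prod_(i < n.+1)
               (1 - (\prod_(k < a) gbar p d A i (frobk p (a.-1 - k)%N lam)) *: 'X) in
  fps_mul (fps_of_poly num) (fps_inv (fps_of_poly den)).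

(* Main.v *)
(* An additive character of F_(q^s) turns N_s into an exponential sum in x_0, ..., x_n, y.
   Writing the character with Dwork's splitting function E(gamma t), E the Artin-Hasse
   exponential and gamma^(p-1) ~ -p, and summing over Teichmueller points, this sum becomes
   a combination over I of {0, ..., n} of q^(s(n+1-#|I|)) times traces of s-th powers of
   Frobenius matrices indexed by the exponents u of weight u_(n+1) with u_i > 0 for i in I.
   Row u is divisible by p^(u_(n+1)), so that after division by q^(mu s) only the rows of
   minimal weight survive modulo p: those of U_min for I = {0, ..., n}, the row u^(i) when I
   is the complement of i, and none for smaller I because d >= 2.  To compare coefficients
   of P up to t^k it suffices to know N_s modulo p^K for s <= k and K large, so finite
   matrices over a localised cyclotomic ring replace completely continuous operators. *)
Require Import Defs.
From HB Require Import structures.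
From mathcomp Require Import all_boot all_order all_algebra all_field cyclic.
From mathcomp Require Import boolp.
From mathcomp Require Import ring lra zify.
Set Implicit Arguments. Unset Strict Implicit. Unset Printing Implicit Defensive.
Import Order.TTheory GRing.Theory Num.Theory.
Local Open Scope ring_scope.

(** * Integer polynomials and Frobenius congruences *)

(** Since $d\mid n$, [mu] is $m=n/d$, and an exponent positive on $I$ has weight $w$ with
    $dw\ge\#I$, hence $w\ge\#I+m-n$. The excess $w+n-\#I-m$ is the power of $p$ left in a row at
    each Frobenius step, once the factor $q^{s(n+1-\#I)}$ and the division by $q^{s(m+1)}$ are
    counted. The row also carries $\eta^w$ with $\eta=\gamma^{p-1}/p\equiv-1$; this is the origin of
    the signs $(-1)^{\mu+1}$ and $(-1)^\mu$ in $A_{uv}$ and $g_i$. The factors $1/\nu_j!$ are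
    Artin-Hasse coefficients: they agree with those of $\exp$ below index $p$, and in the surviving
    entries every $\nu_j$ is below $p$. Whether $I$ feeds the numerator or the denominator is
    decided by the parity of $n+\#I$. The obstacle is precision. Recovering $P$ from the counts runs
    through $kf_k=\sum_{i<k}h_{k-i}f_i$, which divides by $k$ at every step, and each Frobenius
    trace is known only up to a power of $p$. All losses are therefore bounded explicitly, and the
    truncation degree, the size of the matrices and the $p$-adic accuracy are fixed in terms of the
    single coefficient under study. *)

Section IntEval.
Variable R : comNzRingType.
Implicit Types (x : R) (P D : {poly int}).

Definition zev x P : R := (map_poly intr P).[x].

Lemma zevD x : {morph zev x : P D / P + D}.
Proof. by move=> P D; rewrite /zev rmorphD hornerD. Qed.
Lemma zevN x : {morph zev x : P / - P}.
Proof. by move=> P; rewrite /zev rmorphN hornerN. Qed.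
Lemma zevM x : {morph zev x : P D / P * D}.
Proof. by move=> P D; rewrite /zev rmorphM hornerM. Qed.
Lemma zevC x c : zev x c%:P = c%:~R.
Proof. by rewrite /zev map_polyC hornerC. Qed.
Lemma zev0 x : zev x 0 = 0. Proof. exact: zevC. Qed.
Lemma zev1 x : zev x 1 = 1. Proof. exact: zevC. Qed.
Lemma zev_nat x c : zev x c%:R = c%:R.
Proof. by rewrite /zev rmorph_nat -polyC_natr hornerC. Qed.
Lemma zevXn x k : zev x 'X^k = x ^+ k.
Proof. by rewrite /zev map_polyXn hornerXn. Qed.
Lemma zevX x k P : zev x (P ^+ k) = zev x P ^+ k.
Proof. by rewrite /zev rmorphXn horner_exp. Qed.
Lemma zev_sum x (I : Type) (r : seq I) (Q : pred I) (F : I -> {poly int}) :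
  zev x (\sum_(i <- r | Q i) F i) = \sum_(i <- r | Q i) zev x (F i).
Proof. by apply: (big_morph _ (zevD x) (zev0 x)). Qed.
Lemma zev_prod x (I : Type) (r : seq I) (Q : pred I) (F : I -> {poly int}) :
  zev x (\prod_(i <- r | Q i) F i) = \prod_(i <- r | Q i) zev x (F i).
Proof. by apply: (big_morph _ (zevM x) (zev1 x)). Qed.
Lemma zev_compXn x k P : zev x (P \Po 'X^k) = zev (x ^+ k) P.
Proof. by rewrite /zev map_comp_poly map_polyXn horner_comp hornerXn. Qed.
End IntEval.

Lemma zev_rmorph (R S : comNzRingType) (f : {rmorphism R -> S}) x P :
  f (zev x P) = zev (f x) P.
Proof.
rewrite /zev -horner_map -map_poly_comp; congr horner.
by apply: eq_map_poly => z /=; rewrite rmorph_int.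
Qed.


Lemma exprD_prime (R : comNzRingType) p (A B : R) : prime p ->
  exists V, (A + B) ^+ p = A ^+ p + B ^+ p + p%:R * V.
Proof.
case: p => [|q] // p_pr.
exists (\sum_(i < q) (A ^+ (q.+1 - i.+1) * B ^+ i.+1) *+ ('C(q.+1, i.+1) %/ q.+1)).
rewrite exprDn big_ord_recl big_ord_recr /= subn0 bin0 mulr1n expr0 mulr1 -addrA.
congr (_ + _); rewrite addrC /bump /= !add1n subnn binn expr0 mul1r mulr1n.
congr (_ + _); rewrite mulr_sumr; apply: eq_bigr => i _ /=.
rewrite /bump /= add1n mulrnAr mulr_natl -mulrnA mulnC divnK //.
by rewrite prime_dvd_bin //= ltnS ltn_ord.
Qed.

Lemma intr_expr_prime p (c : int) : prime p -> exists c', c ^+ p = c + p%:R * c'.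
Proof.
move=> p_pr; have : (p %| c ^+ p - c)%Z.
  rewrite (dvdz_pcharf (pchar_Fp p_pr)) rmorphB rmorphXn /=.
  by have := expf_card (c%:~R : 'F_p); rewrite card_Fp // => ->; rewrite subrr.
case/dvdzP=> q hq; exists q; rewrite mulrC natz -hq; ring.
Qed.

Lemma zpoly_frobenius p (P : {poly int}) : prime p ->
  exists U, P ^+ p = P \Po 'X^p + p%:R * U.
Proof.
move=> p_pr; elim/poly_ind: P => [|P c [U IH]].
  by exists 0; rewrite comp_poly0 mulr0 addr0 expr0n gtn_eqF ?prime_gt0.
have [V hV] := exprD_prime (P * 'X) c%:P p_pr.
have [c' hc] := intr_expr_prime c p_pr.
exists (U * 'X^p + c'%:P + V).
rewrite hV exprMn IH -rmorphXn /= hc comp_polyD comp_polyM comp_polyX comp_polyC.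
rewrite rmorphD rmorphM /= rmorph_nat; ring.
Qed.

(** Used with $p^k=\#E$ at a point $\omega$ with $\omega^{p^k}=\omega$: there $P(\omega)^{p^k}$ and
    $P(\omega)$ differ by a multiple of $p$. *)
Lemma zpoly_frobenius_iter p k (P : {poly int}) : prime p ->
  exists U, P ^+ (p ^ k) = P \Po 'X^(p ^ k) + p%:R * U.
Proof.
move=> p_pr; elim: k => [|k [U IH]].
  by exists 0; rewrite comp_polyXr expr1 mulr0 addr0.
have [U1 hU1] := exprD_prime (P \Po 'X^(p ^ k)) (p%:R * U) p_pr.
have [U2 hU2] := zpoly_frobenius (P \Po 'X^(p ^ k)) p_pr.
have p1 : p%:R ^+ p = p%:R * p%:R ^+ p.-1 :> {poly int}.
  by rewrite -exprS prednK ?prime_gt0.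
exists (U2 + p%:R ^+ p.-1 * U ^+ p + U1).
rewrite expnSr exprM IH hU1 hU2 exprMn p1 -comp_polyA comp_Xn_poly -exprM [(p * _)%N]mulnC.
ring.
Qed.

(** * A p-adic lift of a finite field inside the algebraic numbers *)

Section CyclotomicRoots.
Variables (E : finFieldType) (g : E) (n : nat).
Hypothesis g_prim : n.-primitive_root g.

Let n_gt0 : (0 < n)%N := prim_order_gt0 g_prim.

Lemma zev_Cyclotomic_root d : (0 < d)%N -> zev g 'Phi_d = 0 -> (n %| d)%N.
Proof.
move=> d_gt0 h; rewrite (prim_order_dvd g_prim) -subr_eq0.
have := congr1 (zev g) (prod_Cyclotomic d_gt0).
rewrite zevD zevN zev1 zevXn zev_prod => <-.
rewrite (big_rem d) /= ?h ?mul0r //.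
by rewrite -dvdn_divisors.
Qed.

Lemma prod_zev_eq0 (s : seq nat) : \prod_(d <- s) zev g 'Phi_d = 0 ->
  exists2 d, d \in s & zev g 'Phi_d = 0.
Proof.
elim: s => [|d s IH]; first by rewrite big_nil => /eqP; rewrite oner_eq0.
rewrite big_cons => /eqP; rewrite mulf_eq0 => /orP[/eqP h|/eqP/IH [d' h1 h2]].
  by exists d; rewrite ?inE ?eqxx.
by exists d'; rewrite ?inE ?h1 ?orbT.
Qed.

(** The product of the $\Phi_d$ with $d\mid pn$, $d\nmid n$ is
    $(X^{pn}-1)/(X^n-1)=\sum_{i<p}X^{ni}$, whose value at $g$ is $p=0$. Some factor $\Phi_d$ thus
    vanishes at $g$; then $n\mid d$, and $d=pn$ is the only possibility. *)
Lemma zev_Cyclotomic_pchar0 p : prime p -> p \in [pchar E] ->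
  zev g 'Phi_(p * n) = 0.
Proof.
move=> p_pr pE; have p_gt0 := prime_gt0 p_pr.
have pn_gt0 : (0 < p * n)%N by rewrite muln_gt0 p_gt0.
have : \prod_(d <- divisors (p * n) | ~~ (d %| n)%N) 'Phi_d
       = \sum_(i < p) 'X^(n * i) :> {poly int}.
  apply: (@mulfI _ ('X^n - 1)); first by rewrite monic_neq0 ?monicXnsubC.
  rewrite -{1}(prod_Cyclotomic n_gt0).
  have -> : \prod_(d <- divisors n) 'Phi_d
      = \prod_(d <- divisors (p * n) | (d %| n)%N) 'Phi_d.
    rewrite -[RHS]big_filter; apply: perm_big; apply: uniq_perm.
    - exact: divisors_uniq.
    - by rewrite filter_uniq ?divisors_uniq.
    move=> d; rewrite mem_filter -!dvdn_divisors //.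
    by case: (boolP (d %| n)%N) => //= dn; rewrite dvdn_mull.
  transitivity (\prod_(d <- divisors (p * n)) 'Phi_d).
    by rewrite [RHS](bigID (fun d => (d %| n)%N)).
  rewrite prod_Cyclotomic // mulnC exprM.
  rewrite subrX1; congr (_ * _).
  by apply: eq_bigr => i _; rewrite -exprM.
move/(congr1 (zev g)); rewrite zev_prod zev_sum.
under [RHS]eq_bigr => i _ do rewrite zevXn exprM (prim_expr_order g_prim) expr1n.
rewrite sumr_const card_ord (pcharf0 pE) -big_filter.
case/prod_zev_eq0 => d; rewrite mem_filter -dvdn_divisors // => /andP[ndn dpn] h.
have d_gt0 := dvdn_gt0 pn_gt0 dpn.
have /dvdnP[k hk] := zev_Cyclotomic_root d_gt0 h.
move: dpn; rewrite hk dvdn_pmul2r // => kp.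
have /orP[/eqP k1|/eqP k1] : (k == 1%N) || (k == p) by case/primeP: p_pr => _; apply.
  by move: ndn; rewrite hk k1 mul1n dvdnn.
by rewrite -k1 -hk.
Qed.
End CyclotomicRoots.

(** $\Phi_n$ is monic and is the minimal polynomial of $z$ over the rationals, so it generates the
    integer relations of $z$. This makes $z\mapsto g$ a well-defined ring morphism from
    $\mathbb{Z}[z]$ to [E]. *)
Lemma zev_cyclotomic_transfer (E : fieldType) (g : E) n (z : algC) :
  n.-primitive_root z -> zev g 'Phi_n = 0 ->
  forall P, zev z P = 0 -> zev g P = 0.
Proof.
move=> z_prim g0 P Pz.
have mon := Cyclotomic_monic n.
rewrite (Pdiv.RingMonic.rdivp_eq mon P) zevD zevM g0 mulr0 add0r.
set r := Pdiv.Ring.rmodp _ _; suff -> : r = 0 by rewrite zev0.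
have rz : zev z r = 0.
  move: Pz; rewrite {1}(Pdiv.RingMonic.rdivp_eq mon P) zevD zevM -/r.
  have -> : zev z 'Phi_n = 0.
    apply/eqP; rewrite /zev (Cintr_Cyclotomic z_prim) -/(root _ _).
    by rewrite root_cyclotomic.
  by rewrite mulr0 add0r.
apply/eqP/negPn/negP => r_neq0.
have [q [Dq mq] dv] := minCpolyP z.
set rQ : {poly rat} := map_poly intr r.
have rQC : map_poly (ratr : rat -> algC) rQ = map_poly intr r.
  by rewrite /rQ -map_poly_comp; apply: eq_map_poly => c /=; rewrite ratr_int.
have : (q %| rQ).
  by rewrite -dv rootE rQC; apply/eqP.
have rQ0 : rQ != 0 by rewrite map_poly_eq0_id0 // intr_eq0 lead_coef_eq0.
move/(dvdp_leq rQ0).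
have -> : size rQ = size r by apply: size_map_inj_poly; [exact: intr_inj|].
have -> : size q = size 'Phi_n.
  rewrite -(size_map_poly (ratr : {rmorphism rat -> algC})) -Dq.
  rewrite (minCpoly_cyclotomic z_prim) -(Cintr_Cyclotomic z_prim).
  by apply: size_map_inj_poly; [exact: intr_inj|].
rewrite leqNgt => /negP; apply.
by rewrite Pdiv.Ring.ltn_rmodpN0 // monic_neq0.
Qed.

Section Local.
Variables (E : fieldType) (theta : algC) (g : E).

(** The graph of the residue map on the localisation of $\mathbb{Z}[\theta]$:
    $z=P(\theta)/D(\theta)$ and $e=P(g)/D(g)$ with $D(g)\ne0$. Working with the graph postpones the
    choice of a fraction; [locrel_fun] shows that the residue does not depend on it. *)
Definition locrel z e := exists P D,
  [/\ zev g D != 0, z * zev theta D = zev theta P & e * zev g D = zev g P].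

Lemma locrel_zev P : locrel (zev theta P) (zev g P).
Proof. by exists P, 1; rewrite !zev1 !mulr1 oner_eq0. Qed.

Lemma locrelD z e z' e' : locrel z e -> locrel z' e' -> locrel (z + z') (e + e').
Proof.
move=> [P [D [h1 h2 h3]]] [P' [D' [h1' h2' h3']]].
exists (P * D' + P' * D), (D * D'); rewrite !zevD !zevM mulf_neq0 //.
by split=> //; [rewrite -h2 -h2' | rewrite -h3 -h3']; ring.
Qed.

Lemma locrelM z e z' e' : locrel z e -> locrel z' e' -> locrel (z * z') (e * e').
Proof.
move=> [P [D [h1 h2 h3]]] [P' [D' [h1' h2' h3']]].
exists (P * P'), (D * D'); rewrite !zevM mulf_neq0 //.
by split=> //; [rewrite -h2 -h2' | rewrite -h3 -h3']; ring.
Qed.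

Lemma locrel_int c : locrel c%:~R c%:~R.
Proof. by have := locrel_zev c%:P; rewrite !zevC. Qed.

Lemma locrelN z e : locrel z e -> locrel (- z) (- e).
Proof.
move=> h; have := locrelM (locrel_int (-1)) h.
by rewrite !mulN1r.
Qed.

Lemma locrel_nat c : locrel c%:R c%:R.
Proof. by have := locrel_int c; rewrite !pmulrn. Qed.

Hypothesis transfer : forall P, zev theta P = 0 -> zev g P = 0.

Lemma locrel_fun z e e' : locrel z e -> locrel z e' -> e = e'.
Proof.
move=> [P [D [h1 h2 h3]]] [P' [D' [h1' h2' h3']]].
have /transfer : zev theta (P * D' - P' * D) = 0.
  by rewrite zevD zevN !zevM -h2 -h2' mulrAC subrr.
move/eqP; rewrite zevD zevN !zevM -h3 -h3' -!mulrA [zev g D' * _]mulrC -mulrBl.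
by rewrite mulf_eq0 mulf_eq0 (negPf h1) (negPf h1') !orbF subr_eq0 => /eqP.
Qed.

Lemma zev_neq0 D : zev g D != 0 -> zev theta D != 0.
Proof. by apply: contraNneq => /transfer ->. Qed.

Lemma locrelV z e : e != 0 -> locrel z e -> locrel z^-1 e^-1.
Proof.
move=> e0 [P [D [h1 h2 h3]]]; have Pg : zev g P != 0 by rewrite -h3 mulf_neq0.
have Dt := zev_neq0 h1; have Pt := zev_neq0 Pg.
have z0 : z != 0 by apply: contraNneq Pt => z0; rewrite -h2 z0 mul0r.
by exists D, P; rewrite -h2 -h3 !mulKf // mulf_neq0.
Qed.

Definition locpred : {pred algC} := fun z => `[< exists e, locrel z e >].

Lemma locpredP z : reflect (exists e, locrel z e) (z \in locpred).
Proof. exact: asboolP. Qed.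

Fact locpred_subring : subring_closed locpred.
Proof.
split; first by apply/locpredP; exists 1; exact: (locrel_nat 1).
  move=> x y /locpredP[e h] /locpredP[e' h']; apply/locpredP; exists (e - e').
  exact: locrelD h (locrelN h').
move=> x y /locpredP[e h] /locpredP[e' h']; apply/locpredP; exists (e * e').
exact: locrelM.
Qed.
HB.instance Definition _ := GRing.isSubringClosed.Build algC locpred locpred_subring.

Record locring := Locring { locval : algC; locvalP : locval \in locpred }.
HB.instance Definition _ := [isSub for locval].
HB.instance Definition _ := [Choice of locring by <:].
HB.instance Definition _ := [SubChoice_isSubComNzRing of locring by <:].

Lemma locres_ex (x : locring) : exists e, locrel (locval x) e.
Proof. exact/locpredP/locvalP. Qed.

Definition locres (x : locring) : E := projT1 (cid (locres_ex x)).

Lemma locresP x : locrel (locval x) (locres x).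
Proof. exact: projT2 (cid (locres_ex x)). Qed.

Lemma locresE x e : locrel (locval x) e -> locres x = e.
Proof. exact: locrel_fun (locresP x). Qed.

Lemma locres_zmod : zmod_morphism locres.
Proof.
move=> x y; apply: locresE; exact: locrelD (locresP _) (locrelN (locresP _)).
Qed.
Lemma locres_monoid : monoid_morphism locres.
Proof.
split; first exact/locresE/(locrel_nat 1).
by move=> x y; apply: locresE; exact: locrelM (locresP _) (locresP _).
Qed.
End Local.

(* [lring] is the localisation of a cyclotomic ring of order p (#|E| - 1) at a prime above p,
   with residue field E; it replaces the ramified extension of the Witt vectors of E, and
   [teich_trace] is what remains of completeness: traces of Teichmueller representatives
   are arbitrarily close to integers. *)
Record padic_lift (p : nat) (E : finFieldType) := PadicLift {
  lring :> comNzRingType;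
  lval : {rmorphism lring -> algC};
  lred : {rmorphism lring -> E};
  teich : E -> lring;
  lzeta : lring;
  lval_inj : injective lval;
  lred_inv : forall x, lred x != 0 -> exists y, x * y = 1;
  teichM : {morph teich : x y / x * y};
  teich0 : teich 0 = 0;
  teich1 : teich 1 = 1;
  lred_teich : forall x, lred (teich x) = x;
  lzeta_sum : \sum_(i < p) lzeta ^+ i = 0;
  teich_trace : forall r x, x ^+ (p ^ r) = x -> forall k,
    exists m y, \sum_(i < r) teich x ^+ (p ^ i) = m%:R + p%:R ^+ k * y }.

Lemma finField_prim_root (E : finFieldType) : exists g : E, #|E|.-1.-primitive_root g.
Proof.
have n_gt0 : (0 < #|E|.-1)%N by rewrite -subn1 subn_gt0 finNzRing_gt1.
pose rs := [seq x <- enum E | x != 0].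
have szrs : size rs = #|E|.-1.
  rewrite -(cardC1 (0 : E)) size_filter -sum1_count big_enum_cond /= sum1dep_card.
  by rewrite cardsE; apply: eq_card => x; rewrite !inE.
have := @has_prim_root E _ rs n_gt0; rewrite szrs leqnn filter_uniq ?enum_uniq //.
have -> : all (#|E|.-1).-unity_root rs.
  apply/allP => x; rewrite mem_filter => /andP[x0 _]; rewrite unity_rootE.
  apply/eqP/(mulfI x0); rewrite mulr1 -exprS prednK ?expf_card //.
  by rewrite (leq_trans _ (finNzRing_gt1 E)).
by move=> /(_ isT isT isT)/hasP[g _ hg]; exists g.
Qed.

(** The $p$ elements of the prime field already exhaust the roots of $X^p-X$. *)
Lemma pchar_expr_fixed (E : fieldType) p (x : E) : p \in [pchar E] -> x ^+ p = x ->
  exists m : nat, x = m%:R.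
Proof.
move=> pE xp; have p_pr := pcharf_prime pE.
pose s := [seq (i%:R : E) | i <- iota 0 p].
have us : uniq s.
  rewrite map_inj_in_uniq ?iota_uniq // => i j; rewrite !mem_iota /= !add0n => hi hj.
  wlog le : i j hi hj / (i <= j)%N => [hw h|].
    by case/orP: (leq_total i j) => le; [exact: hw | apply/esym/hw].
  move/esym/eqP; rewrite -subr_eq0 -natrB // -(dvdn_pcharf pE) => /dvdn_leq.
  rewrite subn_gt0 leq_subRL // => h; apply/eqP; rewrite eqn_leq le /= leqNgt.
  apply/negP => lt; have := h lt; rewrite leqNgt.
  by rewrite (leq_trans hj) ?leq_addl.
have [/mapP[i _ ->]|xs] := boolP (x \in s); first by exists i.
have sz : size ('X^p - 'X : {poly E}) = p.+1.
  by rewrite size_polyDl size_polyXn // size_polyN size_polyX ltnS prime_gt1.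
have := @max_poly_roots E ('X^p - 'X) (x :: s).
rewrite -size_poly_eq0 sz /= xs us /= size_map size_iota ltnn => h.
suff : false by []; apply: h => //; apply/andP; split.
  by rewrite rootE !hornerE xp subrr.
apply/allP=> _ /mapP[i _ ->]; rewrite rootE !hornerE.
by rewrite -(pFrobenius_autE pE) pFrobenius_aut_nat subrr.
Qed.

(** * Frobenius on the unramified part of the localised cyclotomic ring *)

Section Frobenius.
Variables (p M : nat) (E : finFieldType).
Hypotheses (p_pr : prime p) (cardE : #|E| = (p ^ M)%N).
Variables (omega : algC) (g : E).
Hypotheses (omegaQ : omega ^+ (p ^ M) = omega).
Hypothesis transfer : forall P, zev omega P = 0 -> zev g P = 0.

Let pE : p \in [pchar E]. Proof. exact: card_finPcharP cardE p_pr. Qed.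
Let M_gt0 : (0 < M)%N.
Proof.
by case: M cardE => // h; have := finNzRing_gt1 E; rewrite h.
Qed.

(** The maximal ideal is generated by $p$. If $z=P/D$ with $P(g)=0$, then
    $P(\omega)^{p^M}=P(\omega)+pU(\omega)$ gives $P(\omega)(1-P(\omega)^{p^M-1})=-pU(\omega)$, and
    the second factor reduces to 1, so it is an admissible denominator. *)
Lemma locrel_ker z : locrel omega g z 0 ->
  exists z' e', z = p%:R * z' /\ locrel omega g z' e'.
Proof.
move=> [P [D [h1 h2 h3]]]; move: h3; rewrite mul0r => /esym Pg.
have [U hU] := zpoly_frobenius_iter M P p_pr.
pose D' := D * (1 - P ^+ (p ^ M).-1).
have D'g : zev g D' != 0.
  rewrite /D' zevM zevD zevN zev1 zevX Pg expr0n.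
  have -> : ((p ^ M).-1 == 0)%N = false.
    by have := finNzRing_gt1 E; rewrite cardE; case: (p ^ M)%N => [|[]].
  by rewrite subr0 mulr1.
have D't := zev_neq0 transfer D'g.
exists (- zev omega U / zev omega D'), (- zev g U / zev g D').
split; last first.
  exists (- U), D'; split=> //; rewrite zevN mulfVK //.
apply: (mulIf D't); rewrite mulrA mulfVK //.
rewrite /D' zevM mulrA h2 zevD zevN zev1 mulrBr mulr1 mulrN -zevM -exprS.
rewrite prednK ?expn_gt0 ?prime_gt0 // hU zevD zevM zev_compXn omegaQ.
rewrite zev_nat; ring.
Qed.

Variable sigma : {rmorphism algC -> algC}.
Hypothesis sigma_omega : sigma omega = omega ^+ p.

Lemma locrel_sigma z e : locrel omega g z e -> locrel omega g (sigma z) (e ^+ p).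
Proof.
have frob P : zev (g ^+ p) P = zev g P ^+ p.
  by have := zev_rmorph (pFrobenius_aut pE) g P; rewrite /= ?pFrobenius_autE => ->.
move=> [P [D [h1 h2 h3]]]; exists (P \Po 'X^p), (D \Po 'X^p).
rewrite !zev_compXn !frob -h3 exprMn expf_neq0 //; split=> //.
by rewrite -sigma_omega -!zev_rmorph -rmorphM h2.
Qed.

(** Digit by digit: [sigma] lifts the Frobenius of [E], so the residue of a fixed element lies in
    the prime field. Subtracting an integer representative leaves a multiple of $p$ whose quotient
    is again fixed by [sigma]. *)
Lemma locrel_fixed z e : sigma z = z -> locrel omega g z e -> forall k,
  exists m z' e', z = m%:R + p%:R ^+ k * z' /\ locrel omega g z' e'.
Proof.
move=> sz hz k.
suff [m [z' [e' [h1 h2 _]]]] : exists m z' e',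
    [/\ z = m%:R + p%:R ^+ k * z', locrel omega g z' e' & sigma z' = z'].
  by exists m, z', e'.
elim: k => [|k [m [z' [e' [h1 h2 h3]]]]].
  by exists 0%N, z, e; rewrite mul1r add0r.
have := locrel_sigma h2; rewrite h3 => /(locrel_fun transfer h2)/esym/(pchar_expr_fixed pE).
move=> [m' he']; have := locrelD h2 (locrelN (locrel_nat omega g m')).
rewrite he' subrr => /locrel_ker[z2 [e2 [hz2 he2]]].
have p0 : p%:R != 0 :> algC by rewrite pnatr_eq0 -lt0n prime_gt0.
exists (m + p ^ k * m')%N, z2, e2; split=> //.
  rewrite h1 natrD natrM natrX exprSr -[in RHS]mulrA -hz2; ring.
apply: (mulfI p0); rewrite -hz2 -[X in X * sigma _](rmorph_nat sigma) -rmorphM -hz2.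
by rewrite rmorphB /= rmorph_nat h3.
Qed.
End Frobenius.

Section Construction.
Variables (p M : nat) (E : finFieldType).
Hypotheses (p_pr : prime p) (cardE : #|E| = (p ^ M)%N).
Let n := #|E|.-1.
Variables (theta : algC) (g : E).
Hypotheses (theta_prim : (p * n).-primitive_root theta) (g_prim : n.-primitive_root g).

Let pE : p \in [pchar E]. Proof. exact: card_finPcharP cardE p_pr. Qed.
Let M_gt0 : (0 < M)%N.
Proof.
by case: M cardE => // h; have := finNzRing_gt1 E; rewrite h.
Qed.
Let E_gt1 := finNzRing_gt1 E.
Let n_gt0 : (0 < n)%N. Proof. exact: prim_order_gt0 g_prim. Qed.
Let nE : n.+1 = #|E|. Proof. by rewrite /n prednK // ltnW. Qed.

Let transfer := zev_cyclotomic_transfer theta_prim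
  (zev_Cyclotomic_pchar0 g_prim p_pr pE).

Local Notation O := (locring theta g).

HB.instance Definition _ := GRing.isZmodMorphism.Build O E (@locres E theta g)
  (locres_zmod transfer).
HB.instance Definition _ := GRing.isMonoidMorphism.Build O E (@locres E theta g)
  (locres_monoid transfer).

Fact locval_zmod : zmod_morphism (@locval E theta g). Proof. by []. Qed.
Fact locval_monoid : monoid_morphism (@locval E theta g). Proof. by []. Qed.
HB.instance Definition _ := GRing.isZmodMorphism.Build O algC (@locval E theta g)
  locval_zmod.
HB.instance Definition _ := GRing.isMonoidMorphism.Build O algC (@locval E theta g)
  locval_monoid.

Lemma locring_lift z e : locrel theta g z e ->
  exists x : O, locval x = z /\ locres x = e.
Proof.
move=> h; have hz : z \in locpred theta g by apply/locpredP; exists e.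
by exists (Locring hz); split=> //; apply: (locresE transfer).
Qed.

(** Since $\gcd(\#E,pn)=p$, this power has order $n$; it still reduces to $g$ because $g^{\#E}=g$.
    Its powers serve as Teichmueller representatives. *)
Let omega := theta ^+ #|E|.

Let omega_prim : n.-primitive_root omega.
Proof.
have := exp_prim_root theta_prim #|E|.
have -> // : (p * n %/ gcdn #|E| (p * n) = n)%N.
have -> : gcdn #|E| (p * n) = p; last by rewrite mulKn ?prime_gt0.
have cop : coprime #|E| n by rewrite -nE coprimeSn.
rewrite Gauss_gcdl //; apply/gcdn_idPr.
by rewrite cardE -(prednK M_gt0) expnS dvdn_mulr.
Qed.

Let gQ : g ^+ #|E| = g. Proof. exact: expf_card. Qed.

Lemma padic_lift_exists_aux : inhabited (padic_lift p E).
Proof.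
have omegaQ : omega ^+ #|E| = omega.
  by rewrite -nE exprS (prim_expr_order omega_prim) mulr1.
have sub z e : locrel omega g z e -> locrel theta g z e.
  move=> [P [D [h1 h2 h3]]]; exists (P \Po 'X^#|E|), (D \Po 'X^#|E|).
  by rewrite !zev_compXn gQ.
have [w [hw1 hw2]] : exists w : O, locval w = omega /\ locres w = g.
  apply: locring_lift; have := locrel_zev theta g 'X^#|E|.
  by rewrite !zevXn gQ.
have [zt [hz1 hz2]] : exists x : O, locval x = theta ^+ n /\ locres x = 1.
  apply: locring_lift; have := locrel_zev theta g 'X^n.
  by rewrite !zevXn (prim_expr_order g_prim).
have vinj : injective (@locval E theta g) by exact: val_inj.
pose T (x : E) : O := if [pick i : 'I_n | x == g ^+ i] is Some i then w ^+ i else 0.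
have Tg k : T (g ^+ k) = w ^+ k.
  rewrite /T; case: pickP => [i /eqP h|/(_ (Ordinal (ltn_pmod k n_gt0)))]; last first.
    by rewrite /= prim_expr_mod // eqxx.
  apply: vinj; rewrite !rmorphXn /= hw1; apply/eqP.
  by rewrite (eq_prim_root_expr omega_prim) -(eq_prim_root_expr g_prim) h.
have gP (x : E) : x != 0 -> exists k, x = g ^+ k.
  move=> x0; have xn : x ^+ n = 1.
    by apply: (mulfI x0); rewrite mulr1 -exprS nE expf_card.
  by have [i ->] := prim_rootP g_prim xn; exists i.
have g0 : g != 0.
  by have := expf_eq0 g n; rewrite (prim_expr_order g_prim) oner_eq0 n_gt0 /= => <-.
have T0 : T 0 = 0.
  rewrite /T; case: pickP => // i; rewrite eq_sym expf_eq0 => /andP[_ /eqP h].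
  by rewrite h eqxx in g0.
have TM : {morph T : x y / x * y}.
  move=> x y; case: (eqVneq x 0) => [->|/gP[i ->]]; first by rewrite mul0r T0 mul0r.
  case: (eqVneq y 0) => [->|/gP[j ->]]; first by rewrite mulr0 T0 mulr0.
  by rewrite -exprD !Tg exprD.
have T1 : T 1 = 1 by have := Tg 0%N; rewrite !expr0.
have rT x : locres (T x) = x.
  case: (eqVneq x 0) => [->|/gP[i ->]]; first by rewrite T0 rmorph0.
  by rewrite Tg rmorphXn /= hw2.
have TX x k : T (x ^+ k) = T x ^+ k.
  by elim: k => [|k IH]; rewrite ?expr0 // !exprS TM IH.
apply: (inhabits (@PadicLift p E O (@locval E theta g) (@locres E theta g) T zt
  vinj _ TM T0 T1 rT _ _)).
- move=> x x0; have [y [hy1 hy2]] := locring_lift (locrelV transfer x0 (locresP x)).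
  exists y; apply: vinj; rewrite rmorphM /= hy1 divff //.
  apply: contraNneq x0 => hx; apply/eqP/(locresE transfer).
  by rewrite hx; exact: (locrel_nat theta g 0).
- apply: vinj; rewrite rmorph0 rmorph_sum /=.
  have th1 : theta ^+ n - 1 != 0.
    rewrite subr_eq0 -(prim_order_dvd theta_prim); apply/negP => /dvdn_leq.
    move/(_ n_gt0); rewrite leqNgt -{1}[n]mul1n ltn_pmul2r ?prime_gt1 //.
  apply: (mulfI th1); rewrite mulr0; under eq_bigr => i _ do rewrite rmorphXn /= hz1.
  by rewrite -subrX1 -exprM mulnC (prim_expr_order theta_prim) subrr.
move=> r x xr k.
have trw : forall P, zev omega P = 0 -> zev g P = 0.
  by move=> P; rewrite -zev_compXn => /transfer; rewrite zev_compXn gQ.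
have cpn : coprime p n.
  have : coprime (p ^ M) n by rewrite -cardE -nE coprimeSn.
  by rewrite coprime_pexpl.
have [s hs] := Qn_aut_exists cpn.
pose S := \sum_(i < r) T x ^+ (p ^ i).
(* The trace must be expressed through [omega] alone: the expansion in [locrel_fixed] holds in the
   unramified ring, not in the one that contains [theta]. *)
have [e he] : exists e, locrel omega g (locval S) e.
  have [P hP] : exists P, locval S = zev omega P.
    case: (eqVneq x 0) => [x0|/gP[i hi]].
      exists 0; rewrite zev0 /S rmorph_sum big1 // => i _.
      by rewrite x0 T0 expr0n expn_eq0 -[p == 0%N]negbK -lt0n prime_gt0 //= rmorph0.
    exists (\sum_(j < r) 'X^(i * p ^ j)); rewrite zev_sum /S rmorph_sum.
    apply: eq_bigr => j _; rewrite zevXn exprM -hw1 -!rmorphXn /=.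
    by rewrite hi Tg.
  by rewrite hP; exists (zev g P); exact: locrel_zev.
have sS : s (locval S) = locval S.
  have sT y : s (locval (T y)) = locval (T y) ^+ p.
    case: (eqVneq y 0) => [->|/gP[i ->]].
      by rewrite T0 !rmorph0 expr0n -[p == 0%N]negbK -lt0n prime_gt0.
    rewrite Tg; apply: hs; rewrite rmorphXn /= hw1 -exprM mulnC exprM.
    by rewrite (prim_expr_order omega_prim) expr1n.
  rewrite /S !rmorph_sum /=; case: r xr @S he => [|r] xr S he; first by rewrite !big_ord0.
  rewrite big_ord_recr [RHS]big_ord_recl /= addrC; congr (_ + _).
    by rewrite -!TX sT -rmorphXn -!TX /= -exprM -expnSr xr expr1.
  apply: eq_bigr => i _; rewrite -TX sT -rmorphXn /= -!TX -exprM.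
  by rewrite /bump /= add1n expnSr.
have [m [z' [e' [h1 h2]]]] := @locrel_fixed p M E p_pr cardE omega g
  (etrans (congr1 _ (esym cardE)) omegaQ) trw s
  (hs _ (prim_expr_order omega_prim)) _ _ sS he k.
have [y [hy _]] := locring_lift (sub _ _ h2).
exists m, y; apply: vinj; rewrite -/S h1 rmorphD rmorphM rmorphXn /= !rmorph_nat.
by rewrite hy.
Qed.
End Construction.

Lemma padic_lift_exists p M (E : finFieldType) :
  prime p -> #|E| = (p ^ M)%N -> inhabited (padic_lift p E).
Proof.
move=> p_pr cE; have [g hg] := finField_prim_root E.
have n0 : (0 < p * #|E|.-1)%N by rewrite muln_gt0 prime_gt0 // (prim_order_gt0 hg).
have [theta ht] := C_prim_root_exists n0.
exact: (padic_lift_exists_aux p_pr cE ht hg).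
Qed.

(** * Power series and logarithmic derivatives *)

Section FpsRing.
Variable R : comNzRingType.
Implicit Types (f g h : fps R) (k m : nat).

(** Each coefficient depends only on truncations, so ring identities for series are inherited from
    polynomials. *)
Lemma fps_mulE m f g k : (k < m)%N ->
  fps_mul f g k = (\poly_(i < m) f i * \poly_(i < m) g i)`_k.
Proof.
move=> km; rewrite coefM /fps_mul; apply: eq_bigr => i _.
have ik : (i <= k)%N by rewrite -ltnS.
by rewrite !coef_poly (leq_ltn_trans ik km) (leq_ltn_trans (leq_subr i k) km).
Qed.

Lemma eq_fps_mul f f' g g' k : (forall i, (i <= k)%N -> f i = f' i) ->
  (forall i, (i <= k)%N -> g i = g' i) -> fps_mul f g k = fps_mul f' g' k.
Proof.
move=> hf hg; apply: eq_bigr => i _.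
by rewrite hf ?hg ?leq_subr // -ltnS.
Qed.

Lemma fps_mulC f g : fps_mul f g = fps_mul g f.
Proof. by apply/funext => k; rewrite !(@fps_mulE k.+1) // mulrC. Qed.

Lemma coef_fps_of_poly (P Q : {poly R}) k :
  fps_mul (fps_of_poly P) (fps_of_poly Q) k = (P * Q)`_k.
Proof. by rewrite coefM. Qed.

Lemma fps_of_polyM (P Q : {poly R}) :
  fps_mul (fps_of_poly P) (fps_of_poly Q) = fps_of_poly (P * Q).
Proof. by apply/funext => k; rewrite coef_fps_of_poly. Qed.

Lemma fps_mulA f g h : fps_mul f (fps_mul g h) = fps_mul (fps_mul f g) h.
Proof.
apply/funext => k; pose tr f := fps_of_poly (\poly_(i < k.+1) f i) : fps R.
have trE f' i : (i <= k)%N -> f' i = tr f' i.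
  by move=> ik; rewrite /tr /fps_of_poly coef_poly ltnS ik.
transitivity (fps_mul (tr f) (fps_mul (tr g) (tr h)) k).
  apply: eq_fps_mul => i ik; first exact: trE.
  by apply: eq_fps_mul => j ji; apply: trE; apply: leq_trans ji ik.
transitivity (fps_mul (fps_mul (tr f) (tr g)) (tr h) k).
  by rewrite !fps_of_polyM mulrA.
apply/esym; apply: eq_fps_mul => i ik; last exact: trE.
by apply: eq_fps_mul => j ji; apply: trE; apply: leq_trans ji ik.
Qed.

Lemma fps_mulDl f g h : fps_mul (f \+ g) h = fps_mul f h \+ fps_mul g h.
Proof.
by apply/funext => k; rewrite /fps_mul /= -big_split; apply: eq_bigr => i _; rewrite mulrDl.
Qed.

Lemma fps_mulZr c f g k : fps_mul f (fun k => c * g k) k = c * fps_mul f g k.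
Proof. by rewrite /fps_mul mulr_sumr; apply: eq_bigr => i _; rewrite mulrCA. Qed.

Lemma fps_mul1l f : fps_mul (fps_one R) f = f.
Proof.
apply/funext => k; rewrite /fps_mul big_ord_recl /= /fps_one eqxx mul1r subn0.
by rewrite big1 ?addr0 // => i _; rewrite mul0r.
Qed.

Lemma fps_mul1r f : fps_mul f (fps_one R) = f.
Proof. by rewrite fps_mulC fps_mul1l. Qed.

Lemma fps_mul0 f g : fps_mul f g 0%N = f 0%N * g 0%N.
Proof. by rewrite /fps_mul big_ord1. Qed.

Lemma fps_powE m f n k : (k < m)%N ->
  fps_pow f n k = ((\poly_(i < m) f i) ^+ n)`_k.
Proof.
elim: n k => [|n IH] k km; first by rewrite expr0 coef1.
rewrite exprS /= (fps_mulE _ _ km); rewrite !coefM; apply: eq_bigr => i _.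
congr (_ * _); rewrite coef_poly.
by rewrite (leq_ltn_trans (leq_subr _ _) km) IH // (leq_ltn_trans (leq_subr _ _) km).
Qed.

Definition fps_dt f : fps R := fun k => k%:R * f k.

Lemma fps_dtM f g : fps_dt (fps_mul f g) = fps_mul (fps_dt f) g \+ fps_mul f (fps_dt g).
Proof.
apply/funext => k; rewrite /fps_dt /fps_mul /= mulr_sumr -big_split; apply: eq_bigr => i _ /=.
have ik : (i <= k)%N by rewrite -ltnS.
by rewrite -{1}(subnKC ik) natrD; ring.
Qed.

(** The equation $t f'=hf$, that is $h=t\,d\log f/dt$, stated without dividing by $f$. Products of
    series become sums of the [h], and for zeta functions and characteristic polynomials [h]
    consists of point counts or traces. *)
Definition logder h f := fps_dt f = fps_mul h f.

Lemma logderM h f h' f' : logder h f -> logder h' f' ->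
  logder (h \+ h') (fps_mul f f').
Proof.
rewrite /logder fps_dtM => -> ->; rewrite fps_mulDl; congr (_ \+ _).
  by rewrite fps_mulA.
by rewrite fps_mulA (fps_mulC f h') -fps_mulA.
Qed.

Lemma logder1 : logder (fun=> 0) (fps_one R).
Proof.
apply/funext => k; rewrite fps_mul1r /fps_dt /fps_one.
by case: k => [|k]; rewrite ?mul0r ?mulr0.
Qed.

Lemma logder_pow h f n : logder h f -> logder (fun k => n%:R * h k) (fps_pow f n).
Proof.
move=> hf; elim: n => [|n IH].
  have -> : (fun k => 0%:R * h k) = (fun=> 0) by apply/funext => k; rewrite mul0r.
  exact: logder1.
have -> : (fun k => n.+1%:R * h k) = h \+ (fun k => n%:R * h k).
  by apply/funext => k /=; rewrite -natr1 mulrDl mul1r addrC.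
exact: logderM.
Qed.

Lemma logder_prod (I : Type) (s : seq I) (H : I -> fps R) (P : I -> {poly R}) :
  (forall i, logder (H i) (fps_of_poly (P i))) ->
  logder (fun k => \sum_(i <- s) H i k) (fps_of_poly (\prod_(i <- s) P i)).
Proof.
move=> h; elim: s => [|i s IH].
  rewrite big_nil.
  have -> : (fun k => \sum_(i <- [::]) H i k) = (fun=> 0) by apply/funext => k; rewrite big_nil.
  have -> : fps_of_poly (1 : {poly R}) = fps_one R by apply/funext => k; rewrite /fps_of_poly coef1.
  exact: logder1.
rewrite big_cons -fps_of_polyM.
have -> : (fun k => \sum_(j <- i :: s) H j k) = H i \+ (fun k => \sum_(j <- s) H j k).
  by apply/funext => k; rewrite big_cons.
exact: logderM.
Qed.

Lemma logder_rec h f : h 0%N = 0 -> logder h f -> forall k,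
  k%:R * f k = \sum_(i < k) h (k - i)%N * f i.
Proof.
move=> h0 /(congr1 (fun F => F _)) E k; have := E k; rewrite /fps_dt fps_mulC => ->.
rewrite /fps_mul big_ord_recr /= subnn h0 mulr0 addr0.
by apply: eq_bigr => i _; rewrite mulrC.
Qed.

Lemma rec_logder h f : h 0%N = 0 ->
  (forall k, k%:R * f k = \sum_(i < k) h (k - i)%N * f i) -> logder h f.
Proof.
move=> h0 E; apply/funext => k; rewrite /fps_dt E fps_mulC.
rewrite /fps_mul big_ord_recr /= subnn h0 mulr0 addr0.
by apply: eq_bigr => i _; rewrite mulrC.
Qed.
End FpsRing.

Section FpsMap.
Variables (R S : comNzRingType) (u : {rmorphism R -> S}).
Lemma map_fps_mul f g k : u (fps_mul f g k) = fps_mul (u \o f) (u \o g) k.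
Proof. by rewrite /fps_mul rmorph_sum; apply: eq_bigr => i _; rewrite rmorphM. Qed.
End FpsMap.

Section FpsField.
Variable K : numFieldType.
Implicit Types (f g h : fps K) (k : nat).

Lemma logder_uniq h f g : h 0%N = 0 -> f 0%N = g 0%N ->
  logder h f -> logder h g -> f = g.
Proof.
move=> h0 fg0 hf hg; apply/funext => k; elim/ltn_ind: k => -[//|k] IH.
apply: (@mulfI _ k.+1%:R); first by rewrite pnatr_eq0.
rewrite (logder_rec h0 hf) (logder_rec h0 hg); apply: eq_bigr => i _.
by rewrite IH.
Qed.

Fixpoint fps_solve_aux h (fuel k : nat) : K :=
  match fuel with
  | 0 => 0
  | fuel'.+1 =>
      if k == 0%N then 1
      else k%:R^-1 * \sum_(i < k) h (k - i)%N * fps_solve_aux h fuel' i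
  end.
Definition fps_solve h : fps K := fun k => fps_solve_aux h k.+1 k.

Lemma fps_solve_fuel h n k : (k < n)%N -> fps_solve_aux h n k = fps_solve h k.
Proof.
elim/ltn_ind: k n => k IH [|n] // kn; rewrite /fps_solve /=.
case: eqP => // _; congr (_ * _); apply: eq_bigr => i _; congr (_ * _).
by rewrite IH // ?(leq_trans (ltn_ord i)) // [RHS]IH.
Qed.

Lemma fps_solve0 h : fps_solve h 0 = 1. Proof. by []. Qed.

Lemma fps_solveP h : h 0%N = 0 -> logder h (fps_solve h).
Proof.
move=> h0; apply: rec_logder => // -[|k]; first by rewrite mul0r big_ord0.
rewrite {1}/fps_solve /= mulVKf ?pnatr_eq0 //; apply: eq_bigr => i _.
by rewrite -[LHS]/(_ * fps_solve_aux h k.+1 i) fps_solve_fuel.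
Qed.
End FpsField.

Section FpsInv.
Variable F : fieldType.
Implicit Types (f g : fps F).

Lemma fps_inv_fuel f n k : (k < n)%N -> fps_inv_aux f n k = fps_inv f k.
Proof.
elim/ltn_ind: k n => k IH [|n] // kn; rewrite /fps_inv /=.
case: eqP => // _; congr (_ * _); apply: eq_bigr => i _; congr (_ * _).
by rewrite IH // ?(leq_trans (ltn_ord i)) // [RHS]IH.
Qed.

Lemma fps_mulV f : f 0%N != 0 -> fps_mul f (fps_inv f) = fps_one F.
Proof.
move=> f0; apply/funext => -[|k]; first by rewrite fps_mul0 /fps_inv /= mulfV.
rewrite fps_mulC /fps_mul big_ord_recr /= subnn {2}/fps_inv /= mulNr mulrC mulrN.
rewrite mulrA mulfV // mul1r.
apply/eqP; rewrite /fps_one /= subr_eq0; apply/eqP; apply: eq_bigr => i _.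
by rewrite -[in RHS]/(fps_inv_aux f k.+1 i) fps_inv_fuel // mulrC.
Qed.

Lemma fps_mul_inv_eq f g h : f 0%N != 0 -> fps_mul g f = h -> g = fps_mul h (fps_inv f).
Proof. by move=> f0 <-; rewrite -fps_mulA fps_mulV // fps_mul1r. Qed.

Lemma logder_inv h f : f 0%N != 0 -> logder h f -> logder (fun k => - h k) (fps_inv f).
Proof.
move=> f0 hf; rewrite /logder; set g := fps_inv f.
have fg : fps_mul f g = fps_one F by exact: fps_mulV.
have : fps_dt (fps_mul f g) = fun=> 0.
  rewrite fg; have := logder1 F; rewrite /logder => ->.
  by apply/funext => k; rewrite /fps_mul big1 // => i _; rewrite mul0r.
rewrite fps_dtM hf => /(congr1 (fps_mul g)); rewrite (fps_mulC g (_ \+ _)) fps_mulDl.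
rewrite -[fps_mul (fps_mul f _) g]fps_mulA (fps_mulC (fps_dt g)) fps_mulA fg fps_mul1l.
rewrite -[fps_mul (fps_mul h f) g]fps_mulA fg fps_mul1r.
move=> /(congr1 (fun F => F _)) E; apply/funext => k; have := E k.
rewrite /= (fps_mulC g) [RHS]/fps_mul big1 => [|i _]; last by rewrite mul0r.
move/eqP; rewrite addrC addr_eq0 => /eqP ->.
by rewrite /fps_mul -sumrN;  apply: eq_bigr => i _; rewrite mulNr.
Qed.
End FpsInv.

(** As $f$ has no constant term, $f^n$ starts in degree $n$, so the finite sum in [fps_exp] may be
    extended to any common bound before it is differentiated. *)
Lemma logder_exp (f : fps rat) : f 0%N = 0 -> logder (fps_dt f) (fps_exp f).
Proof.
move=> f0; have pw0 n k : (k < n)%N -> fps_pow f n k = 0.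
  elim: n k => // n IH k kn /=; rewrite /fps_mul big1 // => -[[|i] hi] _ /=.
    by rewrite f0 mul0r.
  rewrite IH ?mulr0 //; move: kn hi; rewrite !ltnS; case: k => // k kn ik.
  by rewrite subSS (leq_ltn_trans (leq_subr _ _)) .
have expE M k : (k < M)%N -> fps_exp f k = \sum_(i < M) fps_pow f i k / (i`!)%:R.
  move=> kM; rewrite /fps_exp (big_ord_widen M (fun i => fps_pow f i k / (i`!)%:R)) //.
  rewrite big_mkcond; apply: eq_bigr => i _; case: ltnP => // h.
  by rewrite pw0 ?mul0r.
have dtpow n : fps_dt (fps_pow f n.+1) = fun k => n.+1%:R * fps_mul (fps_dt f) (fps_pow f n) k.
  elim: n => [|n IH].
    by apply/funext => k; rewrite /= fps_mul1r fps_mul1r mul1r.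
  rewrite [fps_pow f n.+2]/= fps_dtM -/(fps_pow f n.+1) IH; apply/funext => k /=.
  rewrite -[n.+2%:R]natr1 mulrDl mul1r addrC; congr (_ + _).
  by rewrite fps_mulZr fps_mulA (fps_mulC f) -fps_mulA.
apply/funext => k; rewrite {1}/fps_dt (@expE k.+1) // big_ord_recl /= mulrDr.
rewrite {1}/fps_one; have -> : k%:R * ((k == 0%N)%:R / (0`!)%:R) = 0 :> rat.
  by case: k => [|k]; rewrite ?mul0r ?mulr0.
rewrite add0r mulr_sumr.
transitivity (\sum_(i < k) fps_mul (fps_dt f) (fps_pow f i) k / (i`!)%:R).
  apply: eq_bigr => i _; rewrite /bump /= add1n mulrA.
  have := congr1 (fun F => F k) (dtpow i); rewrite /= /fps_dt => ->.
  rewrite factS natrM invfM [i.+1%:R * _]mulrC -!mulrA; congr (_ * _).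
  by rewrite mulVKf // pnatr_eq0.
rewrite [RHS]/fps_mul; transitivity (\sum_(j < k.+1) \sum_(i < k)
   fps_dt f j * (fps_pow f i (k - j)%N / (i`!)%:R)).
  rewrite exchange_big /=; apply: eq_bigr => i _; rewrite /fps_mul mulr_suml.
  by apply: eq_bigr => j _; rewrite mulrA.
apply: eq_bigr => -[[|j] hj] _; rewrite -mulr_sumr.
  by rewrite /fps_dt /= !mul0r.
by rewrite [in RHS](expE k) //= ltn_subrL; case: k hj.
Qed.

(** * The Artin-Hasse exponential *)

Section PIntegral.
Variable p : nat.
Hypothesis p_pr : prime p.

Definition pint (r : rat) := exists (a : int) (b : nat),
  ~~ (p %| b)%N /\ r * b%:R = a%:~R.

Lemma ndvdM b c : ~~ (p %| b)%N -> ~~ (p %| c)%N -> ~~ (p %| b * c)%N.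
Proof. by move=> hb hc; rewrite Euclid_dvdM // negb_or hb hc. Qed.

Lemma ndvdX b n : ~~ (p %| b)%N -> ~~ (p %| b ^ n)%N.
Proof. by move=> hb; rewrite Euclid_dvdX // negb_and hb. Qed.

Lemma ndvd_neq0 (K : numDomainType) b : ~~ (p %| b)%N -> b%:R != 0 :> K.
Proof. by apply: contraNneq => /eqP; rewrite pnatr_eq0 => /eqP ->. Qed.

Lemma pint_int (a : int) : pint a%:~R.
Proof. by exists a, 1%N; rewrite mulr1 dvdn1 gtn_eqF ?prime_gt1. Qed.

Lemma pint_nat (a : nat) : pint a%:R.
Proof. exact: (pint_int a). Qed.

Lemma pintD x y : pint x -> pint y -> pint (x + y).
Proof.
move=> [a [b [hb e]]] [a' [b' [hb' e']]].
exists (a * b' + a' * b), (b * b')%N; split; first exact: ndvdM.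
rewrite natrM rmorphD !rmorphM /= -e -e' -!pmulrn; ring.
Qed.

Lemma pintM x y : pint x -> pint y -> pint (x * y).
Proof.
move=> [a [b [hb e]]] [a' [b' [hb' e']]].
exists (a * a'), (b * b')%N; split; first exact: ndvdM.
rewrite natrM rmorphM /= -e -e'; ring.
Qed.

Lemma pintN x : pint x -> pint (- x).
Proof. by move=> h; rewrite -mulN1r; apply: pintM => //; exact: (pint_int (-1)). Qed.

Lemma pint_sum (I : Type) (s : seq I) (f : I -> rat) :
  (forall i, pint (f i)) -> pint (\sum_(i <- s) f i).
Proof.
move=> h; elim: s => [|i s IH]; rewrite ?big_nil ?big_cons; first exact: (pint_nat 0).
exact: pintD.
Qed.

Lemma pintV b : ~~ (p %| b)%N -> pint b%:R^-1.
Proof. by move=> hb; exists 1, b; rewrite mulVf // ndvd_neq0. Qed.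

Lemma pint_fps_mul (f g : fps rat) k :
  (forall i, (i <= k)%N -> pint (f i)) -> (forall i, (i <= k)%N -> pint (g i)) ->
  pint (fps_mul f g k).
Proof.
move=> hf hg; apply: pint_sum => i; apply: pintM.
  by apply: hf; rewrite -ltnS.
by apply: hg; apply: leq_subr.
Qed.

Lemma pint_fps_pow (f : fps rat) n k :
  (forall i, (i <= k)%N -> pint (f i)) -> pint (fps_pow f n k).
Proof.
elim: n k => [|n IH] k h /=; first exact: pint_nat.
apply: pint_fps_mul => // i ik; apply: IH => j ji; apply: h; exact: leq_trans ik.
Qed.

Lemma pint_common_den (f : nat -> rat) k : (forall i, (i < k)%N -> pint (f i)) ->
  exists (b : nat) (g : nat -> int), ~~ (p %| b)%N /\
    forall i, (i < k)%N -> f i * b%:R = (g i)%:~R.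
Proof.
elim: k => [|k IH] h.
  by exists 1%N, (fun=> 0); rewrite dvdn1 gtn_eqF ?prime_gt1.
have [|b [g [hb hg]]] := IH; first by move=> i ik; apply: h; apply: ltnW.
have [a [b' [hb' e]]] := h k (ltnSn k).
exists (b * b')%N, (fun i => if i == k then a * b else g i * b'); split.
  exact: ndvdM.
move=> i; rewrite ltnS natrM; case: eqVneq => [-> _|ik le].
  by rewrite rmorphM /= -e -pmulrn; ring.
by rewrite rmorphM /= -hg 1?ltn_neqAle ?ik // -pmulrn mulrA.
Qed.

(** Legendre's formula gives $v_p(k!)=\lfloor k/p\rfloor+v_p(\lfloor k/p\rfloor!)$, which by
    induction is below $2\lfloor k/p\rfloor\le k$ unless $\lfloor k/p\rfloor=0$. The cut-off of
    Legendre's sum is generalised so that the induction can run on it. *)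
Lemma logn_fact_lt k : (0 < k)%N -> (logn p k`! < k)%N.
Proof.
rewrite logn_fact //; move: k.+1 => N.
case: N => [|N]; first by rewrite big_geq.
have p1 := prime_gt1 p_pr.
elim: N k => [|N IH] k k0; first by rewrite big_geq.
rewrite big_nat_recl // expn1.
have -> : (\sum_(1 <= i < N.+1) k %/ p ^ i.+1
          = \sum_(1 <= i < N.+1) (k %/ p) %/ p ^ i)%N.
  by apply: eq_bigr => i _; rewrite expnS divnMA.
case: (posnP (k %/ p)) => [->|kp].
  by rewrite add0n big1 // => i _; rewrite div0n.
have h := IH _ kp.
have : (k %/ p * p <= k)%N by exact: leq_trunc_div.
have : (k %/ p * 2 <= k %/ p * p)%N by rewrite leq_mul2l p1 orbT.
by move: h kp; lia.
Qed.

Lemma pint_expfact k : (0 < k)%N -> exists2 z, pint z & p%:R ^+ k / k`!%:R = p%:R * z.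
Proof.
move=> k0; have lt := logn_fact_lt k0.
have [u cu hu] := pfactor_coprime p_pr (fact_gt0 k).
have pu : ~~ (p %| u)%N by rewrite -prime_coprime.
have p0 : p%:R != 0 :> rat by rewrite pnatr_eq0 -lt0n prime_gt0.
set v := logn p k`! in lt hu *.
exists (p%:R ^+ (k - v.+1) * u%:R^-1).
  by rewrite -natrX; apply: pintM; [exact: pint_nat | exact: pintV].
rewrite hu natrM natrX invfM !mulrA mulrAC -expfB // -exprS.
by rewrite -subSn // subSS.
Qed.
End PIntegral.

Section ArtinHasse.
Variable p : nat.
Hypothesis p_pr : prime p.

(* c (t + t^p + t^(p^2) + ...): the series with this t d/dt log is the c-th power of the
   Artin-Hasse exponential. *)
Definition pser (R : pzRingType) (c : R) : fps R :=
  fun k => if k == (p ^ logn p k)%N then c else 0.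

Lemma pser0 (R : pzRingType) (c : R) : pser c 0 = 0.
Proof. by rewrite /pser logn0. Qed.

Lemma pserM (R : pzRingType) (c : R) k : pser c (p * k)%N = pser c k.
Proof.
rewrite /pser; case: k => [|k]; first by rewrite muln0.
rewrite lognM ?(prime_gt0 p_pr) // logn_prime // eqxx add1n expnS.
by rewrite eqn_pmul2l ?prime_gt0.
Qed.

Lemma pser_ndvd (R : pzRingType) (c : R) k : ~~ (p %| k)%N ->
  pser c k = if k == 1%N then c else 0.
Proof.
move=> h; rewrite /pser; case: k h => [|k] h; first by rewrite logn0.
suff -> : logn p k.+1 = 0%N by rewrite expn0.
by apply/eqP; rewrite -leqn0 leqNgt logn_gt0 mem_primes p_pr /= (negPf h).
Qed.

Definition artin_hasse : fps rat := fps_solve (pser 1).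

Lemma artin_hasse_logder : logder (pser 1) artin_hasse.
Proof. by apply: fps_solveP; rewrite pser0. Qed.

(** Below degree $p$ the logarithmic derivative is just $t$, so the recursion is that of the
    exponential. *)
Lemma artin_hasse_fact k : (k < p)%N -> artin_hasse k = k`!%:R^-1.
Proof.
elim: k => [|k IH] kp; first by rewrite invr1.
have k1 : k.+1%:R != 0 :> rat by rewrite pnatr_eq0.
apply: (mulfI k1); rewrite (logder_rec (pser0 _) artin_hasse_logder) big_ord_recr /=.
rewrite subSnn big1 => [|i _]; last first.
  have ik := ltn_ord i; rewrite pser_ndvd; last first.
    by apply/negP => /dvdn_leq; rewrite subn_gt0 /=; lia.
  by rewrite gtn_eqF ?mul0r //; lia.
rewrite add0r pser_ndvd ?eqxx ?mul1r; last by rewrite dvdn1 gtn_eqF ?prime_gt1.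
by rewrite IH ?(ltnW kp) // factS natrM invfM mulVKf.
Qed.

Let expp : fps rat := fun k => (- p%:R) ^+ k / k`!%:R.

Lemma expp_logder : logder (fun k => if k == 1%N then - p%:R else 0) expp.
Proof.
apply: rec_logder => // -[|k]; first by rewrite mul0r big_ord0.
rewrite big_ord_recr /= subSnn eqxx big1 => [|i _]; last first.
  by rewrite gtn_eqF ?mul0r // ltn_subRL addn1 ltnS.
rewrite add0r /expp exprS factS natrM invfM.
have k1 : k.+1%:R != 0 :> rat by rewrite pnatr_eq0.
by rewrite [k.+1%:R^-1 * _]mulrC !mulrA mulrC -!mulrA mulKf.
Qed.

Let subst : fps rat := fun k => if (p %| k)%N then artin_hasse (k %/ p)%N else 0.

(** Substituting $t^p$ for $t$ turns $t+t^p+\cdots$ into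
    $p(t^p+t^{p^2}+\cdots)=p(t+t^p+\cdots)-pt$. *)
Lemma subst_logder : logder (fun k => p%:R * pser 1 k + if k == 1%N then - p%:R else 0) subst.
Proof.
have p0 := prime_gt0 p_pr.
have hE k : p%:R * pser 1 k + (if k == 1%N then - p%:R else 0)
    = if (p %| k)%N then p%:R * pser 1 (k %/ p)%N else 0 :> rat.
  case: (boolP (p %| k)%N) => [/dvdnP[j ->]|h].
    rewrite mulnC pserM mulKn // muln_eq1 gtn_eqF ?prime_gt1 //= addr0 //.
  by rewrite pser_ndvd //; case: ifP; rewrite ?mulr1 ?subrr ?mulr0 ?addr0.
apply: rec_logder; first by rewrite pser0 mulr0 addr0.
move=> k; under eq_bigr => i _ do rewrite hE /subst.
rewrite /subst; case: ifP => [/dvdnP[j ->]|h]; last first.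
  rewrite mulr0 big1 // => i _; case: ifP => h1; rewrite ?mul0r //.
  case: ifP => h2; rewrite ?mulr0 //.
  by have := dvdn_add h1 h2; rewrite subnK ?h // ltnW.
rewrite mulnK // natrM [j%:R * _]mulrC -mulrA.
rewrite (logder_rec (pser0 _) artin_hasse_logder) mulr_sumr.
rewrite [RHS](bigID (fun i : 'I_(j * p) => (p %| i)%N)) /= [X in _ + X]big1 ?addr0; last first.
  by move=> i /negPf ->; rewrite mulr0.
have lt (i : 'I_j) : (i * p < j * p)%N by rewrite ltn_pmul2r.
pose hh (i : 'I_j) : 'I_(j * p) := Ordinal (lt i).
have lt' (i : 'I_(j * p)) : (i %/ p < j)%N by rewrite ltn_divLR.
pose hh' (i : 'I_(j * p)) : 'I_j := Ordinal (lt' i).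
rewrite (reindex hh); last first.
  exists hh' => [i _|i hi]; apply: val_inj; rewrite /= ?mulnK //.
  by rewrite divnK.
apply: eq_big => [i|i _] /=; first by rewrite dvdn_mull.
by rewrite -mulnBl !dvdn_mull // !mulnK // mulrA.
Qed.

(* Dwork's integrality argument: E(t^p) = E(t)^p exp(-pt). *)
Lemma subst_eq : subst = fps_mul (fps_pow artin_hasse p) expp.
Proof.
apply: (logder_uniq _ _ subst_logder _); first by rewrite pser0 mulr0 addr0.
  rewrite fps_mul0 /subst dvdn0 div0n /expp expr0 mul1r divr1 (@fps_powE _ 1) //.
  rewrite -horner_coef0 horner_exp horner_coef0 coef_poly /=.
  by rewrite /artin_hasse fps_solve0 expr1n.
exact: logderM (logder_pow p artin_hasse_logder) expp_logder.
Qed.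

(** Compare coefficients of $t^K$ in $E(t^p)=E(t)^p\exp(-pt)$, assuming the lower ones integral.
    With $P$ the truncation of $E$ below $K$, the right side is $(P^p)_K+pE_K$ modulo $p$ times
    integral terms, and $P^p\equiv P(t^p)$ modulo $p$. So $pE_K$ is $p$ times an integral number. *)
Lemma artin_hasse_pint k : pint p (artin_hasse k).
Proof.
have p0 := prime_gt0 p_pr.
have pQ : p%:R != 0 :> rat by rewrite pnatr_eq0 -lt0n.
elim/ltn_ind: k => -[|k] IH; first by exact: (pint_nat p_pr 1).
set K := k.+1 in IH *.
have expp0 : expp 0 = 1 by rewrite /expp expr0 divr1.
have hX i : (0 < i)%N -> exists2 z, pint p z & expp i = p%:R * z.
  move=> i0; have [z hz e] := pint_expfact p_pr i0.
  exists ((-1) ^+ i * z); first by apply: pintM => //; have := pint_int p_pr ((-1) ^+ i); rewrite rmorphXn /= rmorphN1.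
  by rewrite /expp exprNn -mulrA e; ring.
have [z1 hz1 e1] : exists2 z, pint p z & subst K = fps_pow artin_hasse p K + p%:R * z.
  rewrite subst_eq /fps_mul big_ord_recr /= subnn expp0 mulr1.
  have /choice[f hf] : forall i : 'I_K, exists z, pint p z /\ expp (K - i)%N = p%:R * z.
    by move=> i; have [|z ? ?] := hX (K - i)%N; rewrite ?subn_gt0 //; exists z.
  exists (\sum_(i < K) fps_pow artin_hasse p i * f i).
    apply: pint_sum => // i; apply: pintM => //; last by case: (hf i).
    apply: pint_fps_pow => // j ji; apply: IH; exact: leq_ltn_trans ji _.
  rewrite addrC mulr_sumr; congr (_ + _); apply: eq_bigr => i _.
  by case: (hf i) => _ ->; ring.
pose P : {poly rat} := \poly_(i < K) artin_hasse i.
have P0 : P`_0 = 1 by rewrite coef_poly.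
(* The new coefficient enters $E^p$ linearly, once per factor, because the constant term of $P$ is
   1. *)
have e2 : fps_pow artin_hasse p K = (P ^+ p)`_K + p%:R * artin_hasse K.
  rewrite (@fps_powE _ K.+1) //.
  pose Q := artin_hasse K *: 'X^K.
  have -> : \poly_(i < K.+1) artin_hasse i = P + Q.
    apply/polyP => i; rewrite coefD /P /Q coefZ coefXn !coef_poly ltnS leq_eqVlt.
    by case: eqVneq => [->|]; rewrite ?ltnn ?mulr1 ?add0r ?mulr0 ?addr0.
  have -> : (P + Q) ^+ p = P ^+ p + Q * \sum_(i < p) (P + Q) ^+ (p.-1 - i) * P ^+ i.
    have := subrXX (P + Q) P p; rewrite [P + Q - P]addrAC subrr add0r => <-.
    by rewrite [RHS]addrC subrK.
  rewrite coefD /Q -scalerAl coefZ coefXnM ltnn subnn mulrC; congr (_ + _ * _).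
  rewrite -horner_coef0 horner_sum (eq_bigr (fun=> 1)) => [|i _].
    by rewrite sumr_const card_ord.
  rewrite hornerM !horner_exp hornerD hornerZ hornerXn expr0n mulr0 addr0.
  by rewrite horner_coef0 P0 !expr1n mulr1.
have [z3 hz3 e3] : exists2 z, pint p z & (P ^+ p)`_K = subst K + p%:R * z.
  (* Denominators are cleared to reach the Frobenius congruence over the integers; $b^p\equiv b$
     modulo $p$ then compares the factor $b^p$ on one side with $b$ on the other. *)
  have [b [g [hb hg]]] := pint_common_den p_pr IH.
  pose P0' : {poly int} := \poly_(i < K) g i.
  have hP0 : map_poly intr P0' = b%:R *: P.
    apply/polyP => i; rewrite coef_map coefZ !coef_poly.
    by case: ifP => h /=; rewrite ?mulr0 // -hg // mulrC.
  have [U hU] := zpoly_frobenius P0' p_pr.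
  have := congr1 (fun q : {poly int} => (q`_K)%:~R : rat) hU.
  rewrite coefD mulr_natl coefMn rmorphD rmorphMn /= -!(coef_map intr) rmorphXn map_comp_poly map_polyXn /=.
  rewrite hP0 exprZn comp_polyZ !coefZ.
  have -> : (P \Po 'X^p)`_K = subst K.
    rewrite coef_comp_poly_Xn // /subst; case: ifP => // h; rewrite coef_poly.
    by rewrite ltn_Pdiv ?prime_gt1.
  have [b' hb'] := intr_expr_prime b%:Z p_pr.
  have {}hb' : b%:R ^+ p = b%:R + p%:R * b'%:~R :> rat.
    by have := congr1 (fun x : int => x%:~R : rat) hb'; rewrite rmorphXn rmorphD rmorphM /= rmorph_nat -!pmulrn.
  rewrite [(map_poly intr U)`_K]coef_map /= => e.
  have bn0 : b%:R ^+ p != 0 :> rat by rewrite expf_neq0 // (ndvd_neq0 _ hb).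
  exists (((U`_K)%:~R - b'%:~R * subst K) * b%:R ^- p).
    rewrite -natrX; apply: pintM => //; last by apply: pintV => //; exact: ndvdX.
    apply: pintD => //; first exact: pint_int.
    apply: pintN => //; apply: pintM; first exact: p_pr; first exact: pint_int.
    rewrite /subst; case: ifP => _; last exact: (pint_nat p_pr 0).
    by apply: IH; rewrite ltn_Pdiv ?prime_gt1.
  apply: (mulfI bn0); rewrite e mulrDr mulrCA [b%:R ^+ p * (_ * _)]mulrC mulfVK //.
  by rewrite hb' -mulr_natl; ring.
have -> : artin_hasse K = - z1 - z3.
  apply: (mulfI pQ); move: e1; rewrite e2 e3.
  by move/eqP; rewrite -subr_eq0 => /eqP h; apply/eqP; rewrite -subr_eq0 -oppr_eq0 -h; apply/eqP; ring.
by apply: pintD => //; apply: pintN.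
Qed.
End ArtinHasse.

(** * Dwork's splitting function *)

(** The left side is $((1+x)^p-1)/x$. At $x=\zeta-1$ it vanishes, which is the Eisenstein equation
    of $\zeta-1$. *)
Lemma sum_bin_prime (R : comNzRingType) (x : R) p : prime p ->
  exists c, \sum_(i < p) x ^+ i *+ 'C(p, i.+1) = x ^+ p.-1 + p%:R * (1 + x * c).
Proof.
case: p => [|[|q]] // q_pr.
exists (\sum_(i < q) x ^+ i *+ ('C(q.+2, i.+2) %/ q.+2)).
rewrite big_ord_recl big_ord_recr /= /bump /= !add1n binn bin1 expr0 mulr1n.
rewrite addrA addrC; congr (_ + _).
rewrite mulrDr mulr1; congr (_ + _); rewrite mulrA mulr_sumr; apply: eq_bigr => i _.
rewrite /bump /= add1n exprS mulrnAr -mulrA -exprS mulr_natl -mulrnA mulnC divnK //.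
by rewrite prime_dvd_bin //= !ltnS ltn_ord.
Qed.

Section Lift.
Variables (p : nat) (E : finFieldType) (W : padic_lift p E).
Hypotheses (p_pr : prime p) (pE : p \in [pchar E]).
Local Notation val := (lval W).
Local Notation red := (lred W).
Local Notation T := (teich W).
Local Notation zeta := (lzeta W).

Lemma lift_mulI (x y z : W) : x != 0 -> x * y = x * z -> y = z.
Proof.
move=> x0 h; apply: (@lval_inj _ _ W); apply: (@mulfI _ (val x)).
  by rewrite -(rmorph0 val) (inj_eq (@lval_inj _ _ W)).
by rewrite -!rmorphM h.
Qed.

Lemma lift_nat_neq0 n : (0 < n)%N -> n%:R != 0 :> W.
Proof.
move=> n0; rewrite -(inj_eq (@lval_inj _ _ W)) rmorph_nat rmorph0.
by rewrite pnatr_eq0 -lt0n.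
Qed.

Lemma lift_pX_neq0 k : p%:R ^+ k != 0 :> W.
Proof. by rewrite -natrX lift_nat_neq0 // expn_gt0 prime_gt0. Qed.

Lemma lift_nat_inv n : ~~ (p %| n)%N -> exists y : W, n%:R * y = 1.
Proof. by move=> h; apply: lred_inv; rewrite rmorph_nat -(dvdn_pcharf pE). Qed.

(** Bounds the cost of a division by $n$. The exponent $n$ is far larger than $v_p(n)$, but it is
    easy to sum over the steps of a recursion. *)
Lemma lift_div_nat n : (0 < n)%N -> exists b : W, n%:R * b = p%:R ^+ n.
Proof.
move=> n0; have [u cu ->] := pfactor_coprime p_pr n0.
have pu : ~~ (p %| u)%N by rewrite -prime_coprime.
set v := logn p _; have [y hy] := lift_nat_inv pu.
have le : (v <= u * p ^ v)%N.
  apply: (@leq_trans (p ^ v)%N); first by rewrite ltnW // ltn_expl // prime_gt1.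
  by rewrite leq_pmull //; case: u cu pu {hy} => //; rewrite dvdn0.
exists (y * p%:R ^+ (u * p ^ v - v)%N).
rewrite natrM natrX -{2}(subnKC le) exprD.
by rewrite mulrACA hy mul1r.
Qed.

Lemma lift_pint r : pint p r -> exists x : W, val x = ratr r.
Proof.
move=> [a [b [hb e]]]; have [y hy] := lift_nat_inv hb.
exists (a%:~R * y); have b0 : b%:R != 0 :> algC by exact: ndvd_neq0 hb.
apply: (mulfI b0); rewrite -[X in X * val _](rmorph_nat val) -rmorphM mulrCA hy mulr1.
rewrite rmorph_int -[b%:R](ratr_nat algC) -rmorphM mulrC e; exact: esym (ratr_int _ _).
Qed.

Lemma lred_p : red p%:R = 0. Proof. by rewrite rmorph_nat pcharf0. Qed.

Lemma lzetaX : zeta ^+ p = 1.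
Proof. by apply/eqP; rewrite -subr_eq0 subrX1 lzeta_sum mulr0. Qed.

Lemma lzeta_mod m n : m = n %[mod p] -> zeta ^+ m = zeta ^+ n.
Proof.
move=> h; rewrite (divn_eq m p) (divn_eq n p) h !exprD.
by rewrite ![(_ * p)%N]mulnC !exprM lzetaX !expr1n.
Qed.

Lemma lred_zeta : red zeta = 1.
Proof.
have : (red zeta - 1) ^+ p = 0.
  have := rmorphB (pFrobenius_aut pE) (red zeta) 1; rewrite /= !pFrobenius_autE => ->.
  by rewrite -rmorphXn lzetaX rmorph1 expr1n subrr.
by move/eqP; rewrite expf_eq0 subr_eq0 => /andP[_ /eqP].
Qed.

Local Notation lam := (zeta - 1).

Lemma lred_lam : red lam = 0.
Proof. by rewrite rmorphB rmorph1 lred_zeta subrr. Qed.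

Lemma lam_neq0 : lam != 0.
Proof.
apply/eqP => h; have := lift_nat_neq0 (prime_gt0 p_pr).
have z1 : zeta = 1 by apply/eqP; rewrite -subr_eq0 h.
have := lzeta_sum W; rewrite z1; under eq_bigr => i _ do rewrite expr1n.
by rewrite sumr_const card_ord => ->; rewrite eqxx.
Qed.

(** From the Eisenstein equation, $\lambda^{p-1}=-p(1+\lambda c)$ with $\lambda=\zeta-1$, and
    $\lambda$ reduces to 0. *)
Lemma lamX : exists eta : W, lam ^+ p.-1 = p%:R * eta /\ red eta = -1.
Proof.
have e : \sum_(i < p) lam ^+ i *+ 'C(p, i.+1) = 0.
  apply: (lift_mulI lam_neq0); rewrite mulr0 mulr_sumr.
  have : (1 + lam) ^+ p = 1 by rewrite addrC subrK lzetaX.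
  rewrite exprDn big_ord_recl /= bin0 expr1n expr0 mulr1n mulr1 => /eqP.
  rewrite -[X in _ == X]addr0 (inj_eq (addrI _)) => /eqP h; rewrite -[RHS]h.
  by apply: eq_bigr => i _; rewrite /bump /= add1n expr1n mul1r mulrnAr exprS.
have lamp : exists c, lam ^+ p.-1 = - (p%:R * (1 + lam * c)).
  have [c hc] := sum_bin_prime lam p_pr; exists c.
  by apply/eqP; rewrite -addr_eq0 -hc e.
have [c hc] := lamp; exists (- (1 + lam * c)); split; first by rewrite hc mulrN.
by rewrite rmorphN rmorphD rmorphM lred_lam mul0r addr0 rmorph1.
Qed.

Definition ah_lift_ex k : exists x : W, val x = ratr (artin_hasse p k) :=
  lift_pint (artin_hasse_pint p_pr k).
Definition ahl k : W := projT1 (cid (ah_lift_ex k)).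
Lemma ahlE k : val (ahl k) = ratr (artin_hasse p k).
Proof. exact: projT2 (cid (ah_lift_ex k)). Qed.

Lemma ahl_fact k : (k < p)%N -> k`!%:R * ahl k = 1.
Proof.
move=> kp; apply: (@lval_inj _ _ W).
rewrite rmorphM rmorph1 rmorph_nat ahlE artin_hasse_fact // fmorphV rmorph_nat.
by rewrite mulfV // pnatr_eq0 -lt0n fact_gt0.
Qed.

Lemma ahl0 : ahl 0 = 1.
Proof. by have := ahl_fact (prime_gt0 p_pr); rewrite mul1r. Qed.
Lemma ahl1 : ahl 1 = 1.
Proof. by have := ahl_fact (prime_gt1 p_pr); rewrite mul1r. Qed.

Lemma horner_sub (P : {poly W}) a b : exists q, P.[a] - P.[b] = (a - b) * q.
Proof.
have /factor_theorem[Q hQ] : root (P - P.[b]%:P) b.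
  by rewrite rootE hornerD hornerN hornerC subrr.
exists Q.[a]; have := congr1 (horner^~ a) hQ.
by rewrite hornerD hornerN hornerC hornerM hornerXsubC mulrC.
Qed.

Lemma ah_poly_split D : (0 < D)%N ->
  exists B, \poly_(k < D.+1) ahl k = 1 + 'X + 'X^2 * B.
Proof.
case: D => // D _; exists (\poly_(k < D) ahl k.+2).
rewrite !poly_def !big_ord_recl /= ahl0 ahl1 !scale1r expr0 expr1 addrA; congr (_ + _).
rewrite mulr_sumr; apply: eq_bigr => i _; rewrite /bump /= !add1n.
by rewrite -scalerAr -exprD.
Qed.

(* Newton iteration for E(gamma) = zeta, starting from gamma = zeta - 1 *)
Lemma gamma_exists D N : (0 < D)%N -> exists b y,
  let g := lam * (1 + lam * b) in
  (\poly_(k < D.+1) ahl k).[g] = zeta + lam ^+ N * y.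
Proof.
move=> D0; have [B hB] := ah_poly_split D0.
have hBx x : (\poly_(k < D.+1) ahl k).[x] = 1 + x + x ^+ 2 * B.[x].
  by rewrite hB !hornerD hornerM hornerXn hornerX hornerC.
(* With the exponent raised by 2, the correction $\lambda^{N+2}y$ is
   $\lambda\cdot\lambda\cdot\lambda^Ny$ and can be absorbed into $b$; the form $\lambda(1+\lambda
   b)$ is kept. *)
suff [b [y h]] : exists b y, let g := lam * (1 + lam * b) in
    (\poly_(k < D.+1) ahl k).[g] = zeta + lam ^+ N.+2 * y.
  by exists b, (lam ^+ 2 * y); rewrite /= h mulrA -exprD addn2.
elim: N => [|N [b [y h]]].
  exists 0, B.[lam]; rewrite /= mulr0 addr0 mulr1 hBx; ring.
move: h => /=; set g := lam * (1 + lam * b) => h.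
(* The derivative of the truncated series is 1 modulo $\lambda$, so subtracting the error itself
   gains one power of $\lambda$. *)
pose g' := g - lam ^+ N.+2 * y.
exists (b - lam ^+ N * y).
have -> : lam * (1 + lam * (b - lam ^+ N * y)) = g'.
  by rewrite /g' /g !exprS; ring.
have [q hq] := horner_sub B g' g.
exists (- y * (lam * (1 + lam * b) ^+ 2 * q + ((1 + lam * (b - lam ^+ N * y)) + (1 + lam * b)) * B.[g'])).
have e : g' ^+ 2 * B.[g'] - g ^+ 2 * B.[g]
   = g ^+ 2 * (B.[g'] - B.[g]) + (g' - g) * (g' + g) * B.[g'] by ring.
have e2 : g' + g = lam * ((1 + lam * (b - lam ^+ N * y)) + (1 + lam * b)).
  by rewrite /g' /g !exprS; ring.
have e3 : g' - g = - (lam ^+ N.+2 * y) by rewrite /g'; ring.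
have e4 : 1 + g' + g' ^+ 2 * B.[g'] = 1 + g + g ^+ 2 * B.[g]
   + (g' - g + g ^+ 2 * ((g' - g) * q) + (g' - g) * (g' + g) * B.[g']).
  by rewrite -hq; ring.
rewrite hBx e4 -hBx h e2 e3 /g !exprS; ring.
Qed.

Lemma teichX x k : T (x ^+ k) = T x ^+ k.
Proof. by elim: k => [|k IH]; rewrite ?expr0 ?teich1 // !exprS teichM IH. Qed.

Let EC : fps algC := fun k => ratr (artin_hasse p k).

Let EC_logder : logder (pser p 1) EC.
Proof.
apply: rec_logder; first by rewrite pser0.
move=> k; rewrite /EC -(ratr_nat algC) -rmorphM.
rewrite (logder_rec (pser0 _ _) (artin_hasse_logder p)) rmorph_sum.
apply: eq_bigr => i _; rewrite rmorphM; congr (_ * _); rewrite /pser.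
by case: ifP => _; rewrite ?rmorph1 ?rmorph0.
Qed.

Lemma logder_subst (R : comNzRingType) (h f : fps R) c : logder h f ->
  logder (fun k => h k * c ^+ k) (fun k => f k * c ^+ k).
Proof.
move=> hf; apply/funext => k; have := congr1 (fun F => F k) hf.
rewrite /fps_dt mulrA => ->; rewrite /fps_mul mulr_suml; apply: eq_bigr => i _.
have ik : (i <= k)%N by rewrite -ltnS.
have -> : c ^+ k = c ^+ i * c ^+ (k - i) by rewrite -exprD subnKC.
ring.
Qed.

Lemma frobenius_cycle (R : comNzRingType) (z : R) r j : z ^+ (p ^ r) = z ->
  \sum_(i < r) (z ^+ (p ^ i)) ^+ (p ^ j) = \sum_(i < r) z ^+ (p ^ i).
Proof.
move=> hz; elim: j => [|j IH]; first by apply: eq_bigr.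
rewrite -[RHS]IH; case: r hz {IH} => [|r] hz; first by rewrite !big_ord0.
rewrite big_ord_recr [RHS]big_ord_recl /= addrC; congr (_ + _).
  by rewrite expnS exprM -(exprM z) -expnSr hz expn0 expr1.
by apply: eq_bigr => i _; rewrite /bump /= add1n -!exprM -!expnD addSnnS.
Qed.

(** Let $\tau$ be the representative of $x$. The logarithmic derivative of $\prod_iE(\tau^{p^i}t)$
    has the trace $\sum_i\tau^{p^i}$ as coefficient at every $t^{p^j}$, since Frobenius permutes the
    conjugates. As the trace is $m$ up to a high power of $p$, the product is $E(t)^mV(t)$ with $V$
    close to 1. *)
Lemma ah_splitting_coef K D r x : x ^+ (p ^ r) = x ->
  exists m : nat, m%:R = \sum_(i < r) x ^+ (p ^ i) /\
   forall j, (j <= D)%N -> exists y : W,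
    (\prod_(i <- index_iota 0 r) ((\poly_(k < D.+1) ahl k) \Po (T x ^+ (p ^ i) *: 'X))
      - (\poly_(k < D.+1) ahl k) ^+ m)`_j = p%:R ^+ K * y.
Proof.
move=> hx; have [m [w hw]] := teich_trace W hx (K + D).+1.
have hz : T x ^+ (p ^ r) = T x by rewrite -teichX hx.
set P := \poly_(k < D.+1) ahl k.
exists m; split.
  have := congr1 red hw; rewrite rmorphD rmorphM rmorphXn /= lred_p expr0n /= mul0r addr0.
  rewrite rmorph_nat => <-; rewrite rmorph_sum; apply: eq_bigr => i _.
  by rewrite rmorphXn /= lred_teich.
pose Ai i : fps algC := fun k => EC k * (val (T x) ^+ (p ^ i)) ^+ k.
pose Y s := foldr (fun i f => fps_mul (Ai i) f) (fps_one algC) s.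
have Ai_logder i := logder_subst (val (T x) ^+ (p ^ i)) EC_logder.
have Y_logder s : logder (fun k => \sum_(i <- s) pser p 1 k * (val (T x) ^+ (p ^ i)) ^+ k) (Y s).
  elim: s => [|i s IH] /=.
    have -> : (fun k => \sum_(i <- [::]) pser p 1 k * (val (T x) ^+ (p ^ i)) ^+ k) = (fun=> 0).
      by apply/funext => k; rewrite big_nil.
    exact: logder1.
  have := logderM (Ai_logder i) IH; congr (logder _ _).
  by apply/funext => k; rewrite big_cons.
have Y0 s : Y s 0%N = 1.
  by elim: s => [|i s IH] //=; rewrite fps_mul0 IH mulr1 /Ai /EC rmorph1 mul1r.
pose q := p%:R ^+ (K + D).+1 * val w.
pose V := fps_solve (pser p q).
have V_logder : logder (pser p q) V by apply: fps_solveP; rewrite pser0.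
have Ypow0 : fps_pow EC m 0 = 1.
  elim: (m) => [|m' IH] //=; by rewrite fps_mul0 IH mulr1 /EC rmorph1.
have YE : Y (index_iota 0 r) = fps_mul (fps_pow EC m) V.
  apply: (logder_uniq _ _ (Y_logder _) _).
  - by rewrite big1 // => i _; rewrite pser0 mul0r.
  - by rewrite Y0 fps_mul0 Ypow0 mul1r.
  have := logderM (logder_pow m EC_logder) V_logder; congr (logder _ _).
  apply/funext => k; rewrite /= -mulr_sumr /pser; case: eqP => [hk|_]; last first.
    by rewrite mul0r mulr0 addr0.
  rewrite mul1r mulr1 big_mkord hk frobenius_cycle; last first.
    by rewrite -rmorphXn hz.
  have := congr1 val hw; rewrite rmorphD rmorphM rmorphXn /= !rmorph_nat -/q => <-.
  by rewrite rmorph_sum; apply: eq_bigr => i _; rewrite rmorphXn.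
have Vsmall j : (0 < j)%N -> (j <= D)%N -> exists y, V j = val (p%:R ^+ K * y).
  elim/ltn_ind: j => j IH j0 jD.
  have hV i : (i < j)%N -> exists y, V i = val y.
    case: i => [|i] ij; first by exists 1; rewrite rmorph1.
    by have [y ->] := IH i.+1 ij isT (leq_trans (ltnW ij) jD); exists (p%:R ^+ K * y).
  have /choice[f hf] : forall i : 'I_j, exists y, V i = val y by move=> i; apply: hV.
  (* Solving for $V_j$ divides by $j\le D$, which costs at most $p^j$; the accuracy $K+D+1$ of the
     trace was chosen to absorb this. *)
  have [b hb] := lift_div_nat j0.
  have jn0 : j%:R != 0 :> algC by rewrite pnatr_eq0 -lt0n.
  pose S := \sum_(i < j) (if (j - i == p ^ logn p (j - i))%N then w else 0) * f i.
  have hS : j%:R * V j = p%:R ^+ (K + D).+1 * val S.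
    rewrite (logder_rec (pser0 _ _) V_logder) rmorph_sum mulr_sumr.
    apply: eq_bigr => i _; rewrite /pser hf /q rmorphM.
    by case: ifP => _; rewrite ?rmorph0 ?mul0r ?mulr0 // mulrA.
  exists (p%:R ^+ (D.+1 - j) * b * S).
  apply: (mulfI jn0); rewrite hS -[j%:R](rmorph_nat val) -rmorphM.
  rewrite -[p%:R](rmorph_nat val) -rmorphXn -rmorphM; congr (val _).
  transitivity (p%:R ^+ K * p%:R ^+ (D.+1 - j) * (j%:R * b) * S); last by ring.
  by rewrite hb -!exprD; congr (_ ^+ _ * _); lia.
move=> j jD; have valP (s : seq nat) i : (i <= D)%N ->
    val (\prod_(i <- s) (P \Po (T x ^+ (p ^ i) *: 'X)))`_i = Y s i.
  elim: s i => [|a s IH] i iD; first by rewrite big_nil coef1 rmorph_nat.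
  rewrite big_cons coefM rmorph_sum; apply: eq_bigr => l _.
  have lD : (l <= D)%N by rewrite (leq_trans _ iD) // -ltnS.
  rewrite rmorphM IH ?(leq_trans (leq_subr _ _)) //; congr (_ * _).
  have -> : (P \Po (T x ^+ (p ^ a) *: 'X))`_l = P`_l * (T x ^+ (p ^ a)) ^+ l.
    rewrite comp_polyE coef_sum; case: (ltnP l (size P)) => lP.
      rewrite (bigD1 (Ordinal lP)) //= big1 ?addr0 => [|k hk].
        by rewrite exprZn coefZ coefZ coefXn eqxx mulr1.
      rewrite exprZn coefZ coefZ coefXn; case: eqP => [e|]; last by rewrite !mulr0.
      by move/eqP: hk; case; apply: val_inj.
    rewrite big1 => [|k _]; first by rewrite nth_default ?mul0r.
    rewrite exprZn coefZ coefZ coefXn gtn_eqF ?mulr0 //.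
    exact: leq_trans (ltn_ord k) lP.
  by rewrite coef_poly ltnS lD rmorphM !rmorphXn /= ahlE.
have valE i : (i <= D)%N -> val (P ^+ m)`_i = fps_pow EC m i.
  move=> iD; rewrite (@fps_powE _ D.+1) ?ltnS // -coef_map rmorphXn /=.
  suff -> : map_poly val P = \poly_(i < D.+1) EC i by [].
  apply/polyP=> k; rewrite coef_map !coef_poly; case: ifP => _ /=; last exact: rmorph0.
  by rewrite ahlE.
have /choice[f hf] : forall i : 'I_j, exists y, V (j - i)%N = val (p%:R ^+ K * y).
  by move=> i; apply: Vsmall; rewrite ?subn_gt0 // (leq_trans (leq_subr _ _)).
exists (\sum_(i < j) (P ^+ m)`_i * f i).
apply: (@lval_inj _ _ W); rewrite coefB rmorphB valP // valE // YE.
rewrite {1}/fps_mul big_ord_recr /= subnn mulr1 addrK mulr_sumr rmorph_sum.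
apply: eq_bigr => i _; rewrite hf -valE; last by rewrite ltnW // (leq_trans (ltn_ord i)).
by rewrite -rmorphM; congr (val _); ring.
Qed.

(** Three errors are multiples of $p^K$: coefficients up to degree $D$ by [ah_splitting_coef],
    higher terms because $\gamma^{p-1}$ is divisible by $p$ and $D\ge K(p-1)$, and the defect of
    $E(\gamma)=\zeta$, which is a multiple of $\lambda^{K(p-1)}$. *)
Lemma ah_splitting K D : (0 < D)%N -> (K * p.-1 <= D)%N -> exists gamma eta : W,
  [/\ gamma ^+ p.-1 = p%:R * eta, red eta = -1 &
      forall r x m, x ^+ (p ^ r) = x -> m%:R = \sum_(i < r) x ^+ (p ^ i) ->
      exists y, \prod_(i < r) (\sum_(k < D.+1) ahl k * gamma ^+ k * (T x ^+ (p ^ i)) ^+ k)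
        = zeta ^+ m + p%:R ^+ K * y].
Proof.
move=> D0 KD; have [b [y0]] := gamma_exists (K * p.-1) D0.
set gamma := lam * (1 + lam * b) => /= hg; have [eta0 [he0 he1]] := lamX.
have gX : gamma ^+ p.-1 = p%:R * (eta0 * (1 + lam * b) ^+ p.-1).
  by rewrite /gamma exprMn he0 mulrA.
exists gamma, (eta0 * (1 + lam * b) ^+ p.-1); split=> //.
  rewrite rmorphM rmorphXn rmorphD rmorphM rmorph1 lred_lam mul0r addr0 expr1n.
  by rewrite mulr1.
move=> r x m hx hm; have [m' [hm' hc]] := ah_splitting_coef K D hx.
have -> : zeta ^+ m = zeta ^+ m'.
  apply: lzeta_mod; move: hm; rewrite -hm'.
  wlog le : m m' {hm' hc} / (m <= m')%N => [hw h|].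
    by case/orP: (leq_total m m') => le; [exact: hw | apply/esym/hw].
  move/esym/eqP; rewrite -subr_eq0 -natrB // -(dvdn_pcharf pE) => h.
  by apply/esym/eqP; rewrite eqn_mod_dvd.
set P := \poly_(k < D.+1) ahl k in hg hc *.
set A := \prod_(i <- _) _ in hc.
have gsmall j : (D < j)%N -> exists y, gamma ^+ j = p%:R ^+ K * y.
  move=> Dj; have le : (p.-1 * K <= j)%N by rewrite mulnC (leq_trans KD) // ltnW.
  exists ((eta0 * (1 + lam * b) ^+ p.-1) ^+ K * gamma ^+ (j - p.-1 * K)).
  by rewrite -{1}(subnKC le) exprD exprM gX exprMn mulrA.
have [y hy] : exists y, (A - P ^+ m').[gamma] = p%:R ^+ K * y.
  rewrite horner_coef.
  have /choice[f hf] : forall i : 'I_(size (A - P ^+ m')), exists y,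
      (A - P ^+ m')`_i * gamma ^+ i = p%:R ^+ K * y.
    move=> i; case: (leqP i D) => iD.
      by have [y ->] := hc i iD; exists (y * gamma ^+ i); rewrite mulrA.
    by have [y ->] := gsmall i iD; exists ((A - P ^+ m')`_i * y); rewrite mulrCA.
  exists (\sum_i f i); rewrite mulr_sumr; exact: eq_bigr.
have [y1 hy1] : exists y, P.[gamma] ^+ m' = zeta ^+ m' + p%:R ^+ K * y.
  rewrite hg; have -> : lam ^+ (K * p.-1) * y0 = p%:R ^+ K * (eta0 ^+ K * y0).
    by rewrite mulnC exprM he0 exprMn mulrA.
  elim: (m') => [|n [y1 IH]]; first by exists 0; rewrite mulr0 addr0.
  rewrite exprS IH exprS.
  exists (zeta * y1 + eta0 ^+ K * y0 * (zeta ^+ n + p%:R ^+ K * y1)); ring.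
exists (y1 + y); rewrite mulrDr addrA -hy1 -hy hornerD hornerN horner_exp addrC subrK.
rewrite /A horner_prod big_mkord.
apply: eq_bigr => i _; rewrite horner_comp hornerZ hornerX /P horner_poly.
by apply: eq_bigr => k _; rewrite -mulrA -exprMn [gamma * _]mulrC.
Qed.
End Lift.

(** * Additive characters and point counts *)

Section Character.
Variables (p r : nat) (E L : finFieldType) (W : padic_lift p E) (h : {rmorphism L -> E}).
Hypotheses (p_pr : prime p) (pE : p \in [pchar E]) (cardL : #|L| = (p ^ r)%N).
Local Notation val := (lval W).
Local Notation red := (lred W).
Local Notation T := (teich W).
Local Notation zeta := (lzeta W).

Lemma L_pchar : p \in [pchar L].
Proof. exact: card_finPcharP cardL p_pr. Qed.
Let pL := L_pchar.

Let L_gt1 := finNzRing_gt1 L.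

Lemma expf_cardpr (y : L) : y ^+ (p ^ r) = y.
Proof. by rewrite -cardL expf_card. Qed.

Definition ftrace (y : L) : L := \sum_(i < r) y ^+ (p ^ i).

Lemma pfrobXD i (x y : L) : (x + y) ^+ (p ^ i) = x ^+ (p ^ i) + y ^+ (p ^ i).
Proof.
elim: i => [|i IH]; first by rewrite !expr1.
by rewrite expnSr !exprM IH -!(pFrobenius_autE pL) rmorphD.
Qed.

Lemma ftraceD x y : ftrace (x + y) = ftrace x + ftrace y.
Proof. by rewrite /ftrace -big_split; apply: eq_bigr => i _; rewrite pfrobXD. Qed.

Lemma ftrace_fixed y : ftrace y ^+ p = ftrace y.
Proof.
have := frobenius_cycle 1 (expf_cardpr y); rewrite -/(ftrace y) => e.
rewrite -[RHS]e /ftrace -(pFrobenius_autE pL) rmorph_sum; apply: eq_bigr => i _.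
by rewrite /= pFrobenius_autE.
Qed.

Lemma ftrace_nat y : exists m : nat, ftrace y = m%:R.
Proof. exact: pchar_expr_fixed pL (ftrace_fixed y). Qed.

Definition chi y : W := zeta ^+ projT1 (cid (ftrace_nat y)).

Lemma nat_pchar_mod (F : fieldType) m n : p \in [pchar F] ->
  m%:R = n%:R :> F -> m = n %[mod p].
Proof.
move=> pF; wlog le : m n / (m <= n)%N => [hw e|].
  by case/orP: (leq_total m n) => le; [exact: hw | apply/esym/hw].
move/esym/eqP; rewrite -subr_eq0 -natrB // -(dvdn_pcharf pF) => e.
by apply/esym/eqP; rewrite eqn_mod_dvd.
Qed.

Lemma chiE y m : ftrace y = m%:R -> chi y = zeta ^+ m.
Proof.
move=> e; rewrite /chi; case: (cid _) => m' /= e'.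
by apply: lzeta_mod; apply: (nat_pchar_mod pL); rewrite -e -e'.
Qed.

Lemma chiD x y : chi (x + y) = chi x * chi y.
Proof.
have [m hm] := ftrace_nat x; have [n hn] := ftrace_nat y.
rewrite (chiE hm) (chiE hn) -exprD; apply: chiE.
by rewrite ftraceD hm hn natrD.
Qed.

Lemma chi0 : chi 0 = 1.
Proof.
apply: (@chiE 0 0); rewrite /ftrace big1 // => i _.
by rewrite expr0n expn_eq0 -[p == 0%N]negbK -lt0n prime_gt0.
Qed.

Lemma chi_sum (I : finType) (f : I -> L) : chi (\sum_i f i) = \prod_i chi (f i).
Proof. exact: (big_morph chi chiD chi0). Qed.

(** The trace is a polynomial of degree $p^{r-1}<\#L$, so it does not vanish identically. If [chi]
    were 1 at an element of nonzero trace, Bezout would force $\zeta=1$. *)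
Lemma chi_nontrivial : exists y, chi y != 1.
Proof.
have r_gt0 : (0 < r)%N by case: r cardL L_gt1 => // ->.
have [y hy] : exists y, ftrace y != 0.
  apply/existsP; apply: contraT; rewrite negb_exists => /forallP H.
  pose P : {poly L} := \sum_(i < r) 'X^(p ^ i).
  have szP : size P = (p ^ r.-1).+1.
    rewrite /P -(prednK r_gt0) big_ord_recr /= addrC size_polyDl size_polyXn //.
    apply: (leq_ltn_trans (size_sum _ _ _)); apply/bigmax_leqP => i _.
    by rewrite size_polyXn ltn_exp2l ?prime_gt1.
  have P0 : P != 0 by rewrite -size_poly_eq0 szP.
  have := max_poly_roots P0 (_ : all (root P) (enum L)) (enum_uniq _).
  rewrite -cardE szP cardL ltnS leqNgt ltn_exp2l ?prime_gt1 // prednK // leqnn.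
  suff -> : all (root P) (enum L) by move=> /(_ isT).
  apply/allP => x _; rewrite rootE /P horner_sum; move: (H x); rewrite negbK.
  by rewrite /ftrace; under [in X in _ -> X]eq_bigr => i _ do rewrite hornerXn.
have [m hm] := ftrace_nat y; exists y; rewrite (chiE hm); apply/eqP => e.
have cop : coprime m p.
  rewrite coprime_sym prime_coprime //; apply: contra hy.
  by rewrite hm -(dvdn_pcharf pL).
have m_gt0 : (0 < m)%N by case: m hm hy {e cop} => // ->; rewrite eqxx.
have [u v huv _] := egcdnP p m_gt0.
have z1 : zeta = 1.
  have := congr1 (fun k => zeta ^+ k) huv; rewrite (eqP cop) addn1 exprS.
  by rewrite ![(_ * m)%N]mulnC ![(_ * p)%N]mulnC !exprM e lzetaX !expr1n mulr1.
by have := lam_neq0 W p_pr; rewrite z1 subrr eqxx.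
Qed.

Lemma chi_orth z : \sum_y chi (y * z) = if z == 0 then #|L|%:R else 0.
Proof.
case: eqVneq => [->|z0].
  by under eq_bigr => y _ do rewrite mulr0 chi0; rewrite sumr_const.
have [y0 hy0] := chi_nontrivial.
have n1 : chi y0 - 1 != 0 by rewrite subr_eq0.
apply: (lift_mulI n1); rewrite mulr0 mulrBl mul1r.
rewrite [X in _ - X](reindex_inj (addrI (y0 / z))) /= mulr_sumr.
apply/eqP; rewrite subr_eq0; apply/eqP/eq_bigr => y _.
by rewrite mulrDl mulfVK // chiD.
Qed.

Lemma chi_splitting K (theta : W -> W) :
  (forall r x m, x ^+ (p ^ r) = x -> m%:R = \sum_(i < r) x ^+ (p ^ i) ->
      exists y, \prod_(i < r) theta (T x ^+ (p ^ i)) = zeta ^+ m + p%:R ^+ K * y) ->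
  forall v, exists y, \prod_(i < r) theta (T (h v) ^+ (p ^ i)) = chi v + p%:R ^+ K * y.
Proof.
move=> H v; have [m hm] := ftrace_nat v.
rewrite (chiE hm); apply: H; first by rewrite -rmorphXn expf_cardpr.
rewrite -(rmorph_nat h) -hm rmorph_sum; apply: eq_bigr => i _.
by rewrite rmorphXn.
Qed.

Lemma teich_unit_sum k : \sum_(y : L | y != 0) T (h y) ^+ k
  = if (#|L|.-1 %| k)%N then #|L|.-1%:R else 0.
Proof.
have [g hg] := finField_prim_root L.
case: ifP => hk.
  rewrite (eq_bigr (fun=> 1)) => [|y y0].
    by rewrite sumr_const -(cardC1 (0 : L)).
  rewrite -teichX -rmorphXn; have -> : y ^+ k = 1; last by rewrite rmorph1 teich1.
  have y1 : y ^+ #|L|.-1 = 1.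
    by apply: (mulfI y0); rewrite mulr1 -exprS prednK ?expf_card // ltnW.
  by move/dvdnP: hk => [j ->]; rewrite mulnC exprM y1 expr1n.
have g0 : g != 0.
  have := expf_eq0 g #|L|.-1; rewrite (prim_expr_order hg) oner_eq0.
  by rewrite (prim_order_gt0 hg) /= => <-.
have n1 : T (h g) ^+ k - 1 != 0.
  rewrite subr_eq0 -teichX -rmorphXn; apply/eqP => /(congr1 red).
  rewrite lred_teich rmorph1 => /eqP; rewrite -(rmorph1 h) (inj_eq (fmorph_inj h)).
  by rewrite -(prim_order_dvd hg) hk.
apply: (lift_mulI n1); rewrite mulr0 mulrBl mul1r.
rewrite [X in _ - X](reindex_inj (mulfI g0)) /= mulr_sumr.
apply/eqP; rewrite subr_eq0; apply/eqP/eq_big => [y|y _].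
  by rewrite mulf_eq0 (negPf g0).
by rewrite rmorphM teichM exprMn.
Qed.

(** Written as a difference so that the product over coordinates expands over subsets $I$: the first
    term ignores whether $k$ is positive, the second requires it. *)
Lemma teich_sum k : \sum_(y : L) T (h y) ^+ k
  = (if (#|L|.-1 %| k)%N then #|L|%:R else 0)
    - (if (#|L|.-1 %| k)%N && (0 < k)%N then 1 else 0).
Proof.
rewrite (bigD1 0) //= teich_unit_sum rmorph0 teich0 expr0n.
have cL : #|L|%:R = 1 + #|L|.-1%:R :> W by rewrite addrC natr1 prednK // ltnW.
case: k => [|k] /=; first by rewrite dvdn0 subr0 cL.
by rewrite andbT add0r; case: ifP => _; rewrite ?cL ?subr0 // addrAC subrr add0r.
Qed.

(** * Projective point counts as character sums *)

Section Count.
Variables (F : finFieldType) (n N d : nat) (iota : {rmorphism F -> L}).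
Variables (A : 'I_N -> 'I_n.+1 -> nat) (lam : 'I_N -> F).
Hypotheses (d_gt0 : (0 < d)%N) (A_hom : forall j, (\sum_(i < n.+1) A j i)%N = d).

Lemma feval_scale c (x : 'I_n.+1 -> L) :
  feval iota A lam (fun i => c * x i) = c ^+ d * feval iota A lam x.
Proof.
rewrite /feval mulr_sumr; apply: eq_bigr => j _.
rewrite mulrCA; congr (_ * _); rewrite -(A_hom j) expr_sum -big_split.
by apply: eq_bigr => i _; rewrite exprMn.
Qed.

Lemma feval0 : feval iota A lam (fun=> 0) = 0.
Proof.
have := feval_scale 0 (fun=> 0); rewrite expr0n gtn_eqF // [RHS]mul0r => e.
by rewrite -[RHS]e; congr feval; apply/funext => i; rewrite mulr0.
Qed.

Let Z := [set x : {ffun 'I_n.+1 -> L} | feval iota A lam x == 0].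
Let NZ := [set x : {ffun 'I_n.+1 -> L} |
       [exists i, x i != 0%R] && (feval iota A lam x == 0%R)].

Lemma card_zeros : #|Z| = #|NZ|.+1.
Proof.
have z0 : [ffun=> 0] \in Z.
  rewrite inE; apply/eqP; rewrite -[RHS]feval0; congr feval.
  by apply/funext => i; rewrite ffunE.
rewrite (cardsD1 [ffun=> 0] Z) z0 add1n; congr _.+1; apply: eq_card => x.
rewrite !inE; congr (_ && _); apply/idP/existsP => [xn|[i xi]].
  apply/existsP; apply: contraNT xn; rewrite negb_exists => /forallP H.
  by apply/eqP/ffunP => i; rewrite ffunE; move: (H i); rewrite negbK => /eqP.
by apply: contraNneq xi => ->; rewrite ffunE.
Qed.

Let pivot (x : {ffun 'I_n.+1 -> L}) : L := if [pick i | x i != 0] is Some i then x i else 0.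
Let scale (c : L) (x : {ffun 'I_n.+1 -> L}) := [ffun i => c * x i].

(** Scaling permutes the nonzero zeros, and [pivot], a coordinate selected by the support alone, is
    multiplied by the scalar. Its fibres are therefore $\#L-1$ sets of equal size, and the integer
    division in [proj_count] is exact. *)
Lemma card_nonzero_zeros : (#|L|.-1 %| #|NZ|)%N.
Proof.
have pivot_scale c x : c != 0 -> pivot (scale c x) = c * pivot x.
  move=> c0; rewrite /pivot.
  have e : (fun i => scale c x i != 0) =1 (fun i => x i != 0).
    by move=> i; rewrite ffunE mulf_eq0 negb_or c0.
  by rewrite (eq_pick e); case: pickP => [i _|]; rewrite ?ffunE ?mulr0.
have NZ_scale c x : c != 0 -> (scale c x \in NZ) = (x \in NZ).
  move=> c0; rewrite !inE; congr (_ && _).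
    by apply: eq_existsb => i; rewrite ffunE mulf_eq0 negb_or c0.
  have -> : feval iota A lam (scale c x) = c ^+ d * feval iota A lam x.
    by rewrite -feval_scale; congr feval; apply/funext => i; rewrite ffunE.
  by rewrite mulf_eq0 expf_eq0 (negPf c0) andbF.
have pivot_NZ x : x \in NZ -> pivot x != 0.
  rewrite inE => /andP[/existsP[i xi] _]; rewrite /pivot; case: pickP => // H.
  by move: (H i); rewrite xi.
have scaleK c : c != 0 -> cancel (scale c) (scale c^-1).
  by move=> c0 x; apply/ffunP => i; rewrite !ffunE mulKf.
rewrite -sum1_card (partition_big pivot (fun c => c != 0)) //=.
rewrite (eq_bigr (fun=> #|[set x in NZ | pivot x == 1]|)) => [|c c0].
  by rewrite sum_nat_const -(cardC1 (0 : L)) dvdn_mulr.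
rewrite (reindex (scale c)); last first.
  exists (scale c^-1) => x _; first exact: scaleK.
  by rewrite -{1}(invrK c) scaleK ?invr_eq0.
rewrite -sum1_card; apply: eq_bigl => x; rewrite NZ_scale // !inE pivot_scale //.
by rewrite -{2}[c]mulr1 (inj_eq (mulfI c0)).
Qed.

(** With $Q=\#L$, orthogonality turns the double sum into $Q\,\#Z-Q^{n+1}$, where $\#Z=(Q-1)\#X+1$
    counts affine zeros. The geometric sum absorbs $Q^n-1$. *)
Lemma chi_count :
  (#|L|%:R * #|L|.-1%:R *
     ((proj_count iota A lam)%:Z - \sum_(i < n) (#|L| ^ i)%N%:Z)%:~R : W)
  = \sum_(x : {ffun 'I_n.+1 -> L}) \sum_(y : L | y != 0) chi (y * feval iota A lam x).
Proof.
have inner (x : {ffun 'I_n.+1 -> L}) :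
    \sum_(y : L | y != 0) chi (y * feval iota A lam x)
    = #|L|%:R * (x \in Z)%:R - 1.
  have := chi_orth (feval iota A lam x); rewrite (bigD1 0) //= mul0r chi0 => e.
  rewrite inE; apply/eqP; rewrite eq_sym subr_eq addrC e; apply/eqP.
  by case: eqP => _; rewrite ?mulr1 ?mulr0.
rewrite (eq_bigr _ (fun x _ => inner x)) sumrB -mulr_sumr sumr_const card_ffun card_ord.
rewrite -natr_sum; have -> : (\sum_x (x \in Z) = #|Z|)%N.
  by rewrite -sum1_card [RHS]big_mkcond; apply: eq_bigr => x _; case: (x \in Z).
rewrite card_zeros -(divnK card_nonzero_zeros) -/NZ.
have -> : proj_count iota A lam = (#|NZ| %/ #|L|.-1)%N by rewrite /proj_count subn1.
have := subrX1 (#|L|%:R : W) n; have -> : #|L|%:R - 1 = #|L|.-1%:R :> W.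
  by rewrite -{1}(prednK (ltnW L_gt1)) -natr1 addrK.
move=> e; rewrite -natr1 natrM natrX exprS rmorphB rmorph_sum /= -pmulrn.
have -> : \sum_(i < n) (#|L| ^ i)%N%:~R = \sum_(i < n) #|L|%:R ^+ i :> W.
  by apply: eq_bigr => i _; rewrite -natrX.
rewrite mulrBr -!mulrA -e; ring.
Qed.
End Count.
End Character.

(** * The trace formula *)

Section Walk.
Variables (R : comNzRingType) (p m : nat) (Tm : finType).
Variables (e : Tm -> 'I_m -> nat) (c : nat -> Tm -> R).
Local Notation X := {ffun 'I_m -> nat}.
Implicit Types (S : X) (phi : X -> R).

Definition xshift r nu S : X := [ffun i => (S i + p ^ r * e nu i)%N].

(* [walk r phi] expands the product of the polynomials sum_nu c k nu z^(p^k e(nu)),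
   k < r, and replaces each monomial z^S by phi S. *)
Fixpoint walk r phi : R :=
  match r with
  | 0 => phi [ffun=> 0%N]
  | r'.+1 => \sum_nu c r' nu * walk r' (fun S => phi (xshift r' nu S))
  end.

(** Only exponents that the walk can reach matter; this lets size bounds and homogeneity be used
    when [phi] is rewritten. *)
Lemma eq_walk (P : nat -> X -> Prop) r phi psi :
  P 0%N [ffun=> 0%N] -> (forall k nu S, P k S -> P k.+1 (xshift k nu S)) ->
  (forall S, P r S -> phi S = psi S) -> walk r phi = walk r psi.
Proof.
move=> P0 PS; elim: r phi psi => [|r IH] phi psi H /=; first exact: H.
apply: eq_bigr => nu _; congr (_ * _); apply: IH => S hS; apply: H; exact: PS.
Qed.

Lemma walk_sum (I : Type) (s : seq I) (Q : pred I) (f : I -> X -> R) r :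
  walk r (fun S => \sum_(i <- s | Q i) f i S) = \sum_(i <- s | Q i) walk r (f i).
Proof.
elim: r f => [|r IH] f //=.
rewrite exchange_big /=; apply: eq_bigr => nu _.
by rewrite IH mulr_sumr.
Qed.

Lemma walkZ k r phi : walk r (fun S => k * phi S) = k * walk r phi.
Proof.
elim: r phi => [|r IH] phi //=; rewrite mulr_sumr; apply: eq_bigr => nu _.
by rewrite IH mulrCA.
Qed.

Lemma walk_monomial (z : 'I_m -> R) r :
  walk r (fun S => \prod_i z i ^+ S i)
  = \prod_(k < r) \sum_nu c k nu * \prod_i (z i ^+ (p ^ k)) ^+ e nu i.
Proof.
elim: r => [|r IH] /=.
  by rewrite big_ord0 big1 // => i _; rewrite ffunE.
rewrite big_ord_recr /= mulr_sumr -IH; apply: eq_bigr => nu _.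
rewrite mulrCA; congr (_ * _); rewrite mulrC -walkZ; congr (walk _ _).
apply/funext => S; rewrite -big_split; apply: eq_bigr => i _ /=.
by rewrite ffunE exprD exprM mulrC.
Qed.
End Walk.

(** The highest index stands on the left, as in $\bar A(\lambda^{p^{a-1}})\cdots\bar A(\lambda)$. *)
Fixpoint mprod (R : pzSemiRingType) s (M : nat -> 'M[R]_s) r : 'M[R]_s :=
  if r is r'.+1 then M r' *m mprod M r' else 1%:M.

Section TraceFormula.
Variables (R : comNzRingType) (p n d B : nat) (Tm : finType).
Variables (e : Tm -> 'I_n.+2 -> nat) (c : nat -> Tm -> R).
Local Notation X := {ffun 'I_n.+2 -> nat}.
Local Notation Box := {ffun 'I_n.+2 -> 'I_B.+1}.
Hypotheses (p_gt1 : (1 < p)%N).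

Definition homog (S : 'I_n.+2 -> nat) : bool :=
  (\sum_(i < n.+1) S (widen_ord (leqnSn _) i) == d * S ord_max)%N.

Hypotheses (e_hom : forall nu, homog (e nu)).
Hypotheses (e_bound : forall nu i, (e nu i <= B * p.-1)%N).

Definition reach r (S : X) : Prop := homog S /\ forall i, (S i <= B * (p ^ r).-1)%N.

Lemma homogD (S S' : 'I_n.+2 -> nat) : homog S -> homog S' -> homog (fun i => S i + S' i)%N.
Proof.
by move=> /eqP h /eqP h'; rewrite /homog big_split /= h h' mulnDr.
Qed.

Lemma homogM k (S : 'I_n.+2 -> nat) : homog S -> homog (fun i => k * S i)%N.
Proof.
by move=> /eqP h; rewrite /homog -big_distrr /= h mulnCA.
Qed.

Lemma homogM_inv k (S : 'I_n.+2 -> nat) : (0 < k)%N -> homog (fun i => k * S i)%N -> homog S.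
Proof.
by move=> k0; rewrite /homog -big_distrr /= mulnCA eqn_pmul2l.
Qed.

Lemma reach0 : reach 0 [ffun=> 0%N].
Proof.
split; last by move=> i; rewrite ffunE.
by rewrite /homog big1 => [|i _]; rewrite ffunE ?muln0.
Qed.

Lemma reachS r nu S : reach r S -> reach r.+1 (xshift p e r nu S).
Proof.
move=> [h1 h2]; split.
  have := homogD h1 (homogM (p ^ r) (e_hom nu)); rewrite /homog.
  by congr (_ == _); [apply: eq_bigr => i _|]; rewrite ffunE.
move=> i; rewrite ffunE; have := h2 i; have := e_bound nu i.
have q0 : (0 < p ^ r)%N by rewrite expn_gt0 ltnW.
move=> he hS; apply: (@leq_trans (B * (p ^ r).-1 + p ^ r * (B * p.-1))%N).
  by rewrite leq_add // leq_mul.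
rewrite expnS; move: q0; case: (p ^ r)%N => // Q _.
by case: p p_gt1 => // P _; rewrite /=; lia.
Qed.

Variable I : {set 'I_n.+1}.

(** The box makes the index set finite. It loses nothing: exponents of a step are at most $B(p-1)$,
    so any $u$ with $S=(p^r-1)u$ for a reachable $S$ lies in it. *)
Definition Jset : {set Box} := [set u : Box | homog (fun i => u i : nat) &&
  [forall i in I, 0 < (u (widen_ord (leqnSn _) i) : nat)]%N].

Definition stepb (nu : Tm) (u v : Box) : bool := [forall i, e nu i + v i == p * u i]%N.

Definition walkb (r : nat) (u v : Box) (S : X) : bool := [forall i, v i + S i == p ^ r * u i]%N.

Definition tmx k : 'M[R]_#|Jset| :=
  \matrix_(i, j) \sum_(nu | stepb nu (enum_val i) (enum_val j)) c k nu.

(** The intermediate index of a matrix product is forced: $w=pu-e(\nu)$. It inherits homogeneity and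
    positivity on $I$ from $p^rw=v+S$. *)
Lemma step_walk r nu (u v : Box) S : v \in Jset -> reach r S ->
  \sum_(w in Jset) ((stepb nu u w)%:R * (walkb r w v S)%:R : R)
  = (walkb r.+1 u v (xshift p e r nu S))%:R.
Proof.
have q0 : (0 < p ^ r)%N by rewrite expn_gt0 ltnW.
move=> vJ [S1 S2]; case: (boolP (walkb _ _ _ (xshift _ _ _ _ _))) => H; last first.
  rewrite big1 // => w _; case: (boolP (stepb _ _ _)) => h1; rewrite ?mul0r // mul1r.
  case: (boolP (walkb _ _ _ _)) => h2 //; case/negP: H; apply/forallP => i.
  rewrite ffunE; move/forallP/(_ i)/eqP: h1; move/forallP/(_ i)/eqP: h2 => h2 h1.
  by rewrite addnA h2 expnSr -mulnA -h1 mulnDr addnC.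
have E i : (v i + S i + p ^ r * e nu i = p ^ r * (p * u i))%N.
  by move/forallP/(_ i)/eqP: H; rewrite ffunE addnA expnSr mulnA.
have le i : (e nu i <= p * u i)%N.
  by rewrite -(leq_pmul2l q0) -E leq_addl.
have E2 i : (v i + S i = p ^ r * (p * u i - e nu i))%N.
  by rewrite mulnBr -E addnK.
(* Here $p^rw=v+S\le B+B(p^r-1)$, so $w$ stays in the box. *)
have wB i : (p * u i - e nu i < B.+1)%N.
  rewrite ltnS -(leq_pmul2l q0) -E2 mulnC.
  have := S2 i; have : (v i <= B)%N by rewrite -ltnS.
  move: q0; case: (p ^ r)%N => // Q _ /=; lia.
pose w : Box := [ffun i => Ordinal (wB i)].
have ww i : (w i : nat) = (p * u i - e nu i)%N by rewrite ffunE.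
have wJ : w \in Jset.
  move: vJ; rewrite !inE => /andP[v1 /forallP v2]; apply/andP; split.
    apply: (@homogM_inv (p ^ r)) => //; have := homogD v1 S1; rewrite /homog.
    by congr (_ == _); [apply: eq_bigr => i _|]; rewrite E2 ww.
  apply/forallP => i; apply/implyP => iI; move: (v2 i); rewrite iI /= => v0.
  by rewrite -(ltn_pmul2l q0) muln0 ww -E2 addn_gt0 v0.
rewrite (bigD1 w) //= [X in _ + X]big1 ?addr0 => [|w' /andP[_ w'w]].
  have -> : stepb nu u w by apply/forallP => i; rewrite ww subnKC.
  have -> : walkb r w v S by apply/forallP => i; rewrite ww E2.
  by rewrite mulr1.
case: (boolP (stepb _ _ _)) => h; rewrite ?mul0r //; case/eqP: w'w.
apply/ffunP => i; apply: val_inj; rewrite /= ww.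
by move/forallP/(_ i)/eqP: h => <-; rewrite addKn.
Qed.

Lemma mprod_tmx r i j : mprod tmx r i j
  = walk p e c r (fun S => (walkb r (enum_val i) (enum_val j) S)%:R).
Proof.
elim: r i j => [|r IH] i j /=.
  rewrite mxE; congr (_%:R); congr nat_of_bool; apply/eqP/forallP => [-> k|h].
    by rewrite ffunE addn0 mul1n.
  apply: enum_val_inj; apply/ffunP => k; apply: val_inj => /=.
  by have /eqP := h k; rewrite ffunE addn0 mul1n.
rewrite mxE; under [LHS]eq_bigr => k _ do rewrite IH [tmx _ _ _]mxE big_mkcond mulr_suml.
rewrite exchange_big /=; apply: eq_bigr => nu _.
have vJ := enum_valP j.
rewrite (eq_walk (P := reach) c reach0 reachS (fun S hS => esym (step_walk nu (enum_val i) vJ hS))).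
rewrite walk_sum mulr_sumr [RHS]big_enum_val /=.
apply: eq_bigr => k _; rewrite walkZ mulrA; congr (_ * _).
by case: ifP; rewrite ?mulr1 ?mulr0.
Qed.

(** On the diagonal, $u+S=p^ru$ means $S=(p^r-1)u$: a reachable $S$ contributes once if $p^r-1$
    divides it and its quotient lies in [Jset], and not at all otherwise. This is the divisibility
    condition that sums over Teichmueller points impose. *)
Lemma mprod_trace r : (0 < r)%N -> \tr (mprod tmx r)
  = walk p e c r (fun S => [forall i, ((p ^ r).-1 %| S i)%N]%:R *
      [forall i in I, 0 < (S (widen_ord (leqnSn _) i))]%N%:R).
Proof.
move=> r0; rewrite /mxtrace; under eq_bigr => i _ do rewrite mprod_tmx.
rewrite -walk_sum; apply: (eq_walk (P := reach) c reach0 reachS) => S [S1 S2].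
rewrite -(big_enum_val (fun u => (walkb r u u S)%:R)) /=.
have q1 : (1 < p ^ r)%N by rewrite -(expn0 p) ltn_exp2l.
have q0 : (0 < (p ^ r).-1)%N by case: (p ^ r)%N q1 => [|[]].
have qE u k : (u + k == p ^ r * u)%N = (k == (p ^ r).-1 * u)%N.
  by rewrite -{1}(prednK (ltnW q1)) mulSn eqn_add2l.
case: (boolP [forall i, _]) => H; last first.
  rewrite mul0r big1 // => u uJ; case: (boolP (walkb _ _ _ _)) => // h.
  case/negP: H; apply/forallP => i; move/forallP/(_ i): h; rewrite qE => /eqP ->.
  exact: dvdn_mulr.
rewrite mul1r; have uB i : (S i %/ (p ^ r).-1 < B.+1)%N.
  by rewrite ltnS leq_divLR ?(forallP H) // S2.
pose u : Box := [ffun i => Ordinal (uB i)].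
have uE i : (S i = (p ^ r).-1 * u i)%N by rewrite ffunE /= mulnC divnK // (forallP H).
have uw : walkb r u u S by apply/forallP => i; rewrite qE uE.
have uJ : (u \in Jset) = [forall i in I, 0 < (S (widen_ord (leqnSn _) i))]%N.
  rewrite inE; have -> : homog (fun i => u i : nat).
    apply: (homogM_inv q0); move: S1; rewrite /homog.
    by congr (_ == _); [apply: eq_bigr => i _|]; rewrite uE.
  apply: eq_forallb_in => i iI; rewrite uE.
  by rewrite muln_gt0 q0.
rewrite -uJ (bigID (pred1 u)) /= [X in _ + X]big1 ?addr0 => [|u' /andP[_ u'u]].
  case: (boolP (u \in Jset)) => uJ'.
    by rewrite (big_pred1 u) ?uw // => u' /=; case: eqP => [->|]; rewrite ?uJ' ?andbF.
  by rewrite big_pred0 // => u' /=; case: eqP => [->|]; rewrite ?(negPf uJ') ?andbF.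
case: (boolP (walkb _ _ _ _)) => // h; case/eqP: u'u.
apply/ffunP => i; apply: val_inj; apply/eqP => /=.
by move/forallP/(_ i): h; rewrite qE uE eqn_pmul2l // eq_sym.
Qed.
End TraceFormula.

Section Congruence.
Variables (R : comNzRingType) (q : R).
Definition congr_mod (x y : R) := exists t, x = y + q * t.

Lemma congr_mod_prod (I : Type) (s : seq I) (f g : I -> R) :
  (forall i, congr_mod (f i) (g i)) ->
  congr_mod (\prod_(i <- s) f i) (\prod_(i <- s) g i).
Proof.
move=> H; elim: s => [|i s [t IH]]; first by exists 0; rewrite !big_nil mulr0 addr0.
have [u hu] := H i; rewrite !big_cons IH hu.
exists (g i * t + u * (\prod_(j <- s) g j + q * t)); ring.
Qed.

Lemma congr_mod_sum (I : Type) (s : seq I) (P : pred I) (f g : I -> R) :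
  (forall i, congr_mod (f i) (g i)) ->
  congr_mod (\sum_(i <- s | P i) f i) (\sum_(i <- s | P i) g i).
Proof.
move=> H; elim: s => [|i s [t IH]]; first by exists 0; rewrite !big_nil mulr0 addr0.
have [u hu] := H i; rewrite !big_cons; case: ifP => _; last by exists t.
rewrite IH hu; exists (t + u); ring.
Qed.
End Congruence.

Section PointTrace.
Variables (p r : nat) (E L : finFieldType) (W : padic_lift p E) (h : {rmorphism L -> E}).
Hypotheses (p_pr : prime p) (pE : p \in [pchar E]) (cardL : #|L| = (p ^ r)%N).
Local Notation T := (teich W).
Variables (n d B : nat).

Let L_gt1 := finNzRing_gt1 L.

Definition tpoint (x : 'I_n.+1 -> L) (y : L) (i : 'I_n.+2) : W :=
  if (i == n.+1 :> nat) then T (h y) else T (h (x (inord i))).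

Lemma tpoint_prod x y (S : 'I_n.+2 -> nat) : \prod_i tpoint x y i ^+ S i
  = (\prod_i T (h (x i)) ^+ S (widen_ord (leqnSn _) i)) * T (h y) ^+ S ord_max.
Proof.
rewrite big_ord_recr /= {2}/tpoint eqxx; congr (_ * _).
apply: eq_bigr => i _; rewrite /tpoint /= ltn_eqF //; congr (T (h (x _)) ^+ _).
by apply: val_inj; rewrite /= inordK.
Qed.

Section Toric.
Variables (Tm : finType) (e : Tm -> 'I_n.+2 -> nat) (c : nat -> Tm -> W).
Hypotheses (e_hom : forall nu, homog d (e nu)).
Hypotheses (e_bound : forall nu i, (e nu i <= B * p.-1)%N).

(** Expansion of the product: $I$ collects the coordinates where the negative term is chosen, hence
    the sign, the positivity condition on $I$ and the power of $Q$ from the complement. *)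
Lemma toric_pointwise (q : nat) (S : 'I_n.+2 -> nat) (Q q' : W) :
  (\prod_i ((if (q %| S (widen_ord (leqnSn n.+1) i))%N then Q else 0)
    - (if (q %| S (widen_ord (leqnSn n.+1) i))%N
         && (0 < S (widen_ord (leqnSn n.+1) i))%N then 1 else 0)))
  * (if (q %| S ord_max)%N then q' else 0)
  = \sum_(I : {set 'I_n.+1}) q' * (-1) ^+ #|I| * Q ^+ #|~: I|
     * ([forall i, (q %| S i)%N]%:R
       * [forall i in I, 0 < (S (widen_ord (leqnSn _) i))]%N%:R).
Proof.
under eq_bigr => i _ do rewrite addrC.
rewrite bigA_distr mulr_suml; apply: eq_big => [I|I _]; first by rewrite inE.
case: (boolP [forall i, _]) => [/forallP H|]; last first.
  rewrite negb_forall => /existsP[i Hi]; rewrite mul0r mulr0.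
  case: (unliftP ord_max i) => [j|] ij; last by rewrite -ij (negPf Hi) mulr0.
  have e1 : i = widen_ord (leqnSn n.+1) j.
    by apply: val_inj; rewrite ij /= /bump leqNgt ltn_ord.
  rewrite (bigD1 j) //= -e1 (negPf Hi) /= oppr0.
  by case: ifP => _; rewrite !mul0r.
rewrite H mul1r mulrC -!mulrA; congr (_ * _).
under eq_bigr => i _ do rewrite !H /=.
transitivity (\prod_(i in I) ((-1) * ((0 < S (widen_ord (leqnSn n.+1) i))%N%:R))
   * \prod_(i in ~: I) Q).
  rewrite (bigID (mem I)); congr (_ * _).
    by apply: eq_bigr => i /= ->; case: ifP => _; rewrite ?mulr1 ?mulr0 ?oppr0.
  apply: eq_big => [i|i /=]; first by rewrite in_setC.
  by move=> H1; rewrite ifN.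
rewrite prodr_const mulrA mulrAC; congr (_ * _).
rewrite big_split /= prodr_const; congr (_ * _).
case: (boolP [forall i in I, _]) => [/forall_inP H2|].
  by rewrite big1 // => i iI; rewrite H2.
rewrite negb_forall => /existsP[i]; rewrite negb_imply => /andP[iI H2].
by rewrite (bigD1 i) //= (negPf H2) mul0r.
Qed.

Lemma toric_sum : (0 < r)%N ->
  \sum_(x : {ffun 'I_n.+1 -> L}) \sum_(y : L | y != 0)
    walk p e c r (fun S => \prod_i tpoint x y i ^+ S i)
  = \sum_(I : {set 'I_n.+1}) #|L|.-1%:R * (-1) ^+ #|I| * #|L|%:R ^+ #|~: I|
       * \tr (mprod (tmx p d B e c I) r).
Proof.
move=> r0; under eq_bigr => x _ do rewrite -walk_sum.
rewrite -walk_sum.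
under [RHS]eq_bigr => I _.
  rewrite (mprod_trace c (prime_gt1 p_pr) e_hom e_bound I r0) -walkZ; over.
rewrite -walk_sum; congr walk; apply/funext => S.
rewrite -cardL -toric_pointwise.
under eq_bigr => i _ do rewrite -(teich_sum W h).
rewrite -(teich_unit_sum W h) bigA_distr_bigA mulr_suml; apply: eq_bigr => x _.
by rewrite mulr_sumr; apply: eq_bigr => y _; rewrite tpoint_prod.
Qed.
End Toric.

(** * Specialisation to the hypersurface *)

Section Hypersurface.
Variables (F : finFieldType) (N K D : nat) (iota : {rmorphism F -> L}).
Variables (A : 'I_N -> 'I_n.+1 -> nat) (lam : 'I_N -> F) (j : {rmorphism F -> E}).
Hypothesis h_iota : forall a, h (iota a) = j a.
Hypotheses (d_gt0 : (0 < d)%N) (A_hom : forall k, (\sum_(i < n.+1) A k i)%N = d).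
Variables (gamma : W).
Local Notation Tm := {ffun 'I_N -> 'I_D.+1}.

Definition expo (nu : Tm) (i : 'I_n.+2) : nat := (\sum_(k < N) nu k * aplus A k i)%N.

(** For $k=0$, the contribution of $\nu$ to $\prod_j\theta(\hat\lambda_jz^{{\bf a}_j^+})$, with
    $\hat\lambda_j$ the Teichmueller lift; $k$ is the Frobenius twist. *)
Definition coefg (k : nat) (nu : Tm) : W :=
  \prod_(l < N) (ahl W p_pr pE (nu l) * gamma ^+ nu l * (T (j (lam l)) ^+ (p ^ k)) ^+ nu l).

Definition theta (t : W) : W := \sum_(l < D.+1) ahl W p_pr pE l * gamma ^+ l * t ^+ l.

Lemma aplus_widen k i : aplus A k (widen_ord (leqnSn n.+1) i) = A k i.
Proof. by rewrite /aplus /= ltn_eqF // inord_val. Qed.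

Lemma aplus_max k : aplus A k ord_max = 1%N.
Proof. by rewrite /aplus eqxx. Qed.

Lemma expo_hom nu : homog d (expo nu).
Proof.
rewrite /homog /expo exchange_big /= mulnC; apply/eqP.
rewrite big_distrl; apply: eq_bigr => k _ /=.
rewrite aplus_max muln1 -(A_hom k) big_distrr; apply: eq_bigr => i _ /=.
by rewrite aplus_widen.
Qed.

Lemma aplus_le k i : (aplus A k i <= d)%N.
Proof.
rewrite /aplus; case: ifP => // _.
by rewrite -(A_hom k) (bigD1 (inord i)) //= leq_addr.
Qed.

Lemma expo_bound nu i : (expo nu i <= N * (D * d))%N.
Proof.
rewrite /expo -[N in (N * _)%N]card_ord -sum_nat_const; apply: leq_sum => k _.
by rewrite leq_mul ?aplus_le // -ltnS.
Qed.

Lemma teich_monomial x y k :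
  T (h (y * (iota (lam k) * \prod_(i < n.+1) x i ^+ A k i)))
  = T (j (lam k)) * \prod_i tpoint x y i ^+ aplus A k i.
Proof.
rewrite tpoint_prod aplus_max expr1 !rmorphM h_iota !teichM.
rewrite mulrCA; congr (_ * _); rewrite mulrC; congr (_ * _).
rewrite rmorph_prod (big_morph T (@teichM _ _ W) (teich1 W)); apply: eq_bigr => i _.
by rewrite rmorphXn teichX aplus_widen.
Qed.

Lemma theta_prod x y k :
  \prod_(l < N) theta (T (h (y * (iota (lam l) * \prod_(i < n.+1) x i ^+ A l i))) ^+ (p ^ k))
  = \sum_nu coefg k nu * \prod_i (tpoint x y i ^+ (p ^ k)) ^+ expo nu i.
Proof.
rewrite /theta bigA_distr_bigA; apply: eq_bigr => nu _.
rewrite /coefg.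
have -> : \prod_i (tpoint x y i ^+ (p ^ k)) ^+ expo nu i
   = \prod_(l < N) (\prod_i tpoint x y i ^+ aplus A l i) ^+ (p ^ k * nu l).
  under eq_bigr => i _ do rewrite /expo expr_sum.
  rewrite exchange_big; apply: eq_bigr => l _ /=; rewrite -prodrXl.
  apply: eq_bigr => i _; rewrite -!exprM; congr (_ ^+ _).
  by rewrite mulnA [RHS]mulnC.
rewrite -big_split; apply: eq_bigr => l _ /=.
by rewrite teich_monomial exprMn exprMn -!exprM mulrA.
Qed.

Lemma point_trace : (0 < r)%N -> (N * (D * d) <= B * p.-1)%N ->
  (forall v, congr_mod (p%:R ^+ K) (\prod_(i < r) theta (T (h v) ^+ (p ^ i)))
      (chi W p_pr cardL v)) ->
  congr_mod (p%:R ^+ K)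
   (\sum_(I : {set 'I_n.+1}) #|L|.-1%:R * (-1) ^+ #|I| * #|L|%:R ^+ #|~: I|
       * \tr (mprod (tmx p d B expo coefg I) r))
   (#|L|%:R * #|L|.-1%:R *
     ((proj_count iota A lam)%:Z - \sum_(i < n) (#|L| ^ i)%N%:Z)%:~R).
Proof.
move=> r0 hB H; rewrite -(toric_sum coefg expo_hom _ r0); last first.
  by move=> nu i; apply: leq_trans (expo_bound _ _) hB.
rewrite (chi_count W p_pr cardL iota lam d_gt0 A_hom).
apply: congr_mod_sum => x; apply: congr_mod_sum => y; rewrite walk_monomial.
rewrite /feval mulr_sumr chi_sum.
rewrite -(eq_bigr _ (fun (k : 'I_r) _ => theta_prod x y k)).
rewrite exchange_big /=; apply: congr_mod_prod => l; exact: H.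
Qed.
End Hypersurface.
End PointTrace.

(** * Divisibility by powers of p *)

Lemma Jset_card n d B (I : {set 'I_n.+1}) (u : {ffun 'I_n.+2 -> 'I_B.+1}) :
  u \in Jset d B I -> (#|I| <= d * u ord_max)%N.
Proof.
rewrite inE => /andP[/eqP <- /forall_inP H].
rewrite -sum1_card [X in (_ <= X)%N](bigID (mem I)) /=.
apply: leq_trans (leq_addr _ _).
by apply: leq_sum => i iI; apply: H.
Qed.

(** Let $k=\#I$ and $w$ the weight, so $k\le dw$. If $k\le n$, then $d(w+n-k)\ge k+(n-k)=dm$. If
    $k=n+1$, then $dw>dm$. This makes the subtraction in [excess] exact. *)
Lemma Jset_weight n d B m (I : {set 'I_n.+1}) (u : {ffun 'I_n.+2 -> 'I_B.+1}) :
  (0 < d)%N -> n = (d * m)%N -> u \in Jset d B I -> (#|I| + m <= u ord_max + n)%N.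
Proof.
move=> d0 nE /Jset_card h; have h2 : (#|I| <= n.+1)%N by have := max_card (mem I); rewrite card_ord.
set w := (u ord_max : nat) in h *; set k := #|I| in h h2 *.
rewrite leqNgt; apply/negP => lt.
have [kn|nk] := leqP k n.
  have : (d * (w + (n - k)).+1 <= d * m)%N by rewrite leq_mul2l; lia.
  rewrite mulnS mulnDr -nE; have : (n - k <= d * (n - k))%N by rewrite leq_pmull.
  by lia.
have : (d * w <= d * m)%N by rewrite leq_mul2l; lia.
by rewrite -nE; lia.
Qed.

Lemma mprodD (R : comNzRingType) s (M : nat -> 'M[R]_s) k a :
  (forall i, M (a + i)%N = M i) -> mprod M (a + k) = mprod M k *m mprod M a.
Proof.
move=> H; elim: k => [|k IH]; first by rewrite addn0 mul1mx.
by rewrite addnS /= IH H mulmxA.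
Qed.

Lemma mprod_iter (R : comNzRingType) s (M : nat -> 'M[R]_s) a k :
  (forall i, M (a + i)%N = M i) -> mprod M (a * k) = mprod M a ^+ k.
Proof.
move=> H; have HH j i : M (a * j + i)%N = M i.
  by elim: j => [|j IH]; rewrite ?muln0 // mulnS -addnA H.
elim: k => [|k IH]; first by rewrite muln0.
by rewrite mulnSr mprodD // IH exprS.
Qed.

Definition wt n B (u : {ffun 'I_n.+2 -> 'I_B.+1}) : nat := u ord_max.

Section Scaled.
Variables (p : nat) (E : finFieldType) (W : padic_lift p E).
Hypotheses (p_pr : prime p) (pE : p \in [pchar E]).
Local Notation T := (teich W).
Variables (n d B N D m : nat).
Variables (A : 'I_N -> 'I_n.+1 -> nat) (lamE : 'I_N -> E).
Hypotheses (d_gt0 : (0 < d)%N) (n_dm : n = (d * m)%N).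
Variables (gamma eta : W).
Hypotheses (gammaX : gamma ^+ p.-1 = p%:R * eta) (red_eta : lred W eta = -1).
Local Notation Tm := {ffun 'I_N -> 'I_D.+1}.
Variable I : {set 'I_n.+1}.
Local Notation J := (Jset d B I).

Definition hcoef k (u v : {ffun 'I_n.+2 -> 'I_B.+1}) : W :=
  \sum_(nu : Tm | stepb p (expo A) nu u v)
    \prod_(l < N) (ahl W p_pr pE (nu l) * (T (lamE l) ^+ (p ^ k)) ^+ nu l).

Definition excess (u : {ffun 'I_n.+2 -> 'I_B.+1}) : nat := (u ord_max + n - (#|I| + m))%N.

(* p^(m + #|I|) bmx is conjugate to p^n cmx by the diagonal matrix of the gamma^(u_(n+1)). *)
Definition bmx k : 'M[W]_#|J| := \matrix_(i, j)
  (p%:R ^+ excess (enum_val i) * eta ^+ wt (enum_val i)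
   * hcoef k (enum_val i) (enum_val j)).

Definition cmx k : 'M[W]_#|J| := tmx p d B (@expo n N D A)
  (fun k (nu : Tm) => \prod_(l < N) (ahl W p_pr pE (nu l) * gamma ^+ nu l
      * (T (lamE l) ^+ (p ^ k)) ^+ nu l)) I k.

Lemma bmx_cmx k i j :
  p%:R ^+ (m + #|I|) * gamma ^+ wt (enum_val i) * bmx k i j
  = p%:R ^+ n * cmx k i j * gamma ^+ wt (enum_val j).
Proof.
rewrite [bmx _ _ _]mxE /wt; set u := enum_val i; set v := enum_val j.
have le := Jset_weight d_gt0 n_dm (enum_valP i).
have -> : cmx k i j = \sum_(nu : Tm | stepb p (expo A) nu u v)
    gamma ^+ (p * u ord_max - v ord_max) *
    \prod_(l < N) (ahl W p_pr pE (nu l) * (T (lamE l) ^+ (p ^ k)) ^+ nu l).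
  rewrite mxE -/u -/v; apply: eq_bigr => nu /forallP/(_ ord_max)/eqP e.
  have <- : (\sum_(l < N) nu l = p * u ord_max - v ord_max)%N.
    rewrite -e addnK /expo; apply: eq_bigr => l _; by rewrite aplus_max muln1.
  rewrite expr_sum -big_split; apply: eq_bigr => l _ /=; ring.
rewrite -mulr_sumr -/(hcoef k u v).
case: (boolP [exists nu : Tm, stepb p (expo A) nu u v]) => [/existsP[nu0 h]|h]; last first.
  have -> : hcoef k u v = 0.
    rewrite /hcoef big1 // => nu hnu; case/negP: h; apply/existsP; by exists nu.
  by rewrite !(mulr0, mul0r).
have le2 : (v ord_max <= p * u ord_max)%N.
  by move/forallP/(_ ord_max)/eqP: h => <-; rewrite leq_addl.
transitivity (p%:R ^+ (m + #|I| + excess u) * (gamma ^+ u ord_max * eta ^+ u ord_max)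
  * hcoef k u v).
  have aux (x1 x2 g e0 h0 : W) : x1 * g * (x2 * e0 * h0) = x1 * x2 * (g * e0) * h0 by ring.
  by rewrite aux -exprD.
have -> : (m + #|I| + excess u = u ord_max + n)%N by rewrite /excess [(m + _)%N]addnC subnKC.
transitivity (p%:R ^+ n * (gamma ^+ (p * u ord_max - v ord_max) * gamma ^+ v ord_max) * hcoef k u v); last first.
  have aux (x g1 g2 h0 : W) : x * (g1 * g2) * h0 = x * (g1 * h0) * g2 by ring.
  exact: aux.
rewrite -exprD subnK //.
have -> : gamma ^+ (p * u ord_max) = gamma ^+ u ord_max * (p%:R * eta) ^+ u ord_max.
  by rewrite -gammaX -exprM -exprD -mulSn prednK ?prime_gt0.
have aux (x1 x2 g e0 h0 : W) : x1 * x2 * (g * e0) * h0 = x2 * (g * (x1 * e0)) * h0 by ring.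
by rewrite exprMn exprD aux.
Qed.

Lemma mprod_bmx_cmx r i j :
  p%:R ^+ ((m + #|I|) * r) * gamma ^+ wt (enum_val i) * mprod bmx r i j
  = p%:R ^+ (n * r) * mprod cmx r i j * gamma ^+ wt (enum_val j).
Proof.
elim: r i j => [|r IH] i j /=.
  rewrite !muln0 !mxE !mul1r; case: eqP => [->|]; rewrite ?mulr0 ?mul0r //.
  by rewrite mulr1 mul1r.
rewrite [(bmx r *m _) _ _]mxE [(cmx r *m _) _ _]mxE !mulr_sumr mulr_suml.
apply: eq_bigr => k _; rewrite !mulnS !exprD.
have aux1 (x y g b m0 : W) : x * y * g * (b * m0) = y * (x * g * b) * m0 by ring.
have aux2 (y x c g m0 : W) : y * (x * c * g) * m0 = x * c * (y * g * m0) by ring.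
have aux3 (x c y m0 g : W) : x * c * (y * m0 * g) = x * y * (c * m0) * g by ring.
by rewrite -exprD aux1 bmx_cmx aux2 IH aux3.
Qed.

Lemma gamma_neq0 : gamma != 0.
Proof.
apply/eqP => h; have := gammaX; rewrite h expr0n; case: (_ == _) => /esym e.
  move/(congr1 (lred W)): e; rewrite rmorph1 rmorphM (lred_p W pE) mul0r.
  by move/eqP; rewrite eq_sym oner_eq0.
have : p%:R * eta = p%:R * 0 by rewrite e mulr0.
move/(lift_mulI (lift_nat_neq0 W (prime_gt0 p_pr))) => e0.
by move/eqP: red_eta; rewrite e0 rmorph0 eq_sym oppr_eq0 oner_eq0.
Qed.

Lemma trace_bmx_cmx r :
  p%:R ^+ ((m + #|I|) * r) * \tr (mprod bmx r) = p%:R ^+ (n * r) * \tr (mprod cmx r).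
Proof.
rewrite /mxtrace !mulr_sumr; apply: eq_bigr => i _.
set w := wt (enum_val i).
have g0 : gamma ^+ w != 0.
  rewrite -(inj_eq (@lval_inj _ _ W)) rmorphXn rmorph0 expf_neq0 //.
  by rewrite -(rmorph0 (lval W)) (inj_eq (@lval_inj _ _ W)) gamma_neq0.
apply: (lift_mulI g0); have := mprod_bmx_cmx r i i; rewrite -/w => e.
have aux1 (x g b : W) : g * (x * b) = x * g * b by ring.
by rewrite aux1 e mulrC.
Qed.
End Scaled.

Section ScaledTrace.
Variables (p r : nat) (E L : finFieldType) (W : padic_lift p E) (h : {rmorphism L -> E}).
Hypotheses (p_pr : prime p) (pE : p \in [pchar E]) (cardL : #|L| = (p ^ r)%N).
Local Notation T := (teich W).
Variables (F : finFieldType) (n d B N K D m : nat) (iota : {rmorphism F -> L}).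
Variables (A : 'I_N -> 'I_n.+1 -> nat) (lam : 'I_N -> F) (j : {rmorphism F -> E}).
Hypothesis h_iota : forall a, h (iota a) = j a.
Hypotheses (d_gt0 : (0 < d)%N) (A_hom : forall k, (\sum_(i < n.+1) A k i)%N = d).
Hypothesis n_dm : n = (d * m)%N.
Variables (gamma eta : W).
Hypotheses (gammaX : gamma ^+ p.-1 = p%:R * eta) (red_eta : lred W eta = -1).

(** With $Q=\#L$, the traces satisfy
    $Q^{m+\#I}\operatorname{tr}(\text{scaled})=Q^n\operatorname{tr}(\text{unscaled})$, so the
    factors $Q^{n+1-\#I}$ combine to one common $Q^{m+1}$ after $Q^n$ is cancelled. The remaining
    $Q-1$ is invertible. *)
Lemma scaled_trace : (0 < r)%N -> (N * (D * d) <= B * p.-1)%N ->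
  (forall v, congr_mod (p%:R ^+ K)
     (\prod_(i < r) theta p_pr pE D gamma (T (h v) ^+ (p ^ i)))
      (chi W p_pr cardL v)) ->
  congr_mod (p%:R ^+ K)
   (#|L|%:R * ((proj_count iota A lam)%:Z - \sum_(i < n) (#|L| ^ i)%N%:Z)%:~R)
   (#|L|%:R ^+ m.+1 * \sum_(I : {set 'I_n.+1}) (-1) ^+ #|I| *
       \tr (mprod (bmx p_pr pE d B D m A (fun l => j (lam l)) eta I) r)).
Proof.
move=> r0 hB H; have [t ht] := point_trace lam h_iota d_gt0 A_hom r0 hB H.
have Q1 := finNzRing_gt1 L.
have [y hy] : exists y : W, #|L|.-1%:R * y = 1.
  apply: lift_nat_inv => //; have : coprime p #|L|.-1.
    by rewrite -(coprime_pexpl _ _ r0) -cardL -{1}(prednK (ltnW Q1)) coprimeSn.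
  by rewrite prime_coprime.
exists (- (t * y)).
have QE : #|L|%:R = p%:R ^+ r :> W by rewrite cardL natrX.
set e := (_ - _)%:~R in ht *.
set S := \sum_I _ in ht; set S' := \sum_I _.
have SS : #|L|%:R ^+ n * S = #|L|.-1%:R * #|L|%:R ^+ n.+1 * #|L|%:R ^+ m * S'.
  rewrite /S /S' !mulr_sumr; apply: eq_bigr => I _.
  have cI : (#|~: I| + #|I| = n.+1)%N by rewrite addnC cardsC card_ord.
  have cQ : #|L|%:R ^+ n.+1 = #|L|%:R ^+ #|~: I| * #|L|%:R ^+ #|I| :> W.
    by rewrite -exprD cI.
  have := trace_bmx_cmx p_pr pE B D A (fun l => j (lam l)) d_gt0 n_dm gammaX red_eta I r.
  rewrite ![(_ * r)%N]mulnC !exprM -QE => e1.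
  have aux1 (a q s b t0 : W) : a * (q * s * b * t0) = q * s * b * (a * t0) by ring.
  rewrite aux1; move: e1; rewrite /cmx => <-; rewrite cQ exprD.
  have aux2 (q s b m0 i0 t0 : W) : q * s * b * (m0 * i0 * t0) = q * (b * i0) * m0 * (s * t0) by ring.
  exact: aux2.
have Qn0 : #|L|%:R ^+ n != 0 :> W by rewrite QE -exprM lift_pX_neq0.
apply: (lift_mulI Qn0); move: SS; rewrite ht => SS.
have aux (Qn Q q e0 P t0 y0 s : W) : q * y0 = 1 ->
    Qn * (Q * q * e0 + P * t0) = q * (Q * Qn) * s ->
    Qn * (Q * e0) = Qn * (Q * s + P * - (t0 * y0)).
  move=> h1 /(congr1 (fun x => x * y0)) h2.
  have -> : Qn * (Q * e0) = (q * y0) * (Qn * (Q * e0)) by rewrite h1 mul1r.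
  have -> : Qn * (Q * s + P * - (t0 * y0)) = (q * y0) * (Qn * (Q * s)) - Qn * P * t0 * y0.
    by rewrite h1; ring.
  have -> : q * y0 * (Qn * (Q * s)) = q * (Q * Qn) * s * y0 by ring.
  by rewrite -h2; ring.
rewrite exprS -mulrA; apply: aux hy _; rewrite SS exprS -!mulrA; congr (_ * _).
Qed.
End ScaledTrace.

(** * Characteristic series of matrices *)

Section DetSeries.
Variable R : comNzRingType.

Definition det1X s (B : 'M[R]_s) : {poly R} := \det (1%:M - 'X *: map_mx polyC B).

Lemma deriv_prod (I : finType) (f : I -> {poly R}) :
  (\prod_i f i)^`() = \sum_i (f i)^`() * \prod_(k | k != i) f k.
Proof.
suff H (s : seq I) : uniq s -> (\prod_(i <- s) f i)^`()
    = \sum_(i <- s) (f i)^`() * \prod_(k <- s | k != i) f k.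
  by rewrite H ?index_enum_uniq.
elim: s => [|i s IH] /=; first by rewrite !big_nil derivC.
move=> /andP[nis us]; rewrite !big_cons derivM IH // eqxx; congr (_ * _ + _).
  rewrite [RHS]big_seq_cond [LHS]big_seq; apply: eq_bigl => k.
  by case: eqVneq => [->|]; rewrite ?(negPf nis) ?andbT.
rewrite mulr_sumr; apply: eq_big_seq => k ks; rewrite big_cons.
have -> : i != k by apply: contraNneq nis => ->.
by rewrite mulrCA.
Qed.

Lemma deriv_det s (A : 'M[{poly R}]_s) :
  (\det A)^`() = \sum_i \sum_j (A i j)^`() * cofactor A i j.
Proof.
pose Ai i : 'M[{poly R}]_s := \matrix_(k, l) if k == i then (A k l)^`() else A k l.
transitivity (\sum_i \det (Ai i)); last first.
  apply: eq_bigr => i _; rewrite (expand_det_row _ i); apply: eq_bigr => j _.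
  rewrite mxE eqxx /cofactor; congr (_ * (_ * \det _)).
  by apply/matrixP => k l; rewrite !mxE eq_sym (negPf (neq_lift _ _)).
rewrite /determinant raddf_sum exchange_big; apply: eq_bigr => t _ /=.
have sgn (b : nat) (P : {poly R}) : ((-1) ^+ b * P)^`() = (-1) ^+ b * P^`().
  have -> : (-1) ^+ b = ((-1) ^+ b : R)%:P :> {poly R} by rewrite rmorphXn rmorphN1.
  by rewrite derivM derivC mul0r add0r.
rewrite sgn deriv_prod mulr_sumr; apply: eq_bigr => i _; congr (_ * _).
rewrite [RHS](bigD1 i) //= mxE eqxx; congr (_ * _); apply: eq_bigr => k ki.
by rewrite mxE (negPf ki).
Qed.

(* Compare coefficients in adj(A) A = det A for A = 1 - X B and in Jacobi's formula. *)
Lemma det1X_logder s (B : 'M[R]_s) :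
  logder (fun k => if k is 0 then 0 else - \tr (B ^+ k)) (fps_of_poly (det1X B)).
Proof.
pose A : 'M[{poly R}]_s := 1%:M - 'X *: map_mx polyC B.
pose C k : 'M[R]_s := \matrix_(i, j) (\adj A i j)`_k.
have Ccoef k : C k = ((det1X B)`_k)%:M + (if k is k'.+1 then C k' *m B else 0).
  apply/matrixP => i j; have := congr1 (fun M : 'M[{poly R}]_s => (M i j)`_k) (mul_adj_mx A).
  rewrite /A mulmxBr mulmx1 -scalemxAr !mxE coefB coefXM -/A.
  rewrite -/(det1X B) coefMn => /eqP; rewrite subr_eq => /eqP ->; congr (_ + _).
  case: k => [|k]; first by rewrite mxE.
  rewrite coef_sum !mxE; apply: eq_bigr => l _.
  by rewrite !mxE coefMC.
have CE k : C k = \sum_(i < k.+1) (det1X B)`_i *: B ^+ (k - i).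
  elim: k => [|k IH]; first by rewrite Ccoef big_ord1 addr0 scalemx1.
  rewrite Ccoef IH [RHS]big_ord_recr /= subnn expr0 scalemx1 [LHS]addrC; congr (_ + _).
  rewrite mulmx_suml; apply: eq_bigr => i _.
  by rewrite -scalemxAl subSn ?exprSr // -ltnS.
have dE k : (det1X B)`_k.+1 *+ k.+1 = - \tr (B *m C k).
  rewrite -coef_deriv /det1X deriv_det coef_sum /mxtrace -sumrN; apply: eq_bigr => i _.
  rewrite coef_sum mxE -sumrN; apply: eq_bigr => j _.
  have -> : (((1%:M - 'X *: map_mx polyC B) i j)^`() = (- B i j)%:P).
    rewrite !mxE derivB derivM derivX derivC mulr0 addr0 mul1r polyCN.
    by case: eqP => _; rewrite ?mulr1n ?mulr0n derivC add0r.
  by rewrite coefCM mulNr !mxE.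
apply: rec_logder => // -[|k]; first by rewrite mul0r big_ord0.
rewrite mulr_natl /fps_of_poly dE CE mulmx_sumr (raddf_sum (@mxtrace R s)) -sumrN.
apply: eq_bigr => i _; have ik : (i <= k)%N by rewrite -ltnS.
rewrite subSn // -scalemxAr /= mxtraceZ.
have -> : B *m B ^+ (k - i) = B ^+ (k - i).+1 by rewrite exprS.
by rewrite mulNr mulrC.
Qed.

Lemma det1X0 s (B : 'M[R]_s) : (det1X B)`_0 = 1.
Proof.
rewrite -horner_coef0 /det1X -[_.[0]]/(horner_eval 0 _) -det_map_mx.
have -> : map_mx (horner_eval 0) (1%:M - 'X *: map_mx polyC B) = 1%:M.
  apply/matrixP => i j; rewrite !mxE /horner_eval hornerD hornerN hornerM hornerX mul0r subr0.
  by case: eqP; rewrite ?mulr1n ?mulr0n hornerC.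
exact: det1.
Qed.

(** Sylvester's identity, from two triangular factorisations of the block matrix with rows $(1,A)$
    and $(B,1)$. *)
Lemma det1_mul_comm m s (A : 'M[R]_(m, s)) (B : 'M[R]_(s, m)) :
  \det (1%:M - A *m B) = \det (1%:M - B *m A).
Proof.
have e1 : block_mx 1%:M 0 B 1%:M *m block_mx 1%:M A 0 (1%:M - B *m A)
    = block_mx (1%:M - A *m B) A 0 1%:M *m block_mx 1%:M 0 B 1%:M.
  by rewrite !mulmx_block !(mulmx1, mul1mx, mulmx0, mul0mx, addr0, add0r) subrK addrCA subrr addr0.
have := congr1 determinant e1.
rewrite !det_mulmx !det_lblock !det_ublock !det1 !mul1r !mulr1.
by move=> ->.
Qed.

Lemma mprod_prod s (M : nat -> 'M[R]_s) a :
  mprod M a = \prod_(k < a) M (a.-1 - k)%N.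
Proof.
elim: a => [|a IH]; first by rewrite big_ord0.
rewrite big_ord_recl /= subn0 IH; congr (_ *m _); apply: eq_bigr => i _.
by rewrite /bump /= add1n; congr M; have := ltn_ord i; lia.
Qed.
End DetSeries.

Lemma det1_mul_commX (R : comNzRingType) m s (A : 'M[R]_(m, s)) (B : 'M[R]_(s, m)) :
  det1X (A *m B) = det1X (B *m A).
Proof.
rewrite /det1X !map_mxM scalemxAl det1_mul_comm -scalemxAr //.
Qed.

Section Restrict.
Variables (R : comNzRingType) (s t : nat) (f : 'I_t -> 'I_s) (M : nat -> 'M[R]_s).
Hypothesis M_rows : forall k i j, i \notin codom f -> M k i j = 0.
Hypothesis f_inj : injective f.

(** Zero rows give $M_k=PM'_k$ with $P$ the inclusion of the remaining indices. The full product is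
    $PY$ and the restricted one $YP$, so Sylvester's identity applies. *)
Lemma det1X_restrict a : (0 < a)%N ->
  det1X (mprod M a) = det1X (mprod (fun k => mxsub f f (M k)) a).
Proof.
pose P : 'M[R]_(s, t) := \matrix_(i, j) (i == f j)%:R.
pose M' k : 'M[R]_(t, s) := rowsub f (M k).
have PM k : M k = P *m M' k.
  apply/matrixP => i j; rewrite mxE; case: (boolP (i \in codom f)) => [/codomP[l ->]|h].
    rewrite (bigD1 l) //= !mxE eqxx mul1r big1 ?addr0 // => l' l'l.
    by rewrite !mxE (inj_eq f_inj) eq_sym (negPf l'l) mul0r.
  rewrite M_rows // big1 // => l _; rewrite mxE; case: eqP => [e|]; rewrite ?mul0r //.
  by case/negP: h; apply/codomP; exists l.
have M'P k : M' k *m P = mxsub f f (M k).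
  apply/matrixP => i j; rewrite !mxE (bigD1 (f j)) //= !mxE eqxx mulr1 big1 ?addr0 // => l lj.
  by rewrite !mxE (negPf lj) mulr0.
case: a => // a _.
have [Y [hY1 hY2]] : exists Y, mprod M a.+1 = P *m Y /\
    mprod (fun k => mxsub f f (M k)) a.+1 = Y *m P.
  elim: a => [|a [Y [hY1 hY2]]].
    by exists (M' 0%N); rewrite /= !mulmx1 M'P -PM.
  exists (M' a.+1 *m mprod M a.+1); split.
    by rewrite mulmxA -PM.
  by rewrite hY1 mulmxA M'P -mulmxA -hY2.
by rewrite hY1 hY2 det1_mul_commX.
Qed.
End Restrict.

(** * Reduction modulo p *)

(** [red] is defined by the fraction in lowest terms, whose denominator divides $b$; any denominator
    prime to $p$ computes the same residue. *)
Lemma red_pint (F : finFieldType) p r (a : int) b : prime p -> p \in [pchar F] ->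
  ~~ (p %| b)%N -> r * b%:R = a%:~R -> red F r * b%:R = a%:~R.
Proof.
move=> p_pr pF pb e.
have e2 : numq r * b%:Z = a * denq r.
  apply: (@intr_inj rat); rewrite !rmorphM /= -e -pmulrn.
  have d0 : (denq r)%:~R != 0 :> rat by rewrite intr_eq0 denq_neq0.
  by rewrite -{2}(divq_num_den r) mulrAC divfK.
have db : (`|denq r| %| b)%N.
  have : (denq r %| numq r * b%:Z)%Z by rewrite e2 dvdz_mull.
  by rewrite Gauss_dvdzr // coprimezE coprime_sym coprime_num_den.
have pd : ~~ (p %| `|denq r|)%N by apply: contra pb => h; apply: dvdn_trans db.
have d0 : (denq r)%:~R != 0 :> F by rewrite -(dvdz_pcharf pF).
rewrite /red mulrAC -[b%:R]/((b%:Z)%:~R) -rmorphM e2 rmorphM /= mulfK //.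
Qed.

(** Reconciles the enumeration bound [nubound] of [nusum] with the truncation degree [D] of the
    splitting function. *)
Lemma sum_ffun_bound (R : nmodType) (I : finType) (a b : nat)
  (P : (I -> nat) -> bool) (G : (I -> nat) -> R) :
  (forall nu : I -> nat, P nu -> forall i, nu i < minn a.+1 b.+1)%N ->
  \sum_(nu : {ffun I -> 'I_a.+1} | P (fun i => nu i)) G (fun i => nu i)
  = \sum_(nu : {ffun I -> 'I_b.+1} | P (fun i => nu i)) G (fun i => nu i).
Proof.
move=> H; pose ha (nu : {ffun I -> 'I_a.+1}) : {ffun I -> 'I_b.+1} := [ffun i => inord (nu i)].
pose hb (nu : {ffun I -> 'I_b.+1}) : {ffun I -> 'I_a.+1} := [ffun i => inord (nu i)].
have haE (nu : {ffun I -> 'I_a.+1}) : P (fun i => nu i) -> (fun i => ha nu i : nat) = (fun i => nu i : nat).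
  move=> h; apply/funext => i; rewrite ffunE inordK //.
  by have := H _ h i; rewrite leq_min => /andP[].
have hbE (nu : {ffun I -> 'I_b.+1}) : P (fun i => nu i) -> (fun i => hb nu i : nat) = (fun i => nu i : nat).
  move=> h; apply/funext => i; rewrite ffunE inordK //.
  by have := H _ h i; rewrite leq_min => /andP[].
have hab (nu : {ffun I -> 'I_a.+1}) : P (fun i => nu i) -> hb (ha nu) = nu.
  move=> h; apply/ffunP => i; apply: val_inj.
  have h2 : P (fun i => ha nu i) by rewrite haE.
  by have /= := congr1 (fun f => f i) (hbE _ h2); rewrite (congr1 (fun f => f i) (haE _ h)).
rewrite (reindex_onto hb ha) => [|nu h]; last exact: hab.
apply: eq_big => nu.
  apply/andP/idP => [[h1 /eqP h2]|h].
    by rewrite -h2 haE.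
  rewrite hbE // h; split=> //; apply/eqP.
  apply/ffunP => i; apply: val_inj.
  have h2 : P (fun i => hb nu i) by rewrite hbE.
  by have /= := congr1 (fun f => f i) (haE _ h2); rewrite (congr1 (fun f => f i) (hbE _ h)).
by move=> /andP[h1 /eqP h2]; rewrite -[in RHS]h2 haE.
Qed.

Lemma mu_dvd n d m : (1 < d)%N -> n = (d * m)%N -> mu n d = m.
Proof.
move=> d_gt1 ->; have d_gt0 := ltnW d_gt1.
have -> : mu (d * m) d = ((d + m * d) %/ d).-1.
  by rewrite /mu mulnC; congr (_ %/ _).-1; lia.
by rewrite divnDMl // divnn d_gt0.
Qed.

Section Reduction.
Variables (p : nat) (E : finFieldType) (W : padic_lift p E).
Hypotheses (p_pr : prime p) (pE : p \in [pchar E]).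
Local Notation T := (teich W).
Variables (F : finFieldType) (j : {rmorphism F -> E}).
Variables (n d B N D m : nat).
Variables (A : 'I_N -> 'I_n.+1 -> nat) (lam : 'I_N -> F).
Hypotheses (d_gt1 : (1 < d)%N) (n_dm : n = (d * m)%N).
Hypothesis A_hom : forall k, (\sum_(i < n.+1) A k i)%N = d.
Variable eta : W.
Hypothesis red_eta : lred W eta = -1.
Local Notation lamE := (fun l => j (lam l)).

Let d_gt0 : (0 < d)%N. Proof. exact: ltnW. Qed.
Let pF : p \in [pchar F].
Proof. by move: pE; rewrite !inE p_pr /= -(rmorph_nat j) fmorph_eq0. Qed.

Let mu_eq : mu n d = m. Proof. exact: mu_dvd. Qed.

Definition validnu (w target : 'I_n.+2 -> nat) (nu : 'I_N -> nat) : bool :=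
  [forall i : 'I_n.+2, (\sum_(l < N) nu l * aplus A l i + w i == target i)%N].

(** Once every $\nu_l$ is below $p$, the Artin-Hasse coefficients are $1/\nu_l!$ and $\prod\nu_l!$
    is prime to $p$, so the two sums agree term by term. *)
Lemma red_nusum (w target : 'I_n.+2 -> nat) k :
  (target ord_max <= p * m.+1)%N -> (target ord_max <= D)%N ->
  (forall nu, validnu w target nu -> forall l, (nu l < p)%N) ->
  j (nusum p d A w target (frobk p k lam))
  = \sum_(nu : {ffun 'I_N -> 'I_D.+1} | validnu w target (fun l => nu l))
      lred W (\prod_(l < N) (ahl W p_pr pE (nu l) * (T (lamE l) ^+ (p ^ k)) ^+ nu l)).
Proof.
move=> h1 h2 digits.
pose G (nu : 'I_N -> nat) := lred W (\prod_(l < N) (ahl W p_pr pE (nu l) * (T (lamE l) ^+ (p ^ k)) ^+ nu l)).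
rewrite -[RHS](@sum_ffun_bound _ _ (p * (mu n d).+1) D (validnu w target) G); last first.
  move=> nu /forallP/(_ ord_max)/eqP e l.
  have le : (nu l <= target ord_max)%N.
    rewrite -e; apply: leq_trans (leq_addr _ _).
    under eq_bigr => i _ do rewrite aplus_max muln1.
    by rewrite (bigD1 l) //= leq_addr.
  by rewrite leq_min mu_eq !ltnS (leq_trans le h1) (leq_trans le h2).
rewrite /nusum rmorph_sum; apply: eq_bigr => nu hnu.
rewrite rmorphM /G [RHS]rmorph_prod.
under [RHS]eq_bigr => l _ do rewrite rmorphM !rmorphXn /= lred_teich.
rewrite big_split /=; congr (_ * _); last first.
  by rewrite rmorph_prod; apply: eq_bigr => l _; rewrite /frobk !rmorphXn.
have nup l : (nu l < p)%N by exact: (digits _ hnu).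
have pfact : ~~ (p %| \prod_(l < N) (nu l)`!)%N.
  elim/big_ind: _ => [|x y|l _]; first by rewrite dvdn1 gtn_eqF ?prime_gt1.
    exact: ndvdM.
  apply/negP => h; have : (0 < logn p (nu l)`!)%N by rewrite logn_gt0 mem_primes p_pr fact_gt0.
  rewrite logn_fact // big_nat_cond big1 // => i /andP[/andP[i0 _] _].
  by rewrite divn_small // (leq_trans (nup l)) // -{1}[p]expn1 leq_exp2l ?prime_gt1.
have e : red F (1 / (\prod_(l < N) (nu l)`!)%:R) * (\prod_(l < N) (nu l)`!)%:R = 1.
  by apply: (red_pint (a := 1) p_pr pF pfact); rewrite div1r mulVf // (ndvd_neq0 _ pfact).
have f0 : (\prod_(l < N) (nu l)`!)%:R != 0 :> E by rewrite -(dvdn_pcharf pE).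
apply: (mulIf f0); have := congr1 j e; rewrite rmorphM rmorph_nat rmorph1 => ->.
rewrite natr_prod -big_split big1 // => l _ /=.
by have := congr1 (lred W) (ahl_fact W p_pr pE (nup l)); rewrite rmorphM rmorph1 rmorph_nat mulrC.
Qed.

Section RestrictRows.
Variables (I : {set 'I_n.+1}) (t : nat) (f : 'I_t -> 'I_#|Jset d B I|).
Hypothesis f_inj : injective f.
Hypothesis f_excess : forall i, excess m I (enum_val (f i)) = 0%N.
Hypothesis f_codom : forall i, excess m I (enum_val i) = 0%N -> i \in codom f.

Lemma map_mprod (R S : comNzRingType) (u : {rmorphism R -> S}) s (M : nat -> 'M[R]_s) a :
  map_mx u (mprod M a) = mprod (fun k => map_mx u (M k)) a.
Proof. by elim: a => [|a IH] /=; rewrite ?map_mx1 // map_mxM IH. Qed.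

Lemma map_det1X (R S : comNzRingType) (u : {rmorphism R -> S}) s (M : 'M[R]_s) :
  map_poly u (det1X M) = det1X (map_mx u M).
Proof.
rewrite /det1X -det_map_mx; congr (\det _); apply/matrixP => i k.
rewrite !mxE rmorphB rmorphM /= map_polyX map_polyC; congr (_ - _).
by case: eqP; rewrite ?mulr1n ?mulr0n ?rmorph1 ?rmorph0.
Qed.

(** Rows of positive excess vanish modulo $p$; on the others $\eta^w$ reduces to $(-1)^w$. *)
Lemma red_det1X a : (0 < a)%N ->
  map_poly (lred W) (det1X (mprod (bmx p_pr pE d B D m A lamE eta I) a))
  = det1X (mprod (fun k => \matrix_(i, i')
      ((-1) ^+ wt (enum_val (f i)) *
       lred W (hcoef W p_pr pE D A lamE k (enum_val (f i)) (enum_val (f i'))))) a).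
Proof.
move=> a0; set M := bmx _ _ _ _ _ _ _ _ _ _; set N' := (fun k => \matrix_(i, i') _).
have M_rows k i i' : i \notin codom f -> map_mx (lred W) (M k) i i' = 0.
  move=> hi; rewrite !mxE !rmorphM rmorphXn (lred_p W pE) expr0n.
  case: eqP => [e|]; last by rewrite !mul0r.
  by rewrite f_codom in hi.
transitivity (det1X (mprod (fun k => map_mx (lred W) (M k)) a)).
  by rewrite (map_det1X (lred W)) (map_mprod (lred W)).
transitivity (det1X (mprod (fun k => mxsub f f (map_mx (lred W) (M k))) a)).
  exact: (det1X_restrict M_rows f_inj a0).
suff -> : (fun k => mxsub f f (map_mx (lred W) (M k))) = N' by [].
apply/funext => k; apply/matrixP => i i'.
by rewrite !mxE !rmorphM !rmorphXn f_excess !expr0 mul1r red_eta.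
Qed.
End RestrictRows.

(** Every row has positive excess: with $c=\#I<n$ and $d\ge2$, $d(w+n-c)\ge c+2(n-c)>n=dm$. The
    restricted matrix is empty. *)
Lemma red_det1X_small (I : {set 'I_n.+1}) a : (0 < a)%N -> (#|I| < n)%N ->
  map_poly (lred W) (det1X (mprod (bmx p_pr pE d B D m A lamE eta I) a)) = 1.
Proof.
move=> a0 hI; pose f (i : 'I_0) : 'I_#|Jset d B I| :=
  match i with @Ordinal _ _ h => match notF h with end end.
rewrite (@red_det1X I 0 f) //; first by rewrite /det1X det_mx00.
- by case.
- by case.
move=> i; rewrite /excess; have uJ := enum_valP i; set u := enum_val i in uJ *.
have h : (#|I| <= d * wt u)%N := Jset_card uJ.
move=> /eqP; rewrite subn_eq0 => le; exfalso.
have {le} : (wt u + n <= #|I| + m)%N := le.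
move: (wt u) (#|I|) h hI => w c h hI le.
have : (d * (w + (n - c)) <= d * m)%N by rewrite leq_mul2l; lia.
rewrite mulnDr -n_dm; have : ((n - c) * 2 <= d * (n - c))%N.
  by rewrite mulnC leq_mul2r d_gt1 orbT.
by lia.
Qed.

Lemma mprod1 (R : comNzRingType) (M : nat -> 'M[R]_1) a :
  mprod M a = (\prod_(k < a) M (a.-1 - k)%N ord0 ord0)%:M.
Proof.
elim: a => [|a IH]; first by rewrite big_ord0.
rewrite big_ord_recl /= subn0 IH [M a]mx11_scalar -scalar_mxM; congr (_ * _)%:M.
  by rewrite mxE eqxx mulr1n.
apply: eq_bigr => i _; congr (M _ _ _).
by rewrite /bump /= add1n; have := ltn_ord i; lia.
Qed.

Lemma map_poly_1subX (R S : comNzRingType) (u : {rmorphism R -> S}) c :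
  map_poly u (1 - c *: 'X) = 1 - u c *: 'X.
Proof. by rewrite rmorphB rmorph1 /= map_polyZ map_polyX. Qed.

(** A row of excess 0 has weight $m$ and coordinate sum $dm=n$, with at least 1 in each of the $n$
    places of $I$; this forces $u=u^{(i_0)}$, and the product becomes one of scalars. *)
Lemma red_det1X_corank1 i0 a : (0 < a)%N -> (m.+1 <= B)%N -> (p * m.+1 <= D)%N ->
  map_poly (lred W) (det1X (mprod (bmx p_pr pE d B D m A lamE eta (~: [set i0])) a))
  = map_poly j (1 - (\prod_(k < a) gbar p d A i0 (frobk p (a.-1 - k)%N lam)) *: 'X).
Proof.
move=> a0 hB hD; set I := ~: [set i0].
have cI : #|I| = n by have := cardsC [set i0]; rewrite cards1 card_ord -/I => -[].
have uvB c : (uvec d i0 c < B.+1)%N.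
  by rewrite /uvec mu_eq; case: ifP => _; [lia | case: ifP => _; lia].
pose U : {ffun 'I_n.+2 -> 'I_B.+1} := [ffun c => Ordinal (uvB c)].
have UE c : (U c : nat) = uvec d i0 c by rewrite ffunE.
have uvw c : uvec d i0 (widen_ord (leqnSn n.+1) c) = (c != i0).
  by rewrite /uvec /= ltn_eqF // -val_eqE /=; case: eqP.
have uvm : uvec d i0 ord_max = m by rewrite /uvec eqxx mu_eq.
have sum_uv : (\sum_(c < n.+1) uvec d i0 (widen_ord (leqnSn n.+1) c) = n)%N.
  under eq_bigr => c _ do rewrite uvw.
  rewrite -[RHS]cI -sum1_card [RHS]big_mkcond; apply: eq_bigr => c _.
  by rewrite !inE; case: eqP.
have UJ : U \in Jset d B I.
  rewrite inE; apply/andP; split.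
    rewrite /homog UE uvm -n_dm; apply/eqP; rewrite -[RHS]sum_uv; apply: eq_bigr => c _.
    exact: UE.
  by apply/forall_inP => c; rewrite !inE UE uvw => ->.
pose f (i : 'I_1) : 'I_#|Jset d B I| := enum_rank_in UJ U.
have fE i : enum_val (f i) = U by rewrite enum_rankK_in.
rewrite (@red_det1X I 1 f) //.
- rewrite mprod1 map_poly_1subX.
  have -> (c : E) : det1X (c%:M : 'M_1) = 1 - c *: 'X.
    by rewrite /det1X det_mx11 !mxE mulr1n mulrC mul_polyC.
  congr (_ - _ *: _); rewrite rmorph_prod; apply: eq_bigr => k _.
  rewrite mxE !fE /gbar rmorphM rmorphXn rmorphN1 mu_eq /wt UE uvm; congr (_ * _).
  rewrite red_nusum.
  + rewrite /hcoef rmorph_sum; apply: eq_bigl => nu.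
    apply: eq_forallb => i; rewrite /expo addn0 UE.
    rewrite -[RHS](eqn_add2r (uvec d i0 i)); congr (_ == _).
    by rewrite mulnBl mul1n subnK // leq_pmull // prime_gt0.
  + by rewrite uvm leq_mul // leq_subr.
  + by rewrite uvm; apply: leq_trans hD; rewrite leq_mul // leq_subr.
  (* If $\nu_l\ge p$, then $pa_{cl}\le p-1$ for every coordinate $c$, so ${\bf a}_l=0$, against its
     degree $d>0$. *)
  move=> nu hnu l; rewrite ltnNge; apply/negP => pl.
  have A0 c : A l c = 0%N.
    have := forallP hnu (widen_ord (leqnSn n.+1) c); rewrite addn0 uvw => /eqP e.
    have h1 : (p * A l c <= (p - 1) * (c != i0))%N.
      rewrite -e (bigD1 l) //= aplus_widen; apply: leq_trans (leq_addr _ _).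
      by rewrite leq_mul2r pl orbT.
    move: h1 (prime_gt0 p_pr); case: (A l c) => // x h1 p0.
    have : (p <= p * x.+1)%N by rewrite leq_pmulr.
    by move: h1; case: (c != i0); rewrite ?muln1 ?muln0; lia.
  have := A_hom l; rewrite big1 // => e.
  by move: d_gt1; rewrite -e.
- by move=> i i' _; rewrite (ord1 i) (ord1 i').
- move=> i; rewrite fE /excess UE uvm cI; lia.
move=> i /eqP; rewrite /excess subn_eq0 cI addnC leq_add2l => le.
have uJ := enum_valP i; set u := enum_val i in le uJ.
have le2 : (n + m <= u ord_max + n)%N.
  by have := Jset_weight d_gt0 n_dm uJ; rewrite cI.
have um : u ord_max = m :> nat.
  by apply/eqP; rewrite eqn_leq le /=; move: le2; rewrite addnC leq_add2r.
apply/codomP; exists ord0; apply: enum_val_inj; rewrite fE -/u.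
move: uJ; rewrite inE => /andP[/eqP uh /forall_inP upos].
have lei (c : 'I_n.+1) : (uvec d i0 (widen_ord (leqnSn n.+1) c) <= u (widen_ord (leqnSn n.+1) c)
      ?= iff (uvec d i0 (widen_ord (leqnSn n.+1) c) == u (widen_ord (leqnSn n.+1) c)))%N.
  apply/leqif_eq; rewrite uvw; case: (eqVneq c i0) => //= ci.
  by apply: upos; rewrite !inE ci.
have [_ ] := leqif_sum (fun c (_ : true) => lei c).
rewrite uh um -n_dm sum_uv eqxx => /esym/forallP H.
apply/ffunP => c; apply: val_inj; apply/eqP.
case: (unliftP ord_max c) => [c'|] ->; last by rewrite /= um UE uvm.
have -> : lift ord_max c' = widen_ord (leqnSn n.+1) c'.
  by apply: val_inj; rewrite /= /bump leqNgt ltn_ord.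
by rewrite /= UE eq_sym; exact: (H c').
Qed.

(** For full $I$, excess 0 means weight $m+1=\mu+1$, so the surviving rows are those of [Umin], and
    $\eta^{\mu+1}$ supplies the sign of [Abar_entry]. *)
Lemma red_det1X_top a : (0 < a)%N -> (d * m.+1 <= B)%N -> (p * m.+1 <= D)%N ->
  map_poly (lred W) (det1X (mprod (bmx p_pr pE d B D m A lamE eta setT) a))
  = map_poly j (det1X (mprod (fun k => Abar p d A (frobk p k lam)) a)).
Proof.
move=> a0 hB hD; set I : {set 'I_n.+1} := setT.
have cI : #|I| = n.+1 by rewrite cardsT card_ord.
have ubE : ubound n d = (d * m.+1).+1 by rewrite /ubound mu_eq.
pose wd (u0 : {ffun 'I_n.+2 -> 'I_(ubound n d)}) : {ffun 'I_n.+2 -> 'I_B.+1} :=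
  [ffun c => inord (u0 c)].
have wdE u0 c : (wd u0 c : nat) = u0 c.
  rewrite ffunE inordK // ltnS (leq_trans _ hB) // -ltnS -ubE; exact: ltn_ord.
have sum_widen (u0 : 'I_n.+2 -> nat) : (\sum_(i < n.+2 | (i : nat) != n.+1) u0 i
    = \sum_(i < n.+1) u0 (widen_ord (leqnSn n.+1) i))%N.
  rewrite big_mkcond big_ord_recr /= eqxx addn0; apply: eq_bigr => i _.
  by rewrite /= ltn_eqF.
have UminP u0 : u0 \in Umin n d -> [/\ wd u0 \in Jset d B I, (u0 ord_max : nat) = m.+1 &
    forall i, (0 < u0 i)%N].
  rewrite mem_filter => /andP[/and3P[/eqP h1 /forallP h2 /eqP h3] _].
  rewrite mu_eq in h3; split=> //; rewrite inE; apply/andP; split.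
    rewrite /homog wdE -h1 sum_widen; apply/eqP/eq_bigr => i _; exact: wdE.
  by apply/forall_inP => i _; rewrite wdE.
pose un i := nth (u_default n d) (Umin n d) i.
have un_in (i : 'I_(size (Umin n d))) : un i \in Umin n d by rewrite mem_nth.
have unP (i : 'I_(size (Umin n d))) := UminP _ (un_in i).
have unJ (i : 'I_(size (Umin n d))) : wd (un i) \in Jset d B I by case: (unP i).
pose f (i : 'I_(size (Umin n d))) : 'I_#|Jset d B I| := enum_rank_in (unJ i) (wd (un i)).
have fE (i : 'I_(size (Umin n d))) : enum_val (f i) = wd (un i) by rewrite enum_rankK_in.
rewrite (@red_det1X I _ f) //.
- rewrite (map_det1X j) (map_mprod j).
  set M1 := (fun k => \matrix_(i, i') _); set M2 := (fun k => map_mx _ _).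
  suff -> : M1 = M2 by [].
  apply/funext => k; apply/matrixP => i i'; rewrite !mxE !fE /Abar_entry.
  have [_ wi ui] := unP i; have [_ wi' ui'] := unP i'.
  rewrite rmorphM rmorphXn rmorphN1 mu_eq /wt wdE wi; congr (_ * _).
  rewrite red_nusum -/(un i) -/(un i').
  + rewrite /hcoef rmorph_sum; apply: eq_bigl => nu.
    by apply: eq_forallb => c; rewrite /expo !wdE.
  + by rewrite wi.
  + by rewrite wi.
  (* If $\nu_l\ge p$, positivity of $v$ gives $a_{cl}<u_c$ for all $c$. Summing, $d+n+1\le
     d(m+1)=n+d$, a contradiction. *)
  move=> nu hnu l; rewrite ltnNge; apply/negP => pl.
  have h c : (A l c < un i (widen_ord (leqnSn n.+1) c))%N.
    have := forallP hnu (widen_ord (leqnSn n.+1) c) => /eqP e.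
    rewrite -(ltn_pmul2l (prime_gt0 p_pr)) -e (bigD1 l) //= aplus_widen.
    apply: (@leq_trans (nu l * A l c + un i' (widen_ord (leqnSn n.+1) c))%N).
      by rewrite -addn1 leq_add // leq_mul2r pl orbT.
    by rewrite leq_add2r leq_addr.
  have := unJ i; rewrite inE => /andP[/eqP uh _].
  have : (\sum_(c < n.+1) (A l c).+1 <= \sum_(c < n.+1) wd (un i) (widen_ord (leqnSn n.+1) c))%N.
    by apply: leq_sum => c _; rewrite wdE; apply: h.
  rewrite uh wdE wi; under eq_bigr => c _ do rewrite -addn1.
  by rewrite big_split /= A_hom sum1_card card_ord mulnS n_dm; lia.
- move=> i i' /(congr1 enum_val); rewrite !fE => e.
  apply: val_inj; apply/eqP => /=; rewrite -(nth_uniq (u_default n d) (ltn_ord i) (ltn_ord i')).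
    apply/eqP/ffunP => c; apply: val_inj => /=.
    by have := congr1 (fun g : {ffun _ -> 'I_B.+1} => g c : nat) e; rewrite !wdE.
  by rewrite filter_uniq // enum_uniq.
- by move=> i; rewrite fE /excess wdE cI; case: (unP i) => _ -> _; lia.
move=> i /eqP; rewrite /excess subn_eq0 cI => le.
have uJ := enum_valP i; set u := enum_val i in le uJ.
have le2 : (n.+1 + m <= u ord_max + n)%N.
  by have := Jset_weight d_gt0 n_dm uJ; rewrite cI.
have um : u ord_max = m.+1 :> nat.
  have {le} : (wt u + n <= n.+1 + m)%N := le.
  have {le2} : (n.+1 + m <= wt u + n)%N := le2.
  by rewrite -/(wt u); move: (wt u) => w; lia.
have uJ2 := uJ; move: uJ2; rewrite inE => /andP[/eqP uh /forall_inP upos].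
have ub c : (u c < ubound n d)%N.
  rewrite ubE ltnS; case: (unliftP ord_max c) => [c'|] ->; last first.
    by rewrite um -{1}[m.+1]mul1n leq_mul.
  have -> : lift ord_max c' = widen_ord (leqnSn n.+1) c'.
    by apply: val_inj; rewrite /= /bump leqNgt ltn_ord.
  by rewrite -um -uh (bigD1 c') //= leq_addr.
pose u0 : {ffun 'I_n.+2 -> 'I_(ubound n d)} := [ffun c => Ordinal (ub c)].
have u0E c : (u0 c : nat) = u c by rewrite ffunE.
have u0U : u0 \in Umin n d.
  rewrite mem_filter mem_enum andbT; apply/and3P; split.
  - rewrite sum_widen u0E -uh; apply/eqP/eq_bigr => c _; exact: u0E.
  - apply/forallP => c; rewrite u0E; case: (unliftP ord_max c) => [c'|] ->; last first.
      by rewrite um.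
    have -> : lift ord_max c' = widen_ord (leqnSn n.+1) c'.
      by apply: val_inj; rewrite /= /bump leqNgt ltn_ord.
    by apply: upos; rewrite inE.
  by rewrite u0E um mu_eq.
have ix : (index u0 (Umin n d) < size (Umin n d))%N by rewrite index_mem.
apply/codomP; exists (Ordinal ix); apply: enum_val_inj; rewrite fE -/u.
apply/ffunP => c; apply: val_inj => /=; rewrite wdE /un nth_index // u0E.
Qed.
End Reduction.

(** * Embeddings of finite fields *)

Lemma dvdp_XnX (F : fieldType) Q M : ('X^Q - 'X : {poly F}) %| 'X^(Q ^ M) - 'X.
Proof.
elim: M => [|M IH]; first by rewrite expn0 expr1 subrr dvdp0.
have -> : 'X^(Q ^ M.+1) - 'X = ('X^(Q ^ M) ^+ Q - 'X^Q) + ('X^Q - 'X) :> {poly F}.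
  by rewrite -exprM -expnSr addrA subrK.
by rewrite dvdp_add // subrXX dvdp_mulr.
Qed.

(** A generator $g$ of $L^*$ generates [L] over [F]. Its minimal polynomial divides $X^{\#L}-X$,
    which divides $X^{\#E}-X$ and so splits in [E]; sending $g$ to a root respects both copies of
    [F]. *)
Lemma finField_embedding (F L E : finFieldType) (iota : {rmorphism F -> L})
  (j : {rmorphism F -> E}) M : #|E| = (#|L| ^ M)%N ->
  exists h : {rmorphism L -> E}, forall a, h (iota a) = j a.
Proof.
move=> cE; have [g hg] := finField_prim_root L.
have L1 := finNzRing_gt1 L.
pose ev (K : finFieldType) (u : {rmorphism F -> K}) z P := (map_poly u P).[z].
have evM (K : finFieldType) (u : {rmorphism F -> K}) z P Q : ev K u z (P * Q) = ev K u z P * ev K u z Q.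
  by rewrite /ev rmorphM hornerM.
have evB (K : finFieldType) (u : {rmorphism F -> K}) z P Q : ev K u z (P - Q) = ev K u z P - ev K u z Q.
  by rewrite /ev rmorphB hornerD hornerN.
have evD (K : finFieldType) (u : {rmorphism F -> K}) z P Q : ev K u z (P + Q) = ev K u z P + ev K u z Q.
  by rewrite /ev rmorphD hornerD.
have evC (K : finFieldType) (u : {rmorphism F -> K}) z c : ev K u z c%:P = u c.
  by rewrite /ev map_polyC hornerC.
have surj y : exists P, ev L iota g P = y.
  case: (eqVneq y 0) => [->|y0]; first by exists 0; rewrite evC rmorph0.
  have yn : y ^+ #|L|.-1 = 1.
    by apply: (mulfI y0); rewrite mulr1 -exprS prednK ?expf_card // ltnW.
  have [i ->] := prim_rootP hg yn; exists 'X^i.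
  by rewrite /ev map_polyXn hornerXn.
pose annih k := `[< exists P : {poly F}, [/\ P != 0, size P = k & ev L iota g P = 0] >].
have evXX P : P = 'X^#|L| - 'X -> ev L iota g P = 0.
  by move=> ->; rewrite /ev rmorphB /= map_polyXn map_polyX !hornerE expf_card subrr.
have ex_annih : exists k, annih k.
  exists (size ('X^#|L| - 'X : {poly F})); apply/asboolP; exists ('X^#|L| - 'X).
  split=> //; last exact: evXX.
  by rewrite -size_poly_eq0 size_polyDl size_polyXn // size_polyN size_polyX.
case: (ex_minnP ex_annih) => k /asboolP[P0 [P00 sP0 eP0]] kmin.
have P0dvd P : ev L iota g P = 0 -> P0 %| P.
  move=> eP; apply: contraT => ndv; rewrite /dvdp in ndv.
  have : annih (size (P %% P0)).
    apply/asboolP; exists (P %% P0); split=> //.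
    have := congr1 (ev L iota g) (divp_eq P P0).
    by rewrite eP evD evM eP0 mulr0 add0r.
  by move/kmin; rewrite -sP0 leqNgt ltn_modp P00.
have sz0 : (1 < size P0)%N.
  rewrite ltnNge; apply/negP => /size1_polyC e; move: eP0 P00.
  rewrite e evC polyC_eq0 => /eqP; rewrite fmorph_eq0 => /eqP ->.
  by rewrite eqxx.
have [z hz] : exists z, ev E j z P0 = 0.
  have : map_poly j P0 %| \prod_(x <- enum E) ('X - x%:P).
    rewrite big_enum -finField_genPoly cE; apply: dvdp_trans (dvdp_XnX _ _ _).
    have -> : 'X^#|L| - 'X = map_poly j ('X^#|L| - 'X).
      by rewrite rmorphB /= map_polyXn map_polyX.
    by rewrite dvdp_map; apply: P0dvd; exact: evXX.
  case/dvdp_prod_XsubC => m; case E1 : (mask m (enum E)) => [|x s].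
    rewrite big_nil => /eqp_size; rewrite size_map_poly size_poly1 => e.
    by move: sz0; rewrite e.
  rewrite big_cons => /eqpP[[c1 c2] /= /andP[c10 c20] e]; exists x.
  have := congr1 (horner^~ x) e; rewrite !hornerZ hornerM hornerXsubC subrr mul0r mulr0.
  by move/eqP; rewrite mulf_eq0 (negPf c10) => /eqP.
have [s hs] := choice surj.
have key P P' : ev L iota g P = ev L iota g P' -> ev E j z P = ev E j z P'.
  move=> e; have /P0dvd/dvdpP[Q hQ] : ev L iota g (P - P') = 0 by rewrite evB e subrr.
  by apply/eqP; rewrite -subr_eq0 -evB hQ evM hz mulr0.
pose h y := ev E j z (s y).
have hP P : h (ev L iota g P) = ev E j z P by apply: key; rewrite hs.
have hB : zmod_morphism h.
  by move=> x y; rewrite /h -evB; apply: key; rewrite evB !hs.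
have hM : monoid_morphism h.
  split; last by move=> x y; rewrite /h -evM; apply: key; rewrite evM !hs.
  by have := hP 1; rewrite -[1 : {poly F}]/(1%:P) !evC !rmorph1.
pose hBm := GRing.isZmodMorphism.Build _ _ h hB.
pose hMm := GRing.isMonoidMorphism.Build _ _ h hM.
pose hR : {rmorphism L -> E} := HB.pack h hBm hMm.
by exists hR => a; have := hP a%:P; rewrite !evC.
Qed.

Lemma Fp_morphism (p : nat) (F : finFieldType) : p \in [pchar F] ->
  exists f : {rmorphism 'F_p -> F}, True.
Proof.
move=> pF; have p_pr := pcharf_prime pF.
pose f (x : 'F_p) : F := (x : nat)%:R.
have modE k : (k %% p)%:R = k%:R :> F.
  by rewrite [in RHS](divn_eq k p) natrD natrM (pcharf0 pF) mulr0 add0r.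
have pE := Fp_cast p_pr.
have fB : zmod_morphism f.
  move=> x y; have fD u v : f (u + v) = f u + f v.
    by rewrite /f -natrD -[RHS]modE; congr (_%:R); rewrite /=; congr (_ %% _)%N; exact: pE.
  by apply: (addIr (f y)); rewrite -fD !subrK.
have fM : monoid_morphism f.
  split; first by rewrite /f /= modn_small ?pE ?prime_gt1.
  move=> x y; rewrite /f -natrM -[RHS]modE.
  by congr (_%:R); rewrite /=; congr (_ %% _)%N; exact: pE.
pose fBm := GRing.isZmodMorphism.Build _ _ f fB.
pose fMm := GRing.isMonoidMorphism.Build _ _ f fM.
pose fR : {rmorphism 'F_p -> F} := HB.pack f fBm fMm.
by exists fR.
Qed.

Lemma finField_extension (p a M : nat) (F : finFieldType) :
  prime p -> (0 < M)%N -> #|F| = (p ^ a)%N ->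
  exists (E : finFieldType) (j : {rmorphism F -> E}), #|E| = (p ^ (a * M))%N.
Proof.
move=> p_pr M0 cF; have a0 : (0 < a)%N.
  by case: a cF => // h; have := finNzRing_gt1 F; rewrite h.
have aM0 : (0 < a * M)%N by rewrite muln_gt0 a0.
have [E pE cE] := pPrimePowerField p_pr aM0.
have [f _] := Fp_morphism (card_finPcharP cF p_pr).
have [f' _] := Fp_morphism pE.
have [|j _] := @finField_embedding 'F_p F E f f' M.
  by rewrite cE cF expnM.
by exists E, j.
Qed.

(** * The zeta function *)

Lemma logder_map (R S : comNzRingType) (u : {rmorphism R -> S}) (h f : fps R) :
  logder h f -> logder (u \o h) (u \o f).
Proof.
move=> hf; apply/funext => k; have := congr1 (fun F => u (F k)) hf.
by rewrite map_fps_mul /fps_dt rmorphM rmorph_nat.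
Qed.

Lemma logder_1subX (R : comNzRingType) (c : R) :
  logder (fun k => if k is 0 then 0 else - c ^+ k) (fps_of_poly (1 - c *: 'X)).
Proof.
have E k : (1 - c *: 'X : {poly R})`_k = (k == 0%N)%:R - c * (k == 1%N)%:R.
  by rewrite coefB coef1 coefZ coefX.
apply: rec_logder => // -[|k]; first by rewrite mul0r big_ord0.
rewrite /fps_of_poly E /= sub0r.
case: k => [|k]; first by rewrite big_ord1 E /= subn0 expr1; ring.
rewrite !big_ord_recl big1 => [|i _]; last by rewrite E /=; ring.
rewrite !E /bump /= subn0 subSS subn0 [c ^+ k.+2]exprS; ring.
Qed.

(** Passing to index $i+1$ divides by $i+1$, a loss of at most $p^{i+1}$, and $i^2+(i+1)\le(i+1)^2$.
    Accuracy $p^{k^2+1}$ on the logarithmic derivatives leaves $p^{k^2+1-i^2}$ on coefficient $i$,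
    still a multiple of $p$ at $i=k$. *)
Lemma logder_congr (p : nat) (E : finFieldType) (W : padic_lift p E) k
  (h1 h2 f1 f2 : fps algC) :
  prime p -> p \in [pchar E] ->
  h1 0%N = 0 -> h2 0%N = 0 -> f1 0%N = 1 -> f2 0%N = 1 ->
  logder h1 f1 -> logder h2 f2 ->
  (forall i, exists y, f2 i = lval W y) -> (forall i, exists y, h2 i = lval W y) ->
  (forall i, (0 < i)%N -> (i <= k)%N -> exists y, h1 i = h2 i + lval W (p%:R ^+ (k * k).+1 * y)) ->
  forall i, (i <= k)%N -> exists y, f1 i = f2 i + lval W (p%:R ^+ ((k * k).+1 - i * i) * y).
Proof.
move=> p_pr pE h10 h20 f10 f20 lh1 lh2 f2W h2W H i.
elim/ltn_ind: i => i IH ik.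
case: i IH ik => [|i] IH ik.
  by exists 0; rewrite mulr0 rmorph0 addr0 f10 f20.
pose c := ((k * k).+1 - i * i)%N.
have le1 : (i * i + i.+1 <= i.+1 * i.+1)%N by lia.
have le2 : (i.+1 * i.+1 <= k * k)%N by exact: leq_mul.
have step (l : 'I_i.+1) : exists y, h1 (i.+1 - l)%N * f1 l
    = h2 (i.+1 - l)%N * f2 l + lval W (p%:R ^+ c * y).
  have li := ltn_ord l.
  have [y1 e1] := IH l li (leq_trans (ltnW li) ik).
  have [|y2 e2] := H (i.+1 - l)%N _ (leq_trans (leq_subr _ _) ik); first by rewrite subn_gt0.
  have [z1 w1] := f2W l; have [z2 w2] := h2W (i.+1 - l)%N.
  have d1 : ((k * k).+1 - l * l = c + (i * i - l * l))%N.
    have : (l * l <= i * i)%N by apply: leq_mul; rewrite -ltnS.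
    by rewrite /c; lia.
  have d2 : ((k * k).+1 = c + i * i)%N by rewrite /c; lia.
  rewrite e1 e2 w1 w2 d1 d2 -!rmorphM -!rmorphD -!rmorphM.
  exists (p%:R ^+ (i * i) * y2 * (z1 + p%:R ^+ (c + (i * i - l * l)) * y1)
    + z2 * (p%:R ^+ (i * i - l * l) * y1)).
  rewrite -rmorphD; congr (lval W _).
  have aux (pc pi pd z1' z2' y1' y2' : W) :
     (z2' + pc * pi * y2') * (z1' + pc * pd * y1') = z2' * z1'
      + pc * (pi * y2' * (z1' + pc * pd * y1') + z2' * (pd * y1')) by ring.
  by rewrite !exprD aux.
have /choice[g hg] := step.
have in0 : i.+1%:R != 0 :> algC by rewrite pnatr_eq0.
have [b hb] := lift_div_nat W p_pr pE (ltn0Sn i).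
exists (p%:R ^+ (c - i.+1 - ((k * k).+1 - i.+1 * i.+1)) * b * \sum_l g l).
apply: (mulfI in0); rewrite mulrDr (logder_rec h10 lh1) (logder_rec h20 lh2).
rewrite (eq_bigr _ (fun l _ => hg l)) big_split /=; congr (_ + _).
rewrite -rmorph_sum -mulr_sumr -[i.+1%:R in RHS](rmorph_nat (lval W)) -rmorphM.
congr (lval W _).
have -> : c = (((k * k).+1 - i.+1 * i.+1) + (c - i.+1 - ((k * k).+1 - i.+1 * i.+1)) + i.+1)%N.
  by rewrite /c; lia.
rewrite [in LHS]exprD -hb [in LHS]exprD.
set x1 := ((k * k).+1 - _)%N; set x2 := (_ - _ - _)%N.
have aux (a1 a2 i1 b1 s : W) : a1 * a2 * (i1 * b1) * s = i1 * (a1 * (a2 * b1 * s)) by ring.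
rewrite aux; congr (_ * (_ * (_ * _ * _))); congr (_ ^+ _).
by rewrite /x2 /x1; lia.
Qed.

(** A rational number that lies in [W] has denominator prime to $p$: otherwise $p$ would also divide
    its numerator. *)
Lemma lred_rat (p : nat) (E F : finFieldType) (W : padic_lift p E) (j : {rmorphism F -> E})
  (r : rat) (y : W) : p \in [pchar E] -> lval W y = ratr r -> lred W y = j (red F r).
Proof.
move=> pE e.
have e2 : y * (denq r)%:~R = (numq r)%:~R.
  apply: (@lval_inj _ _ W); rewrite rmorphM e !rmorph_int -[(denq r)%:~R](ratr_int algC).
  rewrite -rmorphM -{1}(divq_num_den r) divfK ?rmorph_int //.
  by rewrite intr_eq0 denq_neq0.
have e3 := congr1 (lred W) e2; rewrite rmorphM !rmorph_int in e3.
have d0 : (denq r)%:~R != 0 :> E.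
  apply/eqP => d0; move: e3; rewrite d0 mulr0 => /esym/eqP n0.
  move/eqP: d0; rewrite -!(dvdz_pcharf pE) in n0 *; move: n0.
  rewrite !dvdzE /= => pn pd.
  have := coprime_num_den r; rewrite /coprime => /eqP cop.
  have := dvdn_gcd p `|numq r| `|denq r|; rewrite pn pd cop dvdn1.
  by rewrite gtn_eqF ?prime_gt1 // (pcharf_prime pE).
apply: (mulIf d0); rewrite e3 /red rmorphM fmorphV !rmorph_int divfK //.
Qed.

Section Zeta.
Variables (F : finFieldType) (L : nat -> finFieldType) (iota : forall s, {rmorphism F -> L s}).
Variables (q n N : nat) (A : 'I_N -> 'I_n.+1 -> nat) (lam : 'I_N -> F).

Definition excount (s : nat) : int :=
  (Npts iota A lam s)%:Z - \sum_(i < n) ((q ^ s) ^ i)%N%:Z.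

Lemma fps_exp0 (f : fps rat) : fps_exp f 0%N = 1.
Proof. by rewrite /fps_exp big_ord1 /= fact0 divr1. Qed.

Lemma Pzeta_logder :
  logder (fun s => if s is 0 then 0 else (-1) ^+ n * (excount s)%:~R) (Pzeta iota q A lam)
  /\ Pzeta iota q A lam 0%N = 1.
Proof.
pose pol : {poly rat} := \prod_(i < n) (1 - ((q ^ i)%N)%:R *: 'X).
have lpol : logder (fun k => \sum_(i < n) (if k is 0 then 0 else - ((q ^ i)%N)%:R ^+ k)) (fps_of_poly pol).
  by apply: logder_prod => i; exact: logder_1subX.
pose f : fps rat := fun s => if s == 0%N then 0 else (Npts iota A lam s)%:R / s%:R.
have lz := @logder_exp f erefl; rewrite -/(zeta iota A lam) in lz.
have pol0 : fps_of_poly pol 0%N = 1.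
  rewrite /fps_of_poly -horner_coef0 /pol horner_prod big1 // => i _.
  by rewrite hornerD hornerN hornerZ hornerX hornerC mulr0 subr0.
have lZQ := logderM lz lpol; set ZQ := fps_mul _ _ in lZQ.
have ZQ0 : ZQ 0%N = 1 by rewrite /ZQ fps_mul0 /zeta fps_exp0 pol0 mulr1.
have hE : fps_dt f \+
   (fun k => \sum_(i < n) (if k is 0 then 0 else - ((q ^ i)%N)%:R ^+ k))
   = (fun s => if s is 0 then 0 else (excount s)%:~R).
  apply/funext => -[|s] /=; first by rewrite /fps_dt mul0r add0r big1.
  rewrite /fps_dt /f /= mulrC divfK ?pnatr_eq0 // sumrN /excount rmorphB rmorph_sum /=.
  congr (_ - _); apply: eq_bigr => i _.
  by rewrite -natrX -pmulrn; congr (_%:R); rewrite -!expnM mulnC.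
rewrite hE in lZQ; rewrite /Pzeta -/pol -/ZQ -signr_odd.
case: (odd n); rewrite ?expr1 ?expr0; split=> //.
- have n0 : ZQ 0%N != 0 by rewrite ZQ0 oner_eq0.
  have := logder_inv n0 lZQ; congr (logder _ _).
  by apply/funext => -[|s]; rewrite ?oppr0 // mulN1r.
- by rewrite /fps_inv /= ZQ0 invr1.
by move: lZQ; congr (logder _ _); apply/funext => -[|s] //; rewrite mul1r.
Qed.
End Zeta.

(** * Assembly of the congruence with explicit precision *)

Section Main.
Variables (p a n d N : nat) (F : finFieldType).
Variables (A : 'I_N -> 'I_n.+1 -> nat) (lam : 'I_N -> F).
Variables (L : nat -> finFieldType) (iota : forall s, {rmorphism F -> L s}).
Hypotheses (p_pr : prime p) (a_gt0 : (0 < a)%N) (cardF : #|F| = (p ^ a)%N).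
Hypotheses (d_gt1 : (1 < d)%N) (dn : (d %| n)%N).
Hypothesis A_hom : forall j, (\sum_(i < n.+1) A j i)%N = d.
Hypothesis cardL : forall s, #|L s| = ((p ^ a) ^ s.+1)%N.

Let m := (n %/ d)%N.
Let n_dm : n = (d * m)%N. Proof. by rewrite mulnC divnK. Qed.
Let d_gt0 : (0 < d)%N. Proof. exact: ltnW. Qed.
Let p_gt0 := prime_gt0 p_pr.

Definition rhs_den : {poly F} := \prod_(i < n.+1)
  (1 - (\prod_(k < a) gbar p d A i (frobk p (a.-1 - k)%N lam)) *: 'X).

Definition rhs_num : {poly F} := det1X (mprod (fun k => Abar p d A (frobk p k lam)) a).

Section Bounded.
Variables (E : finFieldType) (j : {rmorphism F -> E}) (W : padic_lift p E).
Hypothesis pE : p \in [pchar E].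
Variables (k : nat).
Hypothesis h_ex : forall s, (s < k)%N -> exists h : {rmorphism L s -> E}, forall x, h (iota s x) = j x.

(** Division by $q^{s(m+1)}$ with $s\le k$ costs at most $ak(m+1)$ powers of $p$, and [logder_congr]
    needs $k^2+1$ more. In [D], $K(p-1)$ controls the tail of the splitting function and $p(m+1)$
    admits every $\nu$ of the reduced sums. In [B], $NDd$ bounds the exponents of a step and
    $d(m+1)$ contains [Umin]. *)
Let K := (a * k * m.+1 + (k * k).+1)%N.
Let D := (K * p.-1 + (p * m.+1).+1)%N.
Let B := (N * (D * d) + d * m.+1)%N.
Variables (gamma eta : W).
Hypotheses (gammaX : gamma ^+ p.-1 = p%:R * eta) (red_eta : lred W eta = -1).
Hypothesis splitting : forall r x l, x ^+ (p ^ r) = x -> l%:R = \sum_(i < r) x ^+ (p ^ i) ->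
  exists y, \prod_(i < r) (\sum_(t < D.+1) ahl W p_pr pE t * gamma ^+ t * (teich W x ^+ (p ^ i)) ^+ t)
        = lzeta W ^+ l + p%:R ^+ K * y.

Local Notation BI I := (mprod (bmx p_pr pE d B D m A (fun l => j (lam l)) eta I) a).

(** As $\lambda^q=\lambda$, the twists repeat after $a$ steps; the product over $as$ steps is then
    an $s$-th power. *)
Lemma bmx_periodic I i : bmx p_pr pE d B D m A (fun l => j (lam l)) eta I (a + i)
  = bmx p_pr pE d B D m A (fun l => j (lam l)) eta I i.
Proof.
apply/matrixP => u v; rewrite !mxE; congr (_ * _); apply: eq_bigr => nu _.
apply: eq_bigr => l _; congr (_ * _ ^+ _).
by rewrite expnD exprM -teichX -rmorphXn -cardF expf_card.
Qed.

Lemma excount_trace s : (0 < s)%N -> (s <= k)%N -> exists y : W,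
  (p ^ a)%N%:R ^+ s * (excount iota (p ^ a) A lam s)%:~R
  = ((p ^ a)%N%:R ^+ s) ^+ m.+1 * (\sum_(I : {set 'I_n.+1}) (-1) ^+ #|I| * \tr (BI I ^+ s))
    + p%:R ^+ K * y.
Proof.
case: s => // s _ sk; have [h hh] := h_ex sk.
have cL : #|L s| = (p ^ (a * s.+1))%N by rewrite cardL expnM.
have r0 : (0 < a * s.+1)%N by rewrite muln_gt0 a_gt0.
have hB : (N * (D * d) <= B * p.-1)%N.
  have p1 : (0 < p.-1)%N by have := prime_gt1 p_pr; case: (p) => [|[]].
  by apply: leq_trans (leq_pmulr _ p1); rewrite /B leq_addr.
have th v : congr_mod (p%:R ^+ K)
     (\prod_(i < a * s.+1) theta p_pr pE D gamma (teich W (h v) ^+ (p ^ i)))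
     (chi W p_pr cL v).
  exact: (chi_splitting h p_pr cL (theta := theta p_pr pE D gamma) splitting v).
have [y hy] := scaled_trace lam hh d_gt0 A_hom n_dm gammaX red_eta r0 hB th.
exists y; move: hy.
have -> : #|L s|%:R = (p ^ a)%N%:R ^+ s.+1 :> W by rewrite cardL natrX.
rewrite /excount /Npts /= -cardL => ->; congr (_ * _ + _).
apply: eq_bigr => I _; congr (_ * \tr _); apply: mprod_iter => i.
exact: bmx_periodic.
Qed.

Let q : rat := (p ^ a)%N%:R.
Definition scaledP : fps rat := fun i => q ^- (m * i) * Pzeta iota (p ^ a) A lam i.
Let cc (s : nat) : rat := if s is 0 then 0 else
  (-1) ^+ n * (excount iota (p ^ a) A lam s)%:~R * q ^- (m * s).

Lemma scaledP_logder : logder cc scaledP /\ scaledP 0%N = 1.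
Proof.
have [h h0] := Pzeta_logder iota (p ^ a) A lam; split; last first.
  by rewrite /scaledP h0 muln0 expr0 invr1 mulr1.
have := logder_subst (q ^- m) h; congr (logder _ _); apply/funext => i.
  by case: i => [|i]; rewrite /cc ?mul0r // exprM exprVn.
by rewrite /scaledP mulrC exprM exprVn.
Qed.

(** The traces of $I$ enter with sign $(-1)^{n+\#I}$, while $\det(1-tB)$ has logarithmic derivative
    $-\sum\operatorname{tr}(B^s)t^s$. Odd sets therefore belong to the numerator. *)
Definition odd_sgn (I : {set 'I_n.+1}) := odd (n + #|I|).

Definition Delta_even : {poly W} := \prod_(I <- [seq I <- enum {set 'I_n.+1} | ~~ odd_sgn I]) det1X (BI I).
Definition Delta_odd : {poly W} := \prod_(I <- [seq I <- enum {set 'I_n.+1} | odd_sgn I]) det1X (BI I).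

Let trace_pow I (s : nat) : W := if s is 0 then 0 else - \tr (BI I ^+ s).

Lemma cc_trace s : (0 < s)%N -> (s <= k)%N -> exists y : W,
  ratr (cc s) = lval W (\sum_(I <- [seq I <- enum {set 'I_n.+1} | odd_sgn I]) trace_pow I s)
    - lval W (\sum_(I <- [seq I <- enum {set 'I_n.+1} | ~~ odd_sgn I]) trace_pow I s)
    + lval W (p%:R ^+ (k * k).+1 * y).
Proof.
move=> s0 sk; have [y hy] := excount_trace s0 sk.
exists ((-1) ^+ n * (p%:R ^+ (a * k * m.+1 - a * s * m.+1) * y)).
set S := \sum_I _ in hy.
have -> : \sum_(I <- [seq I <- enum {set 'I_n.+1} | odd_sgn I]) trace_pow I s
   = \sum_(I : {set 'I_n.+1} | odd_sgn I) - \tr (BI I ^+ s).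
  by rewrite big_filter big_enum_cond; case: (s) s0.
have -> : \sum_(I <- [seq I <- enum {set 'I_n.+1} | ~~ odd_sgn I]) trace_pow I s
   = \sum_(I : {set 'I_n.+1} | ~~ odd_sgn I) - \tr (BI I ^+ s).
  by rewrite big_filter big_enum_cond; case: (s) s0.
rewrite -rmorphB.
have -> : \sum_(I | odd_sgn I) - \tr (BI I ^+ s) - \sum_(I | ~~ odd_sgn I) - \tr (BI I ^+ s)
    = (-1) ^+ n * S.
  rewrite /S mulr_sumr [RHS](bigID odd_sgn) /=; congr (_ + _); last rewrite -sumrN.
    apply: eq_bigr => I hI; rewrite mulrA -exprD -signr_odd -/(odd_sgn I) hI expr1.
    by rewrite mulN1r.
  apply: eq_bigr => I hI; rewrite mulrA -exprD -signr_odd -/(odd_sgn I) (negPf hI) expr0.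
  by rewrite mul1r opprK.
have ccE : cc s = (-1) ^+ n * (excount iota (p ^ a) A lam s)%:~R * q ^- (m * s) by case: (s) s0.
rewrite ccE -rmorphD; set e := excount _ _ _ _ _ in hy *.
set v := lval W; pose Q : algC := (p ^ a)%N%:R ^+ s.
have Q0 : Q != 0 by rewrite expf_neq0 // pnatr_eq0 expn_eq0 negb_and -lt0n p_gt0.
have QE : (p%:R : algC) ^+ (a * s) = Q by rewrite /Q natrX exprM.
have vq : v ((p ^ a)%N%:R ^+ s) = Q by rewrite rmorphXn /= rmorph_nat.
have vp i : v (p%:R ^+ i) = p%:R ^+ i by rewrite rmorphXn /= rmorph_nat.
have vs : v ((-1) ^+ n) = (-1) ^+ n by rewrite rmorphXn /= rmorphN1.
have rs : ratr ((-1) ^+ n) = (-1) ^+ n :> algC by rewrite rmorphXn /= rmorphN1.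
have rq : ratr (q ^+ (m * s)) = Q ^+ m by rewrite rmorphXn /= ratr_nat /Q -exprM mulnC.
have hy2 : Q * e%:~R = Q ^+ m.+1 * v S + p%:R ^+ K * v y.
  have := congr1 v hy; rewrite rmorphM vq [v e%:~R]rmorph_int => ->.
  by rewrite rmorphD [v (_ * S)]rmorphM [v (_ ^+ m.+1)]rmorphXn vq rmorphM vp.
have -> : ratr ((-1) ^+ n * e%:~R * q ^- (m * s)) = (-1) ^+ n * e%:~R * Q ^- m :> algC.
  by rewrite [ratr _]rmorphM /= [ratr (_ * e%:~R)]rmorphM /= fmorphV /= rq rs ratr_int.
have Qm0 : Q ^+ m.+1 != 0 by rewrite expf_neq0.
apply: (mulfI Qm0).
have -> : Q ^+ m.+1 * ((-1) ^+ n * e%:~R * Q ^- m) = (-1) ^+ n * (Q * e%:~R).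
  have Qm : Q ^+ m != 0 by rewrite expf_neq0.
  rewrite exprS; transitivity ((-1) ^+ n * (Q * e%:~R) * (Q ^+ m * Q ^- m)); first by ring.
  by rewrite mulfV // mulr1.
rewrite hy2 rmorphD !rmorphM vs !vp.
have -> : p%:R ^+ K = Q ^+ m.+1 * (p%:R ^+ (k * k).+1 * p%:R ^+ (a * k * m.+1 - a * s * m.+1)) :> algC.
  rewrite -QE -exprM -!exprD; congr (_ ^+ _); rewrite /K.
  have : (a * s * m.+1 <= a * k * m.+1)%N by rewrite leq_mul2r leq_mul2l sk !orbT.
  by lia.
by ring.
Qed.

Lemma Delta_logder (P : pred {set 'I_n.+1}) :
  logder (lval W \o (fun s => \sum_(I <- [seq I <- enum {set 'I_n.+1} | P I]) trace_pow I s))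
    (lval W \o fps_of_poly (\prod_(I <- [seq I <- enum {set 'I_n.+1} | P I]) det1X (BI I))).
Proof. by apply: logder_map; apply: logder_prod => I; exact: det1X_logder. Qed.

Lemma Delta0 (P : pred {set 'I_n.+1}) :
  (\prod_(I <- [seq I <- enum {set 'I_n.+1} | P I]) det1X (BI I))`_0 = 1.
Proof.
rewrite -horner_coef0 horner_prod big1 // => I _.
by rewrite horner_coef0 det1X0.
Qed.

(** [Delta_even] has constant term 1, so the congruence between $P(q^{-m}t)$ times [Delta_even] and
    [Delta_odd] can be solved for the coefficients of $P(q^{-m}t)$ one at a time, which places them
    in [W]. *)
Lemma scaledP_lift : exists y : nat -> W, (forall i, (i <= k)%N -> lval W (y i) = ratr (scaledP i))
  /\ forall i, (i <= k)%N -> lred W (fps_mul y (fps_of_poly Delta_even) i) = lred W Delta_odd`_i.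
Proof.
have [lP P0] := scaledP_logder.
pose Rc : fps algC := fun i => ratr (scaledP i).
have lR : logder (fun i => ratr (cc i)) Rc := logder_map (ratr : {rmorphism rat -> algC}) lP.
have lQ := logderM lR (Delta_logder (fun I => ~~ odd_sgn I)); rewrite -/Delta_even in lQ.
have l2 := Delta_logder odd_sgn; rewrite -/Delta_odd in l2.
have tr0 (P : pred {set 'I_n.+1}) : \sum_(I <- [seq I <- enum {set 'I_n.+1} | P I]) trace_pow I 0 = 0.
  by rewrite big1.
have congrQ i (ik : (i <= k)%N) : exists y, fps_mul Rc (lval W \o fps_of_poly Delta_even) i
   = lval W Delta_odd`_i + lval W (p%:R * y).
  have [] := logder_congr (W := W) (k := k) p_pr pE _ _ _ _ lQ l2 _ _ _ ik.
  - by rewrite /= tr0 !rmorph0 addr0.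
  - by rewrite /= tr0 rmorph0.
  - by rewrite fps_mul0 /Rc P0 rmorph1 mul1r /= /fps_of_poly Delta0 rmorph1.
  - by rewrite /= /fps_of_poly Delta0 rmorph1.
  - by move=> l; exists Delta_odd`_l.
  - by move=> l; exists (\sum_(I <- [seq I <- enum {set 'I_n.+1} | odd_sgn I]) trace_pow I l).
  - move=> l l0 lk; have [y hy] := cc_trace l0 lk; exists y.
    by rewrite /= hy addrAC subrK.
  move=> y hy; exists (p%:R ^+ (k * k - i * i) * y); rewrite hy; congr (_ + lval W _).
  by rewrite mulrA -exprS subSn // leq_mul.
have ylift i : (i <= k)%N -> exists y, lval W y = Rc i.
  elim/ltn_ind: i => i IH ik.
  have [y hy] := congrQ i ik.
  have /choice[g hg] : forall l : 'I_i, exists z, lval W z = Rc l.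
    by move=> l; apply: IH => //; apply: leq_trans ik; apply: ltnW.
  exists (Delta_odd`_i + p%:R * y - \sum_(l < i) g l * Delta_even`_(i - l)).
  rewrite rmorphB rmorphD -hy /fps_mul big_ord_recr /= subnn /fps_of_poly Delta0 rmorph1 mulr1.
  rewrite rmorph_sum addrAC; apply/eqP; rewrite -subr_eq0 addrK subr_eq0; apply/eqP.
  by apply: eq_bigr => l _; rewrite rmorphM hg.
have [y hy] : exists y : nat -> W, forall i, (i <= k)%N -> lval W (y i) = Rc i.
  have /choice[g hg] : forall i, exists z, (i <= k)%N -> lval W z = Rc i.
    move=> i; case: (leqP i k) => ik; last by exists 0.
    by have [z hz] := ylift i ik; exists z.
  by exists g.
exists y; split=> // i ik; have [z hz] := congrQ i ik.
have : fps_mul y (fps_of_poly Delta_even) i = Delta_odd`_i + p%:R * z.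
  apply: (@lval_inj _ _ W); rewrite map_fps_mul rmorphD -hz.
  by apply: eq_fps_mul => // l li; rewrite /= hy // (leq_trans li).
move=> ->; by rewrite rmorphD rmorphM (lred_p W pE) mul0r addr0.
Qed.

Let hBm : (m.+1 <= B)%N.
Proof. by rewrite /B (leq_trans _ (leq_addl _ _)) // leq_pmull. Qed.
Let hBd : (d * m.+1 <= B)%N. Proof. by rewrite /B leq_addl. Qed.
Let hD : (p * m.+1 <= D)%N.
Proof. by rewrite /D (leq_trans _ (leq_addl _ _)). Qed.

Lemma card_cases (I : {set 'I_n.+1}) : [\/ (#|I| < n)%N, #|I| = n | I = setT].
Proof.
have h : (#|I| <= n.+1)%N by have := max_card (mem I); rewrite card_ord.
case: (ltngtP #|I| n) => c; [by constructor 1 | constructor 3 | by constructor 2].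
apply/eqP; rewrite eqEcard subsetT cardsT card_ord; exact: c.
Qed.

Lemma odd_sgn_T : odd_sgn setT.
Proof. by rewrite /odd_sgn cardsT card_ord addnS /= oddD addbb. Qed.

Lemma odd_sgn_n (I : {set 'I_n.+1}) : #|I| = n -> odd_sgn I = false.
Proof. by rewrite /odd_sgn => ->; rewrite oddD addbb. Qed.

Lemma red_Delta_even : map_poly (lred W) Delta_even = map_poly j rhs_den.
Proof.
rewrite /Delta_even big_filter big_enum_cond rmorph_prod /=.
rewrite (bigID (fun I : {set 'I_n.+1} => #|I| == n)) /= [X in _ * X]big1 ?mulr1; last first.
  move=> I /andP[h1 h2]; apply: (red_det1X_small p_pr pE j B D A lam d_gt1 n_dm) => //.
  by case: (card_cases I) => // e; [rewrite e eqxx in h2 | rewrite e odd_sgn_T in h1].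
rewrite /rhs_den rmorph_prod (reindex_inj (@setC_inj _)) /=.
rewrite (eq_bigl (fun I : {set 'I_n.+1} => #|I| == 1%N)); last first.
  move=> I; have cI : (#|I| + #|~: I| = n.+1)%N by rewrite cardsC card_ord.
  apply/andP/eqP => [[_ /eqP e]|e].
    by move: cI; rewrite e; lia.
  have e' : #|~: I| = n by move: cI; rewrite e; lia.
  by rewrite e' eqxx odd_sgn_n.
rewrite big_cards1; apply: eq_bigr => i _.
exact: red_det1X_corank1.
Qed.

Lemma red_Delta_odd : map_poly (lred W) Delta_odd = map_poly j rhs_num.
Proof.
rewrite /Delta_odd big_filter big_enum_cond rmorph_prod /= (bigD1 setT) ?odd_sgn_T //=.
rewrite [X in _ * X]big1 ?mulr1; last first.
  move=> I /andP[h1 h2]; apply: (red_det1X_small p_pr pE j B D A lam d_gt1 n_dm) => //.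
  by case: (card_cases I) => // e; [rewrite odd_sgn_n in h1 | rewrite e eqxx in h2].
exact: red_det1X_top.
Qed.

Lemma bounded_congruence i : (i <= k)%N ->
  fps_mul (fun l => red F (scaledP l)) (fps_of_poly rhs_den) i = rhs_num`_i.
Proof.
move=> ik; have [y [hy1 hy2]] := scaledP_lift.
apply: (fmorph_inj j); have := hy2 i ik; rewrite -!coef_map red_Delta_odd => <-.
rewrite !map_fps_mul; apply: eq_fps_mul => l li /=.
  by apply/esym/(lred_rat j pE); rewrite hy1 // (leq_trans li).
by rewrite /fps_of_poly -!coef_map red_Delta_even.
Qed.
End Bounded.

Lemma main_congruence i :
  fps_mul (fun l => red F (scaledP l)) (fps_of_poly rhs_den) i = fps_of_poly rhs_num i.
Proof.
pose M := (i.+1)`!.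
(* Degree $(i+1)!$ over [F] makes [E] contain a copy of every extension of degree at most $i$, so a
   single ring [W] serves all the counts involved. *)
have [E [j cE]] := finField_extension p_pr (fact_gt0 i.+1) cardF.
have pE : p \in [pchar E] := card_finPcharP cE p_pr.
have [W] := padic_lift_exists p_pr cE.
pose K := (a * i * m.+1 + (i * i).+1)%N.
have [|gamma [eta [h1 h2 h3]]] := ah_splitting W p_pr pE (K := K) (D := K * p.-1 + (p * m.+1).+1) _ (leq_addr _ _).
  by rewrite addnS.
apply: (bounded_congruence (j := j) (W := W) (pE := pE) (k := i) _ h1 h2 h3) => // s si.
have [t ht] : exists t, ((i.+1)`! = s.+1 * t)%N.
  by have /dvdnP[t ->] := dvdn_fact (ltnW si : (0 < s.+1 <= i.+1)%N); exists t; rewrite mulnC.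
apply: (@finField_embedding _ _ _ (iota s) j t).
by rewrite cE cardL ht -!expnM mulnA.
Qed.
End Main.

Theorem theorem6p2 (p a n d N : nat) (F : finFieldType)
  (A : 'I_N -> 'I_n.+1 -> nat) (lam : 'I_N -> F)
  (L : nat -> finFieldType) (iota : forall s, {rmorphism F -> L s}) :
  prime p -> (1 <= a)%N -> #|F| = (p ^ a)%N ->
  (1 <= n)%N -> (2 <= d)%N -> (d %| n)%N ->
  (forall j, (\sum_(i < n.+1) A j i)%N = d) ->
  (forall s, #|L s| = ((p ^ a) ^ s.+1)%N) ->
  forall m : nat,
    red F (((p ^ a)%N%:R : rat) ^- (mu n d * m) * Pzeta iota (p ^ a) A lam m)
    = rhs_series p a d A lam m.
Proof.
move=> p_pr a0 cF n0 d1 dn A_hom cL i.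
have den0 : fps_of_poly (rhs_den p a d A lam) 0%N != 0.
  rewrite /fps_of_poly -horner_coef0 /rhs_den horner_prod big1 ?oner_eq0 // => l _.
  by rewrite hornerD hornerN hornerZ hornerX hornerC mulr0 subr0.
have H := fps_mul_inv_eq den0 (funext (main_congruence lam iota p_pr a0 cF d1 dn A_hom cL)).
have := congr1 (fun f => f i) H.
rewrite /scaledP -(mu_dvd d1 (etrans (esym (divnK dn)) (mulnC _ _))) => ->.
by rewrite /rhs_series /rhs_num /det1X mprod_prod.
Qed.
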